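(* If $n\ge3$ and $1<p<1+\frac4n$, there exists $\lambda<\frac{(n-1)^2}{4}$ such that the radial critical element $v_c$ associated with $\lambda$ satisfies $E_\lambda(v_c(0))<E_\lambda(Q_\lambda)$.
   Context: Hyperbolic space: $\mathbb{H}^n=\{x\in\mathbb{R}^{n+1}: [x,x]=1,\ x_0>0\}$, where $[x,y]=x_0y_0-x_1y_1-\dots-x_ny_n$, with the Riemannian metric induced by $-(dx_0)^2+(dx_1)^2+\dots+(dx_n)^2$, measure $\mu$, gradient $\nabla$ and (nonpositive) Laplace-Beltrami operator $\Delta$. The origin is $0=(1,0,\dots,0)$, and a function is radial if it depends only on the geodesic distance $r=d(x,0)$. $H^1(\mathbb{H}^n)$ is the usual Sobolev space of complex-valued functions. Equation (NLS): $i\partial_t u+\Delta u+|u|^{p-1}u=0$, $u|_{t=0}=u_0\in H^1(\mathbb{H}^n)$; it is locally well posed in $H^1$ with a unique maximal solution $u\in C^0((-T_-,T_+),H^1)$. $u$ scatters forward in time if $T_+=+\infty$ and there is $v_0\in H^1$ with $\lim_{t\to+\infty}\|e^{it\Delta}v_0-u(t)\|_{H^1}=0$; similarly backward in time. For $\lambda<\frac{(n-1)^2}4$ and $f\in H^1(\mathbb{H}^n)$: $\|f\|_{\mathcal{H}_\lambda}^2=\int|\nabla f|^2d\mu-\lambda\int|f|^2d\mu$ (a norm equivalent to the $H^1$ norm), and $E_\lambda(f)=\frac12\|f\|_{\mathcal{H}_\lambda}^2-\frac1{p+1}\|f\|_{L^{p+1}}^{p+1}$. Ground states: $\mathcal{Q}_\lambda$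 is the set of positive radial functions $Q\in H^1(\mathbb{H}^n)$ that attain $\frac1{D_\lambda}=\min_{f\in H^1\setminus\{0\}}\|f\|_{\mathcal{H}_\lambda}^2/\|f\|_{L^{p+1}}^2$ and solve $-\Delta Q-\lambda Q=|Q|^{p-1}Q$; it is nonempty. $Q_\lambda$ denotes an arbitrary element of $\mathcal{Q}_\lambda$; $E_\lambda(Q_\lambda)$ and $\|Q_\lambda\|_{\mathcal{H}_\lambda}$ do not depend on the choice. Critical element: for each $\lambda<\frac{(n-1)^2}{4}$ (and $1<p<1+\frac4{n-2}$), $v_c$ denotes a global, radial, nonscattering (neither forward nor backward in time) solution of (NLS) such that $\{v_c(t):t\in\mathbb{R}\}$ has compact closure in $H^1(\mathbb{H}^n)$, $E_\lambda(v_c(0))\le E_\lambda(Q_\lambda)$, $\|v_c(0)\|_{\mathcal{H}_\lambda}\le\|Q_\lambda\|_{\mathcal{H}_\lambda}$, and such that for every radial $u_0\in H^1(\mathbb{H}^n)$ with $E_\lambda(u_0)<E_\lambda(v_c(0))$ and $\|u_0\|_{\mathcal{H}_\lambda}\le\|Q_\lambda\|_{\mathcal{H}_\lambda}$, the solution of (NLS) with initial data $u_0$ scatters in both time directions. The paper proves that such a $v_c$ exists. *)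

(* Defs.v *)
From HB Require Import structures.
From mathcomp Require Import all_boot all_order all_algebra.
From mathcomp Require Import complex.
From mathcomp Require Import all_classical all_reals all_analysis.
From mathcomp Require Import measurable_realfun.
Import Order.TTheory GRing.Theory Num.Theory.
Import numFieldNormedType.Exports.

Set Implicit Arguments.
Unset Strict Implicit.
Unset Printing Implicit Defensive.

Local Open Scope classical_set_scope.
Local Open Scope ring_scope.
Local Open Scope complex_scope.

Definition measure_row_display : measure_display -> measure_display.
Proof. exact. Qed.

Section row_measurable.
Context (R : realType) (n : nat).

Let coord (i : 'I_n) (x : 'rV[R]_n) : measurableTypeR R := x 0 i.

Let row_set0 : g_sigma_preimage coord set0.
Proof. exact: sigma_algebra0. Qed.

Let row_setC A : g_sigma_preimage coord A -> g_sigma_preimage coord (~` A).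
Proof. exact: sigma_algebraC. Qed.

Let row_bigcup (F : _^nat) : (forall i, g_sigma_preimage coord (F i)) ->
  g_sigma_preimage coord (\bigcup_i (F i)).
Proof. exact: sigma_algebra_bigcup. Qed.

HB.instance Definition _ :=
  @isMeasurable.Build (measure_row_display default_measure_display)
  'rV[R]_n (g_sigma_preimage coord) row_set0 row_setC row_bigcup.
End row_measurable.
Section row_measurability.
Context (R : realType).

Lemma measurable_coord n (i : 'I_n) :
  measurable_fun [set: 'rV[R]_n] (fun x : 'rV[R]_n => x 0 i).
Proof.
move=> _ Y mY; rewrite setTI; apply: sub_sigma_algebra => /=.
rewrite -bigcup_seq/=; exists i => /=; first by rewrite mem_index_enum.
by exists Y => //; rewrite setTI.
Qed.

Lemma measurable_fun_coordP d (T : measurableType d) n (f : T -> 'rV[R]_n) :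
  (forall i, measurable_fun [set: T] (fun t => f t 0 i)) ->
  measurable_fun [set: T] f.
Proof.
move=> mf _ Y mY; rewrite setTI.
suff : image_set_system setT f measurable Y by rewrite /image_set_system /= setTI.
move: Y mY; apply: smallest_sub.
  exact/sigma_algebra_image/sigma_algebra_measurable.
rewrite -bigcup_seq/=; apply: bigcup_sub => i _ A [B mB <-].
rewrite /image_set_system/= !setTI.
by have := mf i measurableT B mB; rewrite setTI.
Qed.

Definition row_cons n (p : R * 'rV[R]_n) : 'rV[R]_n.+1 :=
  \row_i oapp (p.2 0) p.1 (unlift ord0 i).

Lemma row_cons0 n (p : R * 'rV[R]_n) : row_cons p 0 ord0 = p.1.
Proof. by rewrite mxE unlift_none. Qed.

Lemma row_consS n (p : R * 'rV[R]_n) i : row_cons p 0 (lift ord0 i) = p.2 0 i.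
Proof. by rewrite mxE liftK. Qed.

Lemma measurable_row_cons n :
  measurable_fun [set: measurableTypeR R * 'rV[R]_n] (@row_cons n).
Proof.
apply: measurable_fun_coordP => i.
case: (unliftP ord0 i) => [j ->|->].
  under eq_fun do rewrite row_consS.
  exact: (measurableT_comp (@measurable_coord n j)).
under eq_fun do rewrite row_cons0.
exact: (@measurable_fst _ _ (measurableTypeR R) 'rV[R]_n).
Qed.

Section lebesgue_step.
Context (n : nat).
Variable m : {sigma_finite_measure set 'rV[R]_n -> \bar R}.

Definition lebesgue_step : set 'rV[R]_n.+1 -> \bar R :=
  pushforward (@lebesgue_measure R \x m)%E (@row_cons n).


Let mstep0 : lebesgue_step set0 = 0%E.
Proof. by rewrite /lebesgue_step /pushforward preimage_set0 measure0. Qed.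

Let mstep_ge0 A : (0 <= lebesgue_step A)%E.
Proof. by rewrite /lebesgue_step /pushforward; exact: measure_ge0. Qed.

Let mstep_sigma_additive : semi_sigma_additive lebesgue_step.
Proof.
have mf := @measurable_row_cons n.
move=> F mF tF mUF; rewrite /lebesgue_step /pushforward preimage_bigcup.
apply: measure_semi_sigma_additive.
- by move=> k; rewrite -[X in measurable X]setTI; exact: mf.
- apply/trivIsetP => /= i j _ _ ij; rewrite -preimage_setI.
  by move/trivIsetP : tF => /(_ _ _ _ _ ij) ->//; rewrite preimage_set0.
- by rewrite -preimage_bigcup -[X in measurable X]setTI; exact: mf.
Qed.

HB.instance Definition _ := isMeasure.Build _ _ _ lebesgue_step
  mstep0 mstep_ge0 mstep_sigma_additive.

Let row_split (x : 'rV[R]_n.+1) : measurableTypeR R * 'rV[R]_n :=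
  (x 0 ord0, \row_i x 0 (lift ord0 i)).

Let row_consK : cancel (@row_cons n) row_split.
Proof.
move=> [t x]; rewrite /row_split row_cons0; congr pair.
by apply/rowP => i; rewrite mxE row_consS.
Qed.

Let measurable_row_split : measurable_fun [set: 'rV[R]_n.+1] row_split.
Proof.
apply: measurable_fun_pair; first exact: measurable_coord.
apply: measurable_fun_coordP => i; under eq_fun do rewrite mxE.
exact: measurable_coord.
Qed.

Let mstep_sigma_finite : sigma_finite setT lebesgue_step.
Proof.
have /sigma_finiteP[F [TF ndF Foo]] := sigma_finiteT (@lebesgue_measure R).
have /sigma_finiteP[G [TG ndG Goo]] := sigma_finiteT m.
exists (fun k => row_split @^-1` (F k `*` G k)).
  rewrite -preimage_bigcup (_ : \bigcup_k _ = setT) ?preimage_setT//.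
  rewrite -subTset => -[t x] _.
  have [i _ Fit] : (\bigcup_i F i) t by rewrite -TF.
  have [j _ Gjx] : (\bigcup_i G i) x by rewrite -TG.
  exists (maxn i j) => //; split => /=.
    by move: t Fit; exact/subsetPset/ndF/leq_maxl.
  by move: x Gjx; exact/subsetPset/ndG/leq_maxr.
move=> k; have [mF Fk] := Foo k; have [mG Gk] := Goo k; split.
  rewrite -[X in measurable X]setTI; apply: measurable_row_split => //.
  exact: measurableX.
rewrite /lebesgue_step /pushforward -comp_preimage.
rewrite (_ : _ \o _ = id); last by apply/funext => p; rewrite /= row_consK.
by rewrite preimage_id product_measure1E// lte_mul_pinfty// ge0_fin_numE.
Qed.

HB.instance Definition _ := Measure_isSigmaFinite.Build _ _ _ lebesgue_step
  mstep_sigma_finite.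
End lebesgue_step.

Fixpoint lebesgue_row n : {sigma_finite_measure set 'rV[R]_n -> \bar R} :=
  match n with
  | 0 => @dirac _ 'rV[R]_0 0 R
  | n'.+1 => lebesgue_step (lebesgue_row n')
  end.
End row_measurability.
Section hyperbolic_space.
Context (R : realType) (n : nat).
Implicit Types (x y : 'rV[R]_n.+1) (v w : 'rV[R]_n).

Definition lorentz x y : R :=
  x 0 ord0 * y 0 ord0 - \sum_(i < n) x 0 (lift ord0 i) * y 0 (lift ord0 i).

Definition hyperboloid : set 'rV[R]_n.+1 :=
  [set x | lorentz x x = 1 /\ 0 < x 0 ord0].

Definition height v : R := Num.sqrt (1 + \sum_(i < n) v 0 i ^+ 2).

(* Global graph chart of the hyperboloid (hyp_bij). Below, functions on
   hyperbolic space are represented in this chart. *)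
Definition hyp v : 'rV[R]_n.+1 := row_cons (height v, v).

Let sumsq_ge0 v : 0 <= \sum_(i < n) v 0 i ^+ 2.
Proof. by apply: sumr_ge0 => i _; exact: sqr_ge0. Qed.

Lemma height_gt0 v : 0 < height v.
Proof. by rewrite sqrtr_gt0 ltr_wpDr. Qed.

Lemma hyp_bij : set_bij setT hyperboloid hyp.
Proof.
split.
- move=> v _; rewrite /hyperboloid/= /lorentz row_cons0/=; split; last first.
    exact: height_gt0.
  under eq_bigr do rewrite row_consS -expr2.
  by rewrite -expr2 sqr_sqrtr ?addr_ge0// addrK.
- move=> v w _ _ vw; apply/rowP => i.
  by have := congr1 (fun x => x 0 (lift ord0 i)) vw; rewrite !row_consS.
- move=> x [x1 x0]; exists (\row_i x 0 (lift ord0 i)) => //.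
  apply/rowP => i; case: (unliftP ord0 i) => [j ->|->].
    by rewrite row_consS mxE.
  rewrite row_cons0/= /height -[RHS]ger0_norm ?ltW// -sqrtr_sqr; congr Num.sqrt.
  under eq_bigr do rewrite mxE expr2.
  by move/eqP: x1; rewrite /lorentz subr_eq expr2 => /eqP.
Qed.

Definition partial (i : 'I_n) (f : 'rV[R]_n -> R) v : R :=
  'D_('e_i : 'rV[R]_n) f v.

Definition hyp_tangent (i : 'I_n) v : 'rV[R]_n.+1 :=
  \row_k partial i (fun w => hyp w 0 k) v.

(* The Riemannian metric is induced by the opposite of the Lorentz form. *)
Definition metric v : 'M[R]_n :=
  \matrix_(i, j) - lorentz (hyp_tangent i v) (hyp_tangent j v).

Definition volume_density v : R := Num.sqrt (\det (metric v)).

Lemma partial_line i (f : 'rV[R]_n -> R) v :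
  partial i f v = 'D_1 (fun t : R => f (t *: ('e_i : 'rV[R]_n) + v)) 0.
Proof.
rewrite /partial /derive; apply: (f_equal (fun g : R -> R => lim (g @ 0^'))).
by apply/funext => h; rewrite /= scale0r add0r addr0 [h *: 1]mulr1.
Qed.

Lemma partial_coord i j v : partial i (fun w => w 0 j) v = (i == j)%:R.
Proof.
rewrite partial_line (_ : (fun t : R => _) = (fun t => t * (i == j)%:R + v 0 j)).
  by rewrite derive_val /= ?scaler0 ?add0r ?addr0 [_%:R *: _]mulr1.
by apply/funext => t; rewrite !mxE eqxx [j == i]eq_sym.
Qed.

Lemma partial_height i v : partial i height v = v 0 i / height v.
Proof.
have S0 : 0 < 1 + \sum_(j < n) v 0 j ^+ 2 by rewrite ltr_wpDr.
rewrite partial_line (_ : (fun t : R => _) =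
    (Num.sqrt \o (fun t => t ^+ 2 + (2 * v 0 i) * t + (1 + \sum_(j < n) v 0 j ^+ 2)))).
  set g := (fun t : R => _ + _).
  have g0 : g 0 = 1 + \sum_(j < n) v 0 j ^+ 2.
    by rewrite /g expr0n/= mulr0 !add0r.
  have dg : is_derive (0 : R) 1 g (2 * v 0 i).
    pose q : {poly R} :=
      'X^2 + (2 * v 0 i) *: 'X + (1 + \sum_(j < n) v 0 j ^+ 2)%:P.
    have -> : g = horner q.
      by apply/funext => t; rewrite /g /q !(hornerD, hornerZ, hornerXn, hornerX, hornerC).
    apply: is_derive_eq.
    rewrite /q !derivD derivXn derivZ derivX derivC addr0 hornerD hornerMn.
    by rewrite hornerXn hornerZ hornerC expr1 mul0rn add0r mulr1.
  have ds : is_derive (g 0) 1 Num.sqrt (2 * Num.sqrt (g 0))^-1.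
    by apply: is_derive1_sqrt; rewrite g0.
  have := is_derive1_comp ds dg.
  move=> /@derive_val ->; rewrite g0 -/(height v) /GRing.scale/=.
  by rewrite invfM mulrACA mulVf ?pnatr_eq0// mul1r mulrC.
apply/funext => t; rewrite /height/=; congr Num.sqrt.
have sum_delta (F : 'I_n -> R) : \sum_(j < n) (j == i)%:R * F j = F i.
  rewrite (bigD1 i)//= eqxx mul1r big1 ?addr0// => j /negPf ->.
  by rewrite mul0r.
rewrite (eq_bigr (fun j => (j == i)%:R * (t ^+ 2) +
    ((j == i)%:R * (2 * v 0 j * t) + v 0 j ^+ 2))); last first.
  move=> j _; rewrite !mxE eqxx/=; case: (j == i); last first.
    by rewrite mulr0 !mul0r !add0r.
  by rewrite mulr1 !mul1r sqrrD -addrA -mulrA mulr_natl (mulrC t).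
by rewrite !big_split/= !sum_delta addrA [RHS]addrCA addrA.
Qed.

Lemma hyp_tangent0 i v : hyp_tangent i v 0 ord0 = v 0 i / height v.
Proof.
rewrite mxE -partial_height (_ : (fun w => _) = height)//.
by apply/funext => w; exact: row_cons0.
Qed.

Lemma hyp_tangentS i j v : hyp_tangent i v 0 (lift ord0 j) = (i == j)%:R.
Proof.
rewrite mxE (_ : (fun w => _) = (fun w => w 0 j)); first exact: partial_coord.
by apply/funext => w; exact: row_consS.
Qed.

Let lorentz_coord x y a b c d :
  x 0 ord0 = a -> y 0 ord0 = b -> (forall i, x 0 (lift ord0 i) = c i) ->
  (forall i, y 0 (lift ord0 i) = d i) ->
  lorentz x y = a * b - \sum_(i < n) c i * d i.
Proof.
move=> <- <- xc yd; congr (_ - _); apply: eq_bigr => i _.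
by congr (_ * _); [exact: xc|exact: yd].
Qed.

Lemma metricE v i j :
  metric v i j = (i == j)%:R - v 0 i * v 0 j / height v ^+ 2.
Proof.
have -> : metric v i j = - (v 0 i / height v * (v 0 j / height v) -
    \sum_(l < n) (i == l)%:R * (j == l)%:R).
  transitivity (- lorentz (hyp_tangent i v) (hyp_tangent j v)); first exact: mxE.
  congr (- _); apply: lorentz_coord => *.
  - exact: hyp_tangent0.
  - exact: hyp_tangent0.
  - exact: hyp_tangentS.
  - exact: hyp_tangentS.
move: (height v) => h; rewrite opprB (bigD1 i)//= eqxx mul1r [j == i]eq_sym.
rewrite big1 ?addr0 => [|l li]; last by rewrite [i == l]eq_sym (negPf li) mul0r.
by rewrite expr2 invfM mulrACA.
Qed.

Lemma measurable_volume_density : measurable_fun setT volume_density.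
Proof.
have mh : measurable_fun setT height.
  apply: measurableT_comp; first exact: (continuous_measurable_fun (@sqrt_continuous R)).
  apply: measurable_funD => //; apply: measurable_sum => j.
  by apply: measurable_funX; exact: measurable_coord.
apply: measurableT_comp; first exact: (continuous_measurable_fun (@sqrt_continuous R)).
apply: measurable_sum => s; apply: measurable_funM => //.
apply: measurable_prod => j _; under eq_fun do rewrite metricE.
apply: measurable_funB => //; apply: measurable_funM.
  by apply: measurable_funM; exact: measurable_coord.
have -> : (fun v => (height v ^+ 2)^-1) = (fun v => height v `^ (- 2)).
  by apply/funext => v; rewrite powRN powR_mulrn// ltW// height_gt0.
have mp : measurable_fun [set: R] (fun x : R => x `^ (- 2)) by exact: measurable_powR.
exact: (measurableT_comp mp mh).
Qed.

End hyperbolic_space.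
Section hyperbolic_measure.
Context (R : realType) (n : nat).

Definition hyp_measure (A : set 'rV[R]_n) : \bar R :=
  (\int[lebesgue_row R n]_(v in A) (volume_density v)%:E)%E.

Let hyp_measure0 : hyp_measure set0 = 0%E.
Proof. exact: integral_set0. Qed.

Let hyp_measure_ge0 A : (0 <= hyp_measure A)%E.
Proof. by apply: integral_ge0 => v _; rewrite lee_fin sqrtr_ge0. Qed.

Let hyp_measure_sigma_additive : semi_sigma_additive hyp_measure.
Proof.
apply: semi_sigma_additive_nng_induced => [|v].
  by apply/measurable_EFinP; exact: measurable_volume_density.
by rewrite lee_fin sqrtr_ge0.
Qed.

HB.instance Definition _ := isMeasure.Build _ _ _ hyp_measure
  hyp_measure0 hyp_measure_ge0 hyp_measure_sigma_additive.
End hyperbolic_measure.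

HB.instance Definition _ (R : realType) := isPointed.Build R[i] 0.

Section sobolev_space.
Context (R : realType) (n : nat).
Local Notation C := R[i].
Local Notation mu := (@hyp_measure R n).
Local Notation leb := (lebesgue_row R n).
Implicit Types (f g : 'rV[R]_n -> C) (G : 'I_n -> 'rV[R]_n -> C)
  (phi : 'rV[R]_n -> R).

Definition cabs (z : C) : R := complex.Re `|z|.

Definition cmeasurable f : Prop :=
  measurable_fun setT (fun v => complex.Re (f v)) /\
  measurable_fun setT (fun v => complex.Im (f v)).

Definition cintegral (m : {measure set 'rV[R]_n -> \bar R}) f : C :=
  (\int[m]_v complex.Re (f v)) +i* (\int[m]_v complex.Im (f v)).

Definition test_function phi : Prop :=
  (forall (s : seq 'I_n) v, differentiable (foldr (@partial R n) phi s) v) /\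
  compact (closure [set v | phi v != 0]).

(* Riemannian (Hermitian) inner product of two covectors. *)
Definition coinner (v : 'rV[R]_n) (a b : 'I_n -> C) : C :=
  \sum_i \sum_j (invmx (metric v) i j)%:C * a i * conjc (b j).

(* The weak derivative is taken in the chart, hence against Lebesgue measure. *)
Definition weak_differential f G : Prop :=
  forall phi, test_function phi -> forall i,
    cintegral leb (fun v => f v * (partial i phi v)%:C) =
    - cintegral leb (fun v => G i v * (phi v)%:C).

Definition sobolev_differential f G : Prop :=
  [/\ cmeasurable f, forall i, cmeasurable (G i),
      (\int[mu]_v (cabs (f v) ^+ 2)%:E < +oo)%E,
      (\int[mu]_v (complex.Re (coinner v (G ^~ v) (G ^~ v)))%:E < +oo)%E &
      weak_differential f G].

Definition sobolev f : Prop := exists G, sobolev_differential f G.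

(* Well defined up to a null set; only meaningful if f is in H^1. *)
Definition differential f : 'I_n -> 'rV[R]_n -> C :=
  xget (fun _ _ => 0) [set G | sobolev_differential f G].

Definition l2_norm_sq f : R := \int[mu]_v (cabs (f v) ^+ 2).

Definition dirichlet f : R :=
  \int[mu]_v complex.Re
    (coinner v (differential f ^~ v) (differential f ^~ v)).

Definition h1_norm f : R := Num.sqrt (dirichlet f + l2_norm_sq f).

Definition Lp_norm (q : R) f : R :=
  fine ('N[mu]_(q%:E) [ (fun v => (cabs (f v))%:E) ])%E.

Definition Hlam_norm (lam : R) f : R :=
  Num.sqrt (dirichlet f - lam * l2_norm_sq f).

Definition energy (lam p : R) f : R :=
  2^-1 * Hlam_norm lam f ^+ 2 - (p + 1)^-1 * Lp_norm (p + 1) f `^ (p + 1).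

(* Elements are functions, not classes modulo null sets: the topology below is
   the one of the seminorm h1_norm, whose Kolmogorov quotient is H^1. *)
Record H1 := MkH1 { H1_fun :> 'rV[R]_n -> C ; H1_sobolev : sobolev H1_fun }.

HB.instance Definition _ := gen_eqMixin H1.
HB.instance Definition _ := gen_choiceMixin H1.

Definition h1_ball (c : ('rV[R]_n -> C) * R) : set H1 :=
  [set f | h1_norm (fun v => f v - c.1 v) < c.2].

HB.instance Definition _ := isSubBaseTopological.Build H1
  [set c : ('rV[R]_n -> C) * R | sobolev c.1] h1_ball.

(* cosh d(x, y) = [x, y] *)
Definition hyp_dist (x y : 'rV[R]_n.+1) : R :=
  ln (lorentz x y + Num.sqrt (lorentz x y ^+ 2 - 1)).

Definition radial f : Prop :=
  exists h : R -> C, {ae mu, forall v, f v = h (hyp_dist (hyp v) 'e_ord0)}.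

Definition power_nonlinearity (p : R) (z : C) : C := (cabs z `^ (p - 1))%:C * z.

Definition l2_pairing f phi : C := cintegral mu (fun v => f v * (phi v)%:C).

Definition dirichlet_pairing f phi : C :=
  cintegral mu (fun v =>
    coinner v (differential f ^~ v) (fun i => (partial i phi v)%:C)).

Definition ground_state (lam p : R) (Q : H1) : Prop :=
  [/\ {ae mu, forall v, 0 < Q v}, radial Q,
      forall f : H1, ~ {ae mu, forall v, f v = 0} ->
        Hlam_norm lam Q ^+ 2 / Lp_norm (p + 1) Q ^+ 2 <=
        Hlam_norm lam f ^+ 2 / Lp_norm (p + 1) f ^+ 2 &
      forall phi, test_function phi ->
        dirichlet_pairing Q phi - lam%:C * l2_pairing Q phi =
        l2_pairing (fun v => power_nonlinearity p (Q v)) phi].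

Definition cderivable (h : R -> C) (t : R) : Prop :=
  derivable (fun s => complex.Re (h s)) t 1 /\
  derivable (fun s => complex.Im (h s)) t 1.

Definition cderive (h : R -> C) (t : R) : C :=
  ('D_1 (fun s => complex.Re (h s)) t) +i*
  ('D_1 (fun s => complex.Im (h s)) t).

(* u in C((-Tm, Tp), H^1) with u(0) = u0 solves i u_t + Delta u + N(u) = 0 in
   the sense of distributions. *)
Definition schrodinger_solution (N : C -> C) (u0 : H1) (Tm Tp : \bar R)
    (u : R -> H1) : Prop :=
  [/\ (0 < Tm)%E, (0 < Tp)%E, {ae mu, forall v, u 0 v = u0 v} &
      forall t : R, (- Tm < t%:E < Tp)%E ->
        {for t, continuous u} /\
        forall phi, test_function phi ->
          cderivable (fun s => l2_pairing (u s) phi) t /\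
          (0 +i* 1) * cderive (fun s => l2_pairing (u s) phi) t
          - dirichlet_pairing (u t) phi
          + l2_pairing (fun v => N (u t v)) phi = 0].

Definition nls_solution (p : R) := schrodinger_solution (power_nonlinearity p).

Definition nls_maximal_solution (p : R) (u0 : H1) (Tm Tp : \bar R)
    (u : R -> H1) : Prop :=
  nls_solution p u0 Tm Tp u /\
  forall Tm' Tp' u', nls_solution p u0 Tm' Tp' u' ->
    (Tm' <= Tm)%E /\ (Tp' <= Tp)%E.

(* w t = exp(i t Delta) v0 *)
Definition free_evolution (v0 : H1) (w : R -> H1) : Prop :=
  schrodinger_solution (fun=> 0) v0 +oo%E +oo%E w.

Definition scatters_forward (Tp : \bar R) (u : R -> H1) : Prop :=
  Tp = +oo%E /\ exists v0 w, free_evolution v0 w /\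
    h1_norm (fun v => w t v - u t v) @[t --> +oo] --> (0 : R).

Definition scatters_backward (Tm : \bar R) (u : R -> H1) : Prop :=
  Tm = +oo%E /\ exists v0 w, free_evolution v0 w /\
    h1_norm (fun v => w t v - u t v) @[t --> -oo] --> (0 : R).

(* The critical element for lam, relative to the choice Q of Q_lam. *)
Definition critical_element (lam p : R) (Q : H1) (vc : R -> H1) : Prop :=
  [/\ nls_solution p (vc 0) +oo%E +oo%E vc,
      forall t, radial (vc t),
      ~ scatters_forward +oo%E vc /\ ~ scatters_backward +oo%E vc,
      compact (closure (range vc)) &
      [/\ energy lam p (vc 0) <= energy lam p Q,
          Hlam_norm lam (vc 0) <= Hlam_norm lam Q &
          forall u0 : H1, radial u0 ->
            energy lam p u0 < energy lam p (vc 0) ->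
            Hlam_norm lam u0 <= Hlam_norm lam Q ->
            forall Tm Tp u, nls_maximal_solution p u0 Tm Tp u ->
              scatters_forward Tp u /\ scatters_backward Tm u]].
End sobolev_space.

(* Main.v *)
(** Suppose that lambda = 0 does not have the required property. Then there is a
    ground state Q0 for lambda = 0. As a stationary solution of (NLS) it is global
    and does not scatter: if a free solution w converged to it, Im <w(t), phi>
    would converge while its derivative tends to - \int Q0^p phi < 0. For
    lambda = - omega the functional E_lambda(Q0) and the squared norm of Q0 grow at
    most linearly in omega, whereas the Nehari identity and a radial
    Gagliardo-Nirenberg inequality at scale omega^(-1/2) bound E_lambda(Q_lambda)
    and the squared norm of Q_lambda from below by a constant times omega^s, with
    s > 1 exactly when p < 1 + 4/n. So for omega large Q0 lies strictly below the
    ground state level of lambda, and E_lambda(Q_lambda) <= E_lambda(v_c) would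
    force Q0 to scatter.

    The Gagliardo-Nirenberg inequality follows from the oscillation estimate
    |k(x) - k(y)|^2 <= C x^(2-n) \int |grad f|^2 for the radial profile k of f, at
    almost all 0 < x < y, obtained by testing the weak gradient with fields
    v |v|^(-n) D(|v|), whose divergence is |v|^(1-n) D'(|v|). *)

Require Import Defs.
From HB Require Import structures.
From mathcomp Require Import all_boot all_order all_algebra.
From mathcomp Require Import complex.
From mathcomp Require Import all_classical all_reals all_analysis.
From mathcomp Require Import measurable_realfun.
From mathcomp Require Import ring lra.
Import Order.TTheory GRing.Theory Num.Theory.
Import numFieldNormedType.Exports.
Set Implicit Arguments.
Unset Strict Implicit.
Unset Printing Implicit Defensive.
Local Open Scope classical_set_scope.
Local Open Scope ring_scope.
Local Open Scope complex_scope.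

(** * Smooth functions of one variable *)

(** A ground state of parameter lambda gives the standing wave e^(-i lambda t) Q of (NLS), which is
    constant in time only for lambda = 0; hence the special role of that value. Existence of ground
    states is never proved: when the property fails at lambda = 0, the failure itself exhibits Q0.

    The equation of a ground state is available against compactly supported test functions only, so
    it cannot be paired with Q. The Nehari identity is recovered from the minimality of the quotient
    along Q + t phi, with one fixed test function phi. This phi is radial, so that the
    Gagliardo-Nirenberg inequality makes the L^(p+1) norms of the competitors finite; [Lp_norm]
    would turn an infinite norm into 0.

    With q = p + 1 and kappa = n - (n - 2) q / 2, that inequality at scale delta <= 1 reads \int
    |g|^q <= C (\int |grad g|^2 + \int g^2 / delta^2)^(q/2) delta^kappa. For delta = omega^(-1/2)
    the bracket is exactly the squared norm for lambda = - omega. This yields s = kappa / (q - 2),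
    and kappa - (q - 2) = 2 - n (p - 1) / 2 is positive exactly when p < 1 + 4/n. *)

Section smooth1.
Context {R : realType}.
Implicit Types (f g : R -> R) (S : set (R -> R)).

(* Coinductive form of C^oo: a family of derivable functions stable under
   derivation. *)
Definition smooth1 f : Prop := exists S : set (R -> R), S f /\
  forall g, S g -> exists g', S g' /\ forall x : R, is_derive x 1 g (g' x).

Inductive alg1 S : (R -> R) -> Prop :=
| Alg1_gen g : S g -> alg1 S g
| Alg1_cst c : alg1 S (fun=> c)
| Alg1_add g h : alg1 S g -> alg1 S h -> alg1 S (fun x => g x + h x)
| Alg1_mul g h : alg1 S g -> alg1 S h -> alg1 S (fun x => g x * h x).

(** Coinduction up to algebra operations: derivatives of the generators need only be polynomials in
    the generators. By the Leibniz rule the generated algebra is then itself the derivation-stable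
    family. *)
Lemma alg1_smooth S :
  (forall g, S g -> exists g', alg1 S g' /\ forall x : R, is_derive x 1 g (g' x)) ->
  forall f, alg1 S f -> smooth1 f.
Proof.
move=> SP f Sf; exists (alg1 S); split=> // {f Sf} k; elim=> [g /SP//|c|g h _ [g' [Sg' gg']] _ [h' [Sh' hh']]|g h Sg [g' [Sg' gg']] Sh [h' [Sh' hh']]].
- by exists (fun=> 0); split; [exact: Alg1_cst|move=> x; exact: is_derive_cst].
- exists (fun x => g' x + h' x); split; first exact: Alg1_add.
  by move=> x; apply: is_deriveD.
- exists (fun x => g x * h' x + h x * g' x); split.
    by apply: Alg1_add; apply: Alg1_mul.
  by move=> x; apply: is_deriveM.
Qed.

Lemma smooth1_derive f : smooth1 f ->
  exists f', smooth1 f' /\ forall x : R, is_derive x 1 f (f' x).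
Proof.
move=> [S [Sf SP]]; have [f' [Sf' ff']] := SP _ Sf.
by exists f'; split=> //; exists S.
Qed.

Lemma smooth1_cst c : smooth1 (fun=> c).
Proof. by apply: (@alg1_smooth set0) => //; exact: Alg1_cst. Qed.

Lemma smooth1_id : smooth1 id.
Proof.
apply: (@alg1_smooth [set id]); last exact: Alg1_gen.
move=> g ->; exists (fun=> 1); split; first exact: Alg1_cst.
by move=> x; exact: is_derive_id.
Qed.

Let binary f g : smooth1 f -> smooth1 g -> exists S, [/\ S f, S g &
  forall h, S h -> exists h', alg1 S h' /\ forall x : R, is_derive x 1 h (h' x)].
Proof.
move=> [S [Sf SP]] [T [Tg TP]]; exists (S `|` T); split; [by left|by right|].
by move=> h [/SP|/TP] [h' [? ?]]; exists h'; split=> //; apply: Alg1_gen; [left|right].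
Qed.

Lemma smooth1D f g : smooth1 f -> smooth1 g -> smooth1 (fun x => f x + g x).
Proof.
move=> sf sg; have [S [Sf Sg SP]] := binary sf sg.
by apply: (alg1_smooth SP); apply: Alg1_add; apply: Alg1_gen.
Qed.

Lemma smooth1M f g : smooth1 f -> smooth1 g -> smooth1 (fun x => f x * g x).
Proof.
move=> sf sg; have [S [Sf Sg SP]] := binary sf sg.
by apply: (alg1_smooth SP); apply: Alg1_mul; apply: Alg1_gen.
Qed.

Lemma smooth1N f : smooth1 f -> smooth1 (fun x => - f x).
Proof.
move=> sf; rewrite (_ : (fun _ => _) = (fun x => (-1) * f x)).
  exact: smooth1M (smooth1_cst _) sf.
by apply/funext => x; rewrite mulN1r.
Qed.

Lemma smooth1B f g : smooth1 f -> smooth1 g -> smooth1 (fun x => f x - g x).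
Proof. by move=> sf sg; apply: smooth1D => //; exact: smooth1N. Qed.

(** The family of [g] together with all k \o g, for k in the family of [f], is not stable under
    derivation, but by the chain rule its derivatives are products of two members. *)
Lemma smooth1_comp f g : smooth1 f -> smooth1 g -> smooth1 (fun x => f (g x)).
Proof.
move=> [S [Sf SP]] [T [Tg TP]].
pose U : set (R -> R) := [set h | T h] `|` [set h | exists2 k, S k & h = k \o g].
apply: (@alg1_smooth U); last by apply: Alg1_gen; right; exists f.
move=> h [/= /TP[h' [Th' hh']]|/= [k /SP[k' [Sk' kk']] ->]].
  by exists h'; split=> //; apply: Alg1_gen; left.
have [g' [Tg' gg']] := TP _ Tg.
exists (fun x => k' (g x) * g' x); split.
  by apply: Alg1_mul; apply: Alg1_gen; [right; exists k'|left].
by move=> x; apply: is_derive1_comp.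
Qed.

Lemma smooth1_expR : smooth1 (@expR R).
Proof.
exists [set @expR R]; split=> // g ->; exists (@expR R); split=> // x.
exact: is_derive_expR.
Qed.

Lemma smooth1_continuous f : smooth1 f -> continuous f.
Proof.
move=> /smooth1_derive[f' [_ ff']] x.
by apply/differentiable_continuous/derivable1_diffP; have [] := ff' x.
Qed.

Lemma derive1_smooth1 f : smooth1 f -> smooth1 (derive1 f).
Proof.
move=> /smooth1_derive[f' [sf' ff']]; rewrite (_ : derive1 f = f')//.
by apply/funext => x; rewrite derive1E; exact: derive_val.
Qed.

Lemma is_derive_smooth1 f (x : R) : smooth1 f -> is_derive x 1 f (derive1 f x).
Proof.
move=> /smooth1_derive[f' [sf' ff']]; rewrite (_ : derive1 f x = f' x)//.
by rewrite derive1E; exact: derive_val.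
Qed.

End smooth1.

(** * The function e^(-1/t), a bump on [0, 1] and a smooth step *)

Section smooth_step.
Context {R : realType}.

(** The factor t^(-m) is a parameter because it makes the family stable under derivation:
    ([flat m])' = - m [flat (m + 1)] + [flat (m + 2)], also at the gluing point 0. *)
Definition flat (m : nat) (t : R) : R :=
  if 0 < t then (t ^+ m)^-1 * expR (- t^-1) else 0.

Lemma is_derive_powi m (t : R) :
  is_derive t 1 (fun s : R => s ^+ m) (m%:R * t ^+ m.-1).
Proof.
have := is_deriveX m (is_derive_id t (1 : R)).
rewrite [X in is_derive _ _ X _](_ : _ = (fun s : R => s ^+ m)); last first.
  by apply/funext => s; rewrite exprfctE.
by rewrite [_ *: 1]mulr1.
Qed.

(** A single term of the exponential series bounds e^u from below. *)
Lemma pow_expRN_le (m : nat) (u : R) : 0 <= u ->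
  u ^+ m.+1 * expR (- u) <= m.+1`!%:R.
Proof.
move=> u0; rewrite expRN ler_pdivrMr ?expR_gt0//.
rewrite -ler_pdivrMl ?ltr0n ?fact_gt0// mulrC.
by apply: le_trans (expR_ge1Dxn m u0); rewrite lerDr.
Qed.

Lemma flat_ge0 m t : 0 <= flat m t.
Proof.
by rewrite /flat; case: ifPn => // t0; rewrite mulr_ge0 ?expR_ge0// invr_ge0 exprn_ge0// ltW.
Qed.

(** This is [pow_expRN_le] at u = 1/t with exponent m + 2. Quadratic decay is what makes the
    derivative at 0 exist and vanish. *)
Lemma flat_quadratic m (t : R) : flat m t <= m.+2`!%:R * t ^+ 2.
Proof.
rewrite /flat; case: ifPn => [t0|_]; last by rewrite mulr_ge0// sqr_ge0.
have := @pow_expRN_le m.+1 t^-1; rewrite invr_ge0 ltW// => /(_ isT).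
rewrite exprVn -ler_pdivrMr ?exprn_gt0//; apply: le_trans.
by rewrite mulrAC -invfM -exprD addn2.
Qed.

Let dflat m (t : R) : R := - (m%:R) * flat m.+1 t + flat m.+2 t.

Lemma is_derive_flat m (t : R) : is_derive t 1 (flat m) (dflat m t).
Proof.
have [t0|t0|<-] := ltgtP 0 t.
- have E : \forall s \near t, (fun s : R => (s ^+ m)^-1 * expR (- s^-1)) s = flat m s.
    near=> s; rewrite /flat ifT//; near: s.
    by apply: lt_nbhsr.
  apply: near_eq_is_derive E _ => //.
  have tn0 : t != 0 by rewrite gt_eqF.
  have d1 : is_derive t 1 (fun s : R => s^-1) (- t ^- 2 *: 1 : R).
    by apply: is_deriveV.
  have d2 : is_derive t 1 (fun s : R => (s ^+ m)^-1) (- (t ^+ m) ^- 2 *: (m%:R * t ^+ m.-1 : R) : R).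
    by apply: is_deriveV (is_derive_powi _ _); rewrite expf_neq0.
  have d3 : is_derive t 1 (fun s : R => expR (- s^-1)) (expR (- t^-1) * (- (- t ^- 2 *: 1)) : R).
    exact: is_derive1_comp.
  apply: is_derive_eq.
  rewrite /dflat /flat t0 /GRing.scale/= !mulr1.
  case: m d2 => [|m] _ /=.
    by rewrite expr0 mul0r mulr0 oppr0 mul0r add0r mulr0 addr0 opprK invr1 mul1r mulrC.
  rewrite !exprS; move: (expR _) => e; field.
  by rewrite tn0 expf_neq0.
- have E : \forall s \near t, cst (0:R) s = flat m s.
    near=> s; rewrite /flat ifF//; apply/negbTE; rewrite -leNgt ltW//; near: s.
    by apply: lt_nbhsl.
  apply: near_eq_is_derive E _ => //.
  rewrite (_ : dflat m t = 0); first exact: is_derive_cst.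
  by rewrite /dflat /flat ltNge ltW//= mulr0 addr0.
- have -> : dflat m 0 = 0 by rewrite /dflat /flat ltxx mulr0 addr0.
  have f0 : flat m 0 = 0 by rewrite /flat ltxx.
  (* At the gluing point the difference quotient is at most (m + 2)! |h|. *)
  have H : h^-1 *: (flat m (h *: 1 + 0) - flat m 0) @[h --> (0:R)^'] --> (0:R).
    rewrite f0.
    apply/cvgr0Pnorm_le => e e0; near=> h.
    rewrite subr0 addr0 [h *: 1]mulr1 normrM normfV.
    have h0 : h != 0 by near: h; exact: nbhs_dnbhs_neq.
    rewrite mulrC ler_pdivrMr ?normr_gt0// ger0_norm ?flat_ge0//.
    apply: le_trans (flat_quadratic _ _) _.
    rewrite -real_normK ?num_real// expr2 mulrA ler_wpM2r//.
    rewrite -ler_pdivlMl ?ltr0n ?fact_gt0//; near: h.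
    apply: dnbhs0_le.
    by rewrite mulr_gt0// invr_gt0 ltr0n fact_gt0.
  split; last by apply: cvg_lim.
  by apply/cvg_ex; exists 0.
Unshelve. all: by end_near. Qed.

Lemma smooth1_flat m : smooth1 (flat m).
Proof.
apply: (@alg1_smooth _ [set f | exists k, f = flat k]); last first.
  by apply: Alg1_gen; exists m.
move=> _ [k ->]; exists (dflat k); split; last exact: is_derive_flat.
apply: Alg1_add; last by apply: Alg1_gen; exists k.+2.
by apply: Alg1_mul; [exact: Alg1_cst|apply: Alg1_gen; exists k.+1].
Qed.

Definition smooth_bump (t : R) : R := flat 0 t * flat 0 (1 - t).

Lemma smooth1_bump : smooth1 smooth_bump.
Proof.
apply: smooth1M; first exact: smooth1_flat.
apply: smooth1_comp; first exact: smooth1_flat.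
by apply: smooth1B; [exact: smooth1_cst|exact: smooth1_id].
Qed.

Lemma bump_ge0 t : 0 <= smooth_bump t.
Proof. by rewrite mulr_ge0 ?flat_ge0. Qed.

Lemma bump_gt0 t : 0 < t < 1 -> 0 < smooth_bump t.
Proof.
move=> /andP[t0 t1]; rewrite /smooth_bump /flat t0 subr_gt0 t1 !expr0 invr1 !mul1r.
by rewrite mulr_gt0 ?expR_gt0.
Qed.

Lemma bump_le1 t : smooth_bump t <= 1.
Proof.
have f1 s : flat 0 s <= 1.
  rewrite /flat; case: ifPn => // s0.
  by rewrite expr0 invr1 mul1r -(expR0 R) ler_expR oppr_le0 invr_ge0 ltW.
by rewrite -[leRHS]mulr1 ler_pM ?flat_ge0.
Qed.

Lemma bump_le0 t : t <= 0 -> smooth_bump t = 0.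
Proof. by move=> t0; rewrite /smooth_bump /flat ltNge t0 mul0r. Qed.

Lemma bump_ge1 t : 1 <= t -> smooth_bump t = 0.
Proof. by move=> t1; rewrite /smooth_bump /(flat 0 (1 - t)) subr_gt0 ltNge t1 mulr0. Qed.

Let cbump : continuous smooth_bump.
Proof. exact/smooth1_continuous/smooth1_bump. Qed.

(** The base point -1 lies strictly to the left of the support, so that the fundamental theorem of
    calculus applies at t = 0 as at an interior point. *)
Definition bump_prim (t : R) : R := \int[lebesgue_measure]_(x in `[-1, t]) smooth_bump x.

Let bump_integrable a b : (@lebesgue_measure R).-integrable `[a, b] (EFin \o smooth_bump).
Proof.
apply: continuous_compact_integrable; first exact: segment_compact.
by apply: continuous_subspaceT.
Qed.

Lemma bump_prim_le0 t : t <= 0 -> bump_prim t = 0.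
Proof.
move=> t0; rewrite /bump_prim (@eq_Rintegral _ _ _ _ _ (cst 0)).
  by rewrite /Rintegral integral0.
move=> x; rewrite inE/= in_itv/= => /andP[_ xt].
by rewrite bump_le0// (le_trans xt).
Qed.

Lemma bump_prim_ge1 t : 1 <= t -> bump_prim t = bump_prim 1.
Proof.
move=> t1; rewrite /bump_prim Rintegral_mkcond [RHS]Rintegral_mkcond.
congr Rintegral; apply/funext => x; rewrite !patchE !mem_setE !in_itv/=.
case: (leP (-1) x) => //= x0; case: (leP x 1) => x1.
  by rewrite (le_trans x1 t1).
by rewrite bump_ge1 ?(ltW x1)//; case: ifP.
Qed.

Lemma is_derive_bump_prim (t : R) : is_derive t 1 bump_prim (smooth_bump t).
Proof.
have [t0|t0] := ltP t 0.
  rewrite bump_le0 ?ltW//.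
  have E : \forall s \near t, cst (0:R) s = bump_prim s.
    near=> s; rewrite bump_prim_le0// ltW//; near: s.
    by apply: lt_nbhsl.
  by apply: near_eq_is_derive E _ => //; exact: is_derive_cst.
have [||||] := @continuous_FTC1_closed _ smooth_bump (-1) t (t + 1).
- by rewrite ltrDl.
- exact: bump_integrable.
- by rewrite (lt_le_trans _ t0)// ltrN10.
- exact: cbump.
- by move=> d1 d2; split; [exact: d1|rewrite -derive1E; exact: d2].
Unshelve. all: by end_near. Qed.

Lemma smooth1_prim (f f' : R -> R) : smooth1 f' ->
  (forall x : R, is_derive x 1 f (f' x)) -> smooth1 f.
Proof.
move=> [S [Sf' SP]] ff'; exists (f |` S); split; first by left.
move=> g [->|/SP[g' [? ?]]]; [by exists f'; split=> //; right|].
by exists g'; split=> //; right.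
Qed.

Lemma bump_prim_ge0 t : 0 <= bump_prim t.
Proof. by apply: Rintegral_ge0 => x _; exact: bump_ge0. Qed.

Lemma bump_prim1_gt0 : 0 < bump_prim 1.
Proof.
rewrite -(bump_prim_le0 (lexx 0)).
have cb : continuous bump_prim.
  exact/smooth1_continuous/(smooth1_prim smooth1_bump)/is_derive_bump_prim.
apply: (@gtr0_derive1_lt_cc _ _ 0 1) => //.
- by move=> x _; have [] := is_derive_bump_prim x.
- move=> x; rewrite in_itv/= => x01.
  by rewrite derive1E (@derive_val _ _ _ _ _ _ _ (is_derive_bump_prim x)) bump_gt0.
- exact: continuous_subspaceT.
- by rewrite in_itv/= lexx ler01.
- by rewrite in_itv/= lexx ler01.
Qed.

Definition step (t : R) : R := bump_prim t / bump_prim 1.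

Lemma is_derive_step (t : R) : is_derive t 1 step (smooth_bump t / bump_prim 1).
Proof.
rewrite /step [X in is_derive _ _ X _](_ : _ = (bump_prim 1)^-1 \*: bump_prim).
  apply: is_derive_eq; first exact/is_deriveZ/is_derive_bump_prim.
  by rewrite [LHS]mulrC.
by apply/funext => x /=; rewrite [RHS]mulrC.
Qed.

Lemma smooth1_step : smooth1 step.
Proof.
apply: smooth1_prim is_derive_step.
by apply: smooth1M; [exact: smooth1_bump|exact: smooth1_cst].
Qed.

Lemma step_le0 t : t <= 0 -> step t = 0.
Proof. by move=> t0; rewrite /step bump_prim_le0 ?mul0r. Qed.

Lemma step_ge1 t : 1 <= t -> step t = 1.
Proof. by move=> t0; rewrite /step bump_prim_ge1 ?divff// gt_eqF// bump_prim1_gt0. Qed.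

Lemma step_nd : {homo step : x y / x <= y}.
Proof.
move=> x y xy; apply: (@ger0_derive1_le_cc _ step x y) => //.
- by move=> z _; have [] := is_derive_step z.
- move=> z _; rewrite derive1E (@derive_val _ _ _ _ _ _ _ (is_derive_step z)).
  by rewrite divr_ge0 ?bump_ge0 ?bump_prim_ge0.
- exact/continuous_subspaceT/smooth1_continuous/smooth1_step.
- by rewrite in_itv/= lexx xy.
- by rewrite in_itv/= lexx xy.
Qed.

Lemma step_ge0 t : 0 <= step t.
Proof. by rewrite /step divr_ge0 ?bump_prim_ge0. Qed.

Lemma step_le1 t : step t <= 1.
Proof.
have [t1|/ltW t1] := leP 1 t; first by rewrite step_ge1.
by rewrite -(step_ge1 (lexx 1)); exact: step_nd.
Qed.

Lemma step_gt0 t : 0 < t -> 0 < step t.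
Proof.
move=> t0; have [t1|t1] := leP 1 t; first by rewrite step_ge1.
rewrite -[ltLHS](step_le0 (lexx 0)).
apply: (@gtr0_derive1_lt_cc _ step 0 t) => //.
- by move=> x _; have [] := is_derive_step x.
- move=> x; rewrite in_itv/= => /andP[x0 xt].
  rewrite derive1E (@derive_val _ _ _ _ _ _ _ (is_derive_step x)).
  by rewrite divr_gt0 ?bump_prim1_gt0// bump_gt0// x0 (lt_trans xt).
- exact/continuous_subspaceT/smooth1_continuous/smooth1_step.
- by rewrite in_itv/= lexx ltW.
- by rewrite in_itv/= lexx ltW.
Qed.

End smooth_step.

(** * Smooth functions of several variables *)

Section smoothn.
Context {R : realType} {n : nat}.
Local Notation rV := 'rV[R]_n.
Implicit Types (f g : rV -> R) (S : set (rV -> R)) (v : rV) (i : 'I_n).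

(** Coinductive like [smooth1]. Stability under every [partial i] gives differentiability of the
    iterated partial derivatives that [test_function] asks for. *)
Definition smoothn f : Prop := exists S : set (rV -> R), S f /\
  forall g, S g -> (forall v, differentiable g v) /\ forall i, S (partial i g).

Lemma smoothn_foldr f (s : seq 'I_n) v : smoothn f ->
  differentiable (foldr (@partial R n) f s) v.
Proof.
move=> [S [Sf SP]]; have : S (foldr (@partial R n) f s).
  by elim: s => //= i s /SP[_].
by move=> /SP[].
Qed.

Lemma smoothn_diff f v : smoothn f -> differentiable f v.
Proof. exact: (@smoothn_foldr f [::] v). Qed.


Lemma partial_cst i (c : R) : partial i (fun=> c) = fun=> 0.
Proof. by apply/funext => v; exact: derive_cst. Qed.

Lemma partialD i f g v : differentiable f v -> differentiable g v ->
  partial i (fun w => f w + g w) v = partial i f v + partial i g v.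
Proof. by move=> df dg; apply: deriveD; exact: diff_derivable. Qed.

Lemma partialM i f g v : differentiable f v -> differentiable g v ->
  partial i (fun w => f w * g w) v = f v * partial i g v + g v * partial i f v.
Proof. by move=> df dg; apply: deriveM; exact: diff_derivable. Qed.

Lemma partial_comp i (D : R -> R) f v : smooth1 D -> differentiable f v ->
  partial i (fun w => D (f w)) v = derive1 D (f v) * partial i f v.
Proof.
move=> sD df; have dD : differentiable D (f v).
  by apply/derivable1_diffP; have [] := is_derive_smooth1 (f v) sD.
rewrite /partial deriveE; last exact: differentiable_comp.
rewrite (diff_comp df dD)/= deriveE// (diff1E dD).
by rewrite [LHS]mulrC.
Qed.

Inductive algn S : (rV -> R) -> Prop :=
| Algn_gen g : S g -> algn S g
| Algn_cst c : algn S (fun=> c)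
| Algn_add g h : algn S g -> algn S h -> algn S (fun x => g x + h x)
| Algn_mul g h : algn S g -> algn S h -> algn S (fun x => g x * h x).

Lemma algn_smooth S :
  (forall g, S g -> (forall v, differentiable g v) /\
     forall i, algn S (partial i g)) ->
  forall f, algn S f -> smoothn f.
Proof.
move=> SP f Sf; exists (algn S); split=> // {f Sf} k.
elim=> [g /SP//|c|g h _ [dg ag] _ [dh ah]|g h Sg [dg ag] Sh [dh ah]]; split.
- by move=> v; exact: differentiable_cst.
- by move=> i; rewrite partial_cst; exact: Algn_cst.
- by move=> v; exact: differentiableD.
- move=> i; rewrite (_ : partial i _ = fun x => partial i g x + partial i h x).
    exact: Algn_add.
  by apply/funext => v; exact: partialD.
- by move=> v; exact: differentiableM.
- move=> i; rewrite (_ : partial i _ = fun x => g x * partial i h x + h x * partial i g x).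
    by apply: Algn_add; apply: Algn_mul.
  by apply/funext => v; exact: partialM.
Qed.

Lemma smoothn_cst c : smoothn (fun=> c).
Proof. by apply: (@algn_smooth set0) => //; exact: Algn_cst. Qed.

Lemma smoothn_coord j : smoothn (fun v => v 0 j).
Proof.
apply: (@algn_smooth [set fun v : rV => v 0 j]); last exact: Algn_gen.
move=> g ->; split=> [v|i]; first exact: differentiable_coord.
rewrite (_ : partial i _ = fun=> (i == j)%:R); first exact: Algn_cst.
by apply/funext => v; exact: partial_coord.
Qed.

Let binary f g : smoothn f -> smoothn g -> exists S, [/\ S f, S g &
  forall g, S g -> (forall v, differentiable g v) /\
     forall i, algn S (partial i g)].
Proof.
move=> [S [Sf SP]] [T [Tg TP]]; exists (S `|` T); split; [by left|by right|].
by move=> h [/SP|/TP] [? Sh]; split=> // i; apply: Algn_gen; [left|right].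
Qed.

Lemma smoothnD f g : smoothn f -> smoothn g -> smoothn (fun v => f v + g v).
Proof.
move=> sf sg; have [S [Sf Sg SP]] := binary sf sg.
by apply: (algn_smooth SP); apply: Algn_add; apply: Algn_gen.
Qed.

Lemma smoothnM f g : smoothn f -> smoothn g -> smoothn (fun v => f v * g v).
Proof.
move=> sf sg; have [S [Sf Sg SP]] := binary sf sg.
by apply: (algn_smooth SP); apply: Algn_mul; apply: Algn_gen.
Qed.

Lemma smoothn_sum (I : Type) (s : seq I) (F : I -> rV -> R) :
  (forall j : I, smoothn (F j)) -> smoothn (fun v => \sum_(i <- s) F i v).
Proof.
move=> sF; elim: s => [|i s IH].
  by under eq_fun do rewrite big_nil; exact: smoothn_cst.
by under eq_fun do rewrite big_cons; exact: smoothnD.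
Qed.

Lemma smoothn_prod (I : Type) (s : seq I) (F : I -> rV -> R) :
  (forall j : I, smoothn (F j)) -> smoothn (fun v => \prod_(i <- s) F i v).
Proof.
move=> sF; elim: s => [|i s IH].
  by under eq_fun do rewrite big_nil; exact: smoothn_cst.
by under eq_fun do rewrite big_cons; exact: smoothnM.
Qed.

Lemma smoothn_comp (D : R -> R) f : smooth1 D -> smoothn f ->
  smoothn (fun v => D (f v)).
Proof.
move=> sD [T [Tf TP]].
pose U : set (rV -> R) := [set h | T h] `|`
  [set h | exists2 k, smooth1 k & h = k \o f].
apply: (@algn_smooth U); last by apply: Algn_gen; right; exists D.
have df v : differentiable f v by have [] := TP _ Tf.
move=> h [/= /TP[dh Th]|/= [k sk ->]].
  by split=> // i; apply: Algn_gen; left.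
split=> [v|i].
  apply: differentiable_comp => //; apply/derivable1_diffP.
  by have [] := is_derive_smooth1 (f v) sk.
rewrite (_ : partial i _ = fun v => derive1 k (f v) * partial i f v).
  apply: Algn_mul; apply: Algn_gen; [right|left]; last by have [_ /(_ i)] := TP _ Tf.
  by exists (derive1 k) => //; exact: derive1_smooth1.
by apply/funext => v; exact: partial_comp.
Qed.

Definition nsq v : R := \sum_(i < n) v 0 i ^+ 2.

Lemma nsq_ge0 v : 0 <= nsq v.
Proof. by apply: sumr_ge0 => i _; exact: sqr_ge0. Qed.

Lemma coord_le_nsq v i : v 0 i ^+ 2 <= nsq v.
Proof. by rewrite /nsq (bigD1 i)//= lerDl; apply: sumr_ge0 => j _; exact: sqr_ge0. Qed.

Lemma smoothn_nsq : smoothn nsq.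
Proof.
apply: smoothn_sum => i; under eq_fun do rewrite expr2.
by apply: smoothnM; exact: smoothn_coord.
Qed.

Lemma partial_nsq i v : partial i nsq v = 2 * v 0 i.
Proof.
rewrite /partial /nsq (_ : (fun w : rV => _) = \sum_(j < n) (fun w : rV => w 0 j ^+ 2)); last first.
  by apply/funext => w; rewrite fct_sumE.
have dj j : derivable (fun w : rV => w 0 j) v 'e_i.
  exact/diff_derivable/differentiable_coord.
rewrite derive_sum; last first.
  move=> j; under eq_fun do rewrite expr2; exact: derivableM.
rewrite (bigD1 i)//= big1 ?addr0.
  under eq_fun do rewrite expr2.
  rewrite deriveM// -/(partial i (fun w => w 0 i) v) partial_coord eqxx.
  by rewrite [_ *: 1]mulr1 mulr2n mulrDl mul1r.
move=> j ji; under eq_fun do rewrite expr2.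
rewrite deriveM// -/(partial i (fun w => w 0 j) v) partial_coord eq_sym (negbTE ji).
by rewrite [_ *: 0]mulr0 addr0.
Qed.

Lemma compact_support f (K : R) :
  (forall v i, K < `|v 0 i| -> f v = 0) ->
  compact (closure [set v | f v != 0]).
Proof.
move=> fK; pose B : set rV := [set v : rV | forall i, `[- K, K]%classic (v 0 i)].
have cB : compact B by apply: (@rV_compact _ _ (fun=> _)) => i; exact: segment_compact.
apply: (subclosed_compact _ cB); first exact: closed_closure.
rewrite (closure_id B).1; last first.
  by apply: compact_closed => //; exact: norm_hausdorff.
apply: closureS => v /= fv i; rewrite /= in_itv/= -ler_norml.
by case: leP => // /fK fv0; rewrite fv0 eqxx in fv.
Qed.

Lemma smoothn_test f (K : R) : smoothn f ->
  (forall v i, K < `|v 0 i| -> f v = 0) -> test_function f.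
Proof.
move=> sf fK; split; first by move=> s v; exact: smoothn_foldr.
exact: compact_support fK.
Qed.

End smoothn.

(** * Smooth cutoffs of intervals and boxes *)

Section box_function.
Context {R : realType} {n : nat}.
Local Notation rV := 'rV[R]_n.

(** The ramps occupy [a, a + e] and [b, b + e], both to the right of their base point. As e tends to
    0 the limit is therefore the indicator of the half-open []a, b]], and the derivative is the
    difference of one kernel placed at a and at b. *)
Definition cutoff (a b e t : R) : R := step ((t - a) / e) - step ((t - b) / e).

Lemma smooth1_cutoff a b e : smooth1 (cutoff a b e).
Proof.
have H c : smooth1 (fun t => step ((t - c) / e)).
  apply: smooth1_comp; first exact: smooth1_step.
  apply: smooth1M; last exact: smooth1_cst.
  by apply: smooth1B; [exact: smooth1_id|exact: smooth1_cst].
by apply: smooth1B; exact: H.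
Qed.

Lemma cutoff_ge0 a b e t : 0 < e -> a <= b -> 0 <= cutoff a b e t.
Proof.
by move=> e0 ab; rewrite subr_ge0 step_nd// ler_pM2r ?invr_gt0// lerD2l lerN2.
Qed.

Lemma cutoff_le1 a b e t : cutoff a b e t <= 1.
Proof. by rewrite lerBlDr (le_trans (step_le1 _))// lerDl step_ge0. Qed.

Lemma cutoff_lt a b e t : 0 < e -> a <= b -> t <= a -> cutoff a b e t = 0.
Proof.
move=> e0 ab ta; rewrite /cutoff !step_le0 ?subrr//.
  by rewrite pmulr_lle0 ?invr_gt0// subr_le0 (le_trans ta).
by rewrite pmulr_lle0 ?invr_gt0// subr_le0.
Qed.

Lemma cutoff_gt a b e t : 0 < e -> a <= b -> b + e <= t -> cutoff a b e t = 0.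
Proof.
move=> e0 ab ta; rewrite /cutoff !step_ge1 ?subrr//.
  by rewrite ler_pdivlMr// mul1r lerBrDr addrC.
by rewrite ler_pdivlMr// mul1r lerBrDr addrC (le_trans _ ta)// lerD2r.
Qed.

Lemma cutoff_gt0 a b e t : 0 < e -> a < t < b -> 0 < cutoff a b e t.
Proof.
move=> e0 /andP[at_ tb]; rewrite /cutoff [X in _ - X]step_le0 ?subr0.
  by rewrite step_gt0// divr_gt0// subr_gt0.
by rewrite pmulr_lle0 ?invr_gt0// subr_le0 ltW.
Qed.

Definition box_cutoff (a b : 'I_n -> R) (e : R) (v : rV) : R :=
  \prod_(i < n) cutoff (a i) (b i) e (v 0 i).

Lemma test_box_cutoff a b e : 0 < e -> (forall i, a i <= b i) ->
  test_function (box_cutoff a b e).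
Proof.
move=> e0 ab.
apply: (@smoothn_test _ _ _ (\sum_i (`|a i| + `|b i| + e))).
  apply: smoothn_prod => i; apply: smoothn_comp; first exact: smooth1_cutoff.
  exact: smoothn_coord.
move=> v i Kv; rewrite /box_cutoff (bigD1 i)//=.
have {Kv} : `|a i| + `|b i| + e < `|v 0 i|.
  apply: le_lt_trans Kv; rewrite [leRHS](bigD1 i)//= lerDl.
  by apply: sumr_ge0 => j _; rewrite !addr_ge0// ltW.
case: (leP 0 (v 0 i)) => [v0|v0] Kv.
  rewrite cutoff_gt ?mul0r//; have := ler_norm (b i); have := normr_ge0 (a i).
  by move: Kv; rewrite (ger0_norm v0); lra.
rewrite cutoff_lt ?mul0r//; have := ler_norm (- a i); have := normr_ge0 (b i).
by move: Kv; rewrite (ltr0_norm v0) normrN; lra.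
Qed.

End box_function.

(** * Radial test functions *)

Section log_profile.
Context {R : realType}.
Implicit Types (B D : R -> R).

Lemma is_derive_vanish B (K t : R) : (forall s, s <= K -> B s = 0) -> t < K ->
  is_derive t 1 B 0.
Proof.
move=> BK tK; have E : \forall s \near t, cst (0:R) s = B s.
  by near=> s; rewrite BK// ltW//; near: s; apply: lt_nbhsl.
by apply: near_eq_is_derive E _ => //; exact: is_derive_cst.
Unshelve. all: by end_near. Qed.

Lemma derive1_vanish B (K t : R) : (forall s, s <= K -> B s = 0) -> t < K ->
  derive1 B t = 0.
Proof.
by move=> BK tK; rewrite derive1E (@derive_val _ _ _ _ _ _ _ (is_derive_vanish BK tK)).
Qed.

(** In the variable ln t the negative powers of t become exponentials, whose smoothness comes from
    the closure lemmas. If [B] vanishes near minus infinity, the extension by 0 to t <= 0 is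
    smooth. *)
Definition log_profile B (t : R) : R := if 0 < t then B (ln t) else 0.

Lemma smooth1_log_profile B (K : R) : smooth1 B ->
  (forall t, t <= K -> B t = 0) -> smooth1 (log_profile B).
Proof.
move=> sB BK.
exists [set f | exists B, [/\ f = log_profile B, smooth1 B &
  exists K, forall t, t <= K -> B t = 0]]; split.
  by exists B; split=> //; exists K.
move=> _ [{sB BK K}B [-> sB [K BK]]].
have dB (t : R) := is_derive_smooth1 t sB.
exists (log_profile (fun t => derive1 B t * expR (- t))); split.
  exists (fun t => derive1 B t * expR (- t)); split=> //.
    apply: smooth1M; first exact: derive1_smooth1.
    by apply: smooth1_comp; [exact: smooth1_expR|exact/smooth1N/smooth1_id].
  (* The derivative is known to vanish for t < K only, hence the loss of one unit; the value of the
     threshold does not matter. *)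
  exists (K - 1) => t tK; rewrite (derive1_vanish BK) ?mul0r//.
  by rewrite (le_lt_trans tK)// ltrBlDr ltrDl.
(* Splitting at e^K instead of 0 avoids a gluing point: below e^K the function is locally zero, and
   from e^K on the argument t is positive. *)
move=> t; have [tK|tK] := ltP t (expR K).
  rewrite (_ : log_profile _ t = 0); last first.
    rewrite /log_profile; case: ifPn => // t0.
    have tK' : ln t < K by rewrite -ltr_expR lnK.
    by rewrite (derive1_vanish BK) ?mul0r.
  have E : \forall s \near t, cst (0:R) s = log_profile B s.
    near=> s; rewrite /log_profile; case: ifPn => // s0.
    by rewrite BK// -ler_expR lnK ?posrE// ltW//; near: s; exact: lt_nbhsl.
  by apply: near_eq_is_derive E _ => //; exact: is_derive_cst.
have t0 : 0 < t by rewrite (lt_le_trans _ tK)// expR_gt0.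
have E : \forall s \near t, (B \o @ln R) s = log_profile B s.
  near=> s; rewrite /log_profile ifT//; near: s; exact: lt_nbhsr.
apply: near_eq_is_derive E _ => //.
rewrite /log_profile t0 expRN lnK//.
apply: is_derive1_comp; exact: is_derive1_ln.
Unshelve. all: by end_near. Qed.

Lemma sqrt_expR_ln (t : R) : 0 < t -> Num.sqrt t = expR (ln t / 2).
Proof.
move=> t0; rewrite -[RHS]ger0_norm ?expR_ge0// -sqrtr_sqr -expRM_natl.
by rewrite mulrC divfK ?pnatr_eq0// lnK.
Qed.

(** At t = |v|^2 this is |v|^(-m) D(|v|). The variable is the square because |v|^2 is a polynomial
    in the coordinates, whereas |v| is not smooth at the origin. *)
Definition profile m D (t : R) : R := (Num.sqrt t ^+ m)^-1 * D (Num.sqrt t).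

Lemma smooth1_profile m D a : 0 < a -> smooth1 D ->
  (forall t, t <= a -> D t = 0) -> smooth1 (profile m D).
Proof.
move=> a0 sD Da.
pose B t := expR (- (m%:R * (t / 2))) * D (expR (t / 2)).
rewrite (_ : profile m D = log_profile B); last first.
  apply/funext => t; rewrite /profile /log_profile; case: ifPn => [t0|].
    by rewrite /B expRN expRM_natl -sqrt_expR_ln.
  by rewrite -leNgt => /ler0_sqrtr ->; rewrite Da ?mulr0// ltW.
apply: (@smooth1_log_profile _ (ln (a ^+ 2))).
  have s2 : smooth1 (fun t : R => t / 2).
    by apply: smooth1M; [exact: smooth1_id|exact: smooth1_cst].
  apply: smooth1M; last first.
    by apply: smooth1_comp => //; apply: smooth1_comp => //; exact: smooth1_expR.
  apply: smooth1_comp; first exact: smooth1_expR.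
  by apply: smooth1N; apply: smooth1M; first exact: smooth1_cst.
move=> t ta; rewrite /B Da ?mulr0//.
rewrite -(@ler_pXn2r _ 2) ?nnegrE ?expR_ge0 ?(ltW a0)//.
rewrite -expRM_natl mulrC divfK ?pnatr_eq0//.
by rewrite -[leRHS]lnK ?posrE ?exprn_gt0// ler_expR.
Qed.

Lemma is_derive_profile m D (t : R) : 0 < t -> smooth1 D ->
  is_derive t 1 (profile m D)
   ((- m%:R / 2 * t^-1) * profile m D t +
    (Num.sqrt t ^+ m)^-1 * (derive1 D (Num.sqrt t) / (2 * Num.sqrt t))).
Proof.
move=> t0 sD; set r := Num.sqrt t.
have r0 : 0 < r by rewrite sqrtr_gt0.
have d1 : is_derive r 1 (fun s : R => (s ^+ m)^-1) (- (r ^+ m) ^- 2 *: (m%:R * r ^+ m.-1 : R) : R).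
  by apply: is_deriveV (is_derive_powi _ _); rewrite expf_neq0// gt_eqF.
have d2 := is_derive_smooth1 r sD.
have d3 := is_derive1_comp (is_deriveM d1 d2) (is_derive1_sqrt t0).
have -> : profile m D = ((fun s : R => (s ^+ m)^-1) * D) \o Num.sqrt by [].
apply: is_derive_eq.
rewrite /profile/= -/r /GRing.scale/=.
rewrite [((fun s : R => _) * D) r](_ : _ = (r ^+ m)^-1 * D r)//.
have -> : t = r ^+ 2 by rewrite sqr_sqrtr// ltW.
have rn0 : r != 0 by rewrite gt_eqF.
case: m d1 d3 => [|m] _ _ /=.
  by rewrite !expr0 invr1; field.
rewrite !exprS; move: (derive1 _ _) (D r) => x y; field.
by rewrite rn0 expf_neq0.
Qed.

End log_profile.

Section radial_test.
Context {R : realType} {n : nat}.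
Local Notation rV := 'rV[R]_n.
Implicit Types (v : rV).

Definition enorm v : R := Num.sqrt (nsq v).

Lemma enorm_ge0 v : 0 <= enorm v. Proof. exact: sqrtr_ge0. Qed.

Lemma coord_le_enorm v i : `|v 0 i| <= enorm v.
Proof. by rewrite -sqrtr_sqr ler_sqrt ?nsq_ge0// coord_le_nsq. Qed.

Hypothesis n0 : (0 < n)%N.
Variables (D : R -> R) (a b : R).
Hypotheses (a0 : 0 < a) (sD : smooth1 D) (Da : forall t, t <= a -> D t = 0)
  (Db : forall t, b <= t -> D t = 0).

Let far v i : b < `|v 0 i| -> D (enorm v) = 0.
Proof. by move=> bv; rewrite Db// (le_trans (ltW bv))// coord_le_enorm. Qed.

Lemma test_radial : test_function (fun v => D (enorm v)).
Proof.
apply: (@smoothn_test _ _ _ b); last exact: far.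
have -> : (fun v => D (enorm v)) = (fun v => profile 0 D (nsq v)).
  by apply/funext => v; rewrite /profile expr0 invr1 mul1r.
apply: smoothn_comp; last exact: smoothn_nsq.
exact: smooth1_profile sD Da.
Qed.

Definition radial_field i v : R := v 0 i * profile n D (nsq v).

Lemma test_radial_field i : test_function (radial_field i).
Proof.
apply: (@smoothn_test _ _ _ b).
  apply: smoothnM; first exact: smoothn_coord.
  apply: smoothn_comp; last exact: smoothn_nsq.
  exact: smooth1_profile sD Da.
move=> v j bv; rewrite /radial_field /profile -/(enorm v).
by rewrite (far bv) !mulr0.
Qed.

(* The field v |v|^-n is divergence free, hence only D' contributes. *)
Lemma div_radial_field v :
  \sum_i partial i (radial_field i) v = derive1 D (enorm v) / enorm v ^+ n.-1.
Proof.
have sp := smooth1_profile n a0 sD Da.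
have dp := smoothn_diff _ (smoothn_comp sp (@smoothn_nsq R n)).
have dE i : partial i (radial_field i) v =
    v 0 i * (derive1 (profile n D) (nsq v) * (2 * v 0 i)) + profile n D (nsq v).
  rewrite partialM//; last exact: differentiable_coord.
  rewrite (partial_comp _ sp); last exact: smoothn_diff smoothn_nsq.
  by rewrite partial_nsq partial_coord eqxx mulr1.
under eq_bigr do rewrite dE.
(* At the origin both sides vanish because [D] is zero on a neighbourhood of it. *)
have [v0|v0] := eqVneq (nsq v) 0.
  have c0 i : v 0 i = 0.
    apply/eqP; rewrite -sqrf_eq0 eq_le sqr_ge0 andbT.
    by rewrite (le_trans (coord_le_nsq v i))// v0.
  rewrite big1 => [|i _]; last first.
    by rewrite c0 mul0r add0r v0 /profile sqrtr0 Da ?mulr0 ?mul0r// ltW.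
  by rewrite /enorm v0 sqrtr0 (derive1_vanish Da a0) mul0r.
have t0 : 0 < nsq v by rewrite lt_neqAle eq_sym v0 nsq_ge0.
have -> : derive1 (profile n D) (nsq v) = (- n%:R / 2 * (nsq v)^-1) * profile n D (nsq v) +
    (enorm v ^+ n)^-1 * (derive1 D (enorm v) / (2 * enorm v)).
  by rewrite derive1E; have := is_derive_profile n t0 sD => /(@derive_val _ _ _ _ _ _ _).
rewrite (eq_bigr (fun i => v 0 i ^+ 2 * (2 * ((- n%:R / 2 / nsq v) * profile n D (nsq v) +
    (enorm v ^+ n)^-1 * (derive1 D (enorm v) / (2 * enorm v)))) + profile n D (nsq v))); last first.
  by move=> i _; ring.
rewrite big_split/= -mulr_suml -/(nsq v) sumr_const card_ord -mulr_natl.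
have r0 : enorm v != 0 by rewrite gt_eqF// sqrtr_gt0.
have -> : nsq v = enorm v ^+ 2 by rewrite sqr_sqrtr// nsq_ge0.
have rn : enorm v ^+ n != 0 by rewrite expf_neq0.
have rE : enorm v ^+ n = enorm v * enorm v ^+ n.-1 by rewrite -exprS prednK.
rewrite rE in rn *; move: rn; rewrite mulf_eq0 (negbTE r0)/= => rn.
by field; rewrite rn r0.
Qed.

End radial_test.

(** * Lebesgue measure on row vectors *)

Section lebesgue_row_theory.
Context {R : realType}.
Local Notation leb1 := (@lebesgue_measure R).
Local Notation leb n := (lebesgue_row R n).
Local Open Scope ereal_scope.

Lemma measurable_row_cons_comp n d (T : measurableType d) (f : 'rV[R]_n.+1 -> T) :
  measurable_fun setT f ->
  measurable_fun setT (fun p : measurableTypeR R * 'rV[R]_n => f (row_cons p)).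
Proof. by move=> mf; apply: measurableT_comp => //; exact: measurable_row_cons. Qed.

Lemma ge0_integral_row n (f : 'rV[R]_n.+1 -> \bar R) :
  measurable_fun setT f -> (forall v, 0 <= f v) ->
  \int[leb n.+1]_v f v = \int[leb1]_t \int[leb n]_x f (row_cons (t, x)).
Proof.
move=> mf f0; rewrite [LHS](ge0_integral_pushforward (@measurable_row_cons R n))//.
rewrite preimage_setT fubini_tonelli1//.
  exact: measurable_row_cons_comp.
by move=> p; exact: f0.
Qed.

Lemma integrable_row n (f : 'rV[R]_n.+1 -> \bar R) : (leb n.+1).-integrable setT f ->
  (leb1 \x leb n).-integrable setT (fun p => f (row_cons p)).
Proof.
move=> /integrableP[mf fi]; apply/integrableP; split.
  exact: measurable_row_cons_comp.
move: fi; rewrite [X in X < _ -> _](ge0_integral_pushforward (@measurable_row_cons R n))//.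
by apply: measurableT_comp.
Qed.

Lemma integral_row n (f : 'rV[R]_n.+1 -> \bar R) : (leb n.+1).-integrable setT f ->
  \int[leb n.+1]_v f v = \int[leb1]_t \int[leb n]_x f (row_cons (t, x)).
Proof.
move=> fi; rewrite [LHS](integral_pushforward (@measurable_row_cons R n))//; last first.
- exact: integrable_row.
- exact: measurable_int fi.
by rewrite preimage_setT -integral12_prod_meas1//; exact: integrable_row.
Qed.

Lemma integral_row21 n (f : 'rV[R]_n.+1 -> \bar R) : (leb n.+1).-integrable setT f ->
  \int[leb n.+1]_v f v = \int[leb n]_x \int[leb1]_t f (row_cons (t, x)).
Proof.
move=> fi; rewrite [LHS](integral_pushforward (@measurable_row_cons R n))//; last first.
- exact: integrable_row.
- exact: measurable_int fi.
by rewrite preimage_setT -integral21_prod_meas1//; exact: integrable_row.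
Qed.

Definition boxset n (A : 'I_n -> set R) : set 'rV[R]_n := [set v | forall i, A i (v 0%R i)].

Lemma measurable_boxset n (A : 'I_n -> set R) :
  (forall i, measurable (A i)) -> measurable (boxset A).
Proof.
move=> mA; rewrite (_ : boxset A = \bigcap_(i in [set: 'I_n]) ((fun v => v 0%R i) @^-1` A i)).
  apply: fin_bigcap_measurable; first exact: finite_finset.
  move=> i _; rewrite -[X in measurable X]setTI.
  exact: measurable_coord.
by apply/seteqP; split=> [v Av i _|v Av i]; apply: Av.
Qed.

Lemma leb_boxset n (A : 'I_n -> set R) : (forall i, measurable (A i)) ->
  leb n (boxset A) = \prod_(i < n) leb1 (A i).
Proof.
elim: n A => [|n IH] A mA.
  rewrite big_ord0 /= /dirac indicE mem_set//.
  by move=> [].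
rewrite big_ord_recl -IH//= /lebesgue_step /pushforward -product_measure1E//.
  congr (_ _); apply/seteqP; split => [[t x] H|[t x] [/= At Ax] i] /=.
    split=> /=; first by have := H ord0; rewrite row_cons0.
    by move=> i; have := H (lift ord0 i); rewrite row_consS.
  by case: (unliftP ord0 i) => [j ->|->]; rewrite ?row_cons0 ?row_consS.
  exact: mA.
exact: measurable_boxset.
Qed.

Lemma leb_boxset_lty n (A : 'I_n -> set R) : (forall i, measurable (A i)) ->
  (forall i, leb1 (A i) < +oo) -> leb n (boxset A) < +oo.
Proof.
move=> mA Aoo; rewrite leb_boxset//.
have H (s : seq 'I_n) : 0 <= \prod_(i <- s) leb1 (A i) /\ \prod_(i <- s) leb1 (A i) < +oo.
  elim: s => [|i s [IH0 IH]]; first by rewrite big_nil ltry lee_fin.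
  by rewrite big_cons; split; [exact: mule_ge0|rewrite lte_mul_pinfty// ge0_fin_numE].
by have [] := H (index_enum 'I_n).
Qed.

Lemma leb_boxset_gt0 n (A : 'I_n -> set R) : (forall i, measurable (A i)) ->
  (forall i, 0 < leb1 (A i)) -> 0 < leb n (boxset A).
Proof.
move=> mA A0; rewrite leb_boxset//.
have H (s : seq 'I_n) : 0 < \prod_(i <- s) leb1 (A i).
  elim: s => [|i s IH]; first by rewrite big_nil lte_fin.
  by rewrite big_cons; exact: mule_gt0.
exact: H.
Qed.

Definition cube n (K : R) : set 'rV[R]_n := boxset (fun=> `[(- K)%R, K]%classic).

Arguments cube : clear implicits.

Lemma measurable_cube n K : measurable (cube n K).
Proof. exact: measurable_boxset. Qed.

Lemma leb_cube_lty n K : leb n (cube n K) < +oo.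
Proof.
apply: leb_boxset_lty => // i; rewrite lebesgue_measure_itv/=.
by case: ifPn => _; rewrite -?EFinB ?ltry.
Qed.

(** Both sides are measures in [A], so by uniqueness of Lebesgue measure it is enough to compare
    them on half-open intervals. *)
Lemma leb1_scale (s : R) (A : set R) : (0 < s)%R -> measurable A ->
  s%:E * leb1 ((fun t => s * t)%R @^-1` A) = leb1 A.
Proof.
move=> s0 mA.
have ms : measurable_fun [set: measurableTypeR R]
   ((fun t => s * t)%R : measurableTypeR R -> measurableTypeR R).
  exact: measurable_funM.
pose m := mscale (NngNum (ltW s0)) (pushforward leb1
   ((fun t => s * t)%R : measurableTypeR R -> measurableTypeR R)).
apply/esym; apply: (@lebesgue_measure_unique R (m ms)) => // _ [[a b]] _ <-.
transitivity (s%:E * leb1 ((fun t => s * t)%R @^-1` `]a, b])); last by [].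
have -> : ((fun t => s * t)%R @^-1` `]a, b]) = `](a / s)%R, (b / s)%R]%classic.
  apply/seteqP; split=> t /=; rewrite !in_itv/= => /andP[ax xb].
    by rewrite ltr_pdivrMr// ler_pdivlMr// (mulrC t) ax xb.
  by move: ax xb; rewrite ltr_pdivrMr// ler_pdivlMr// (mulrC t) => -> ->.
rewrite !lebesgue_measure_itv/= !lte_fin ltr_pM2r ?invr_gt0//.
case: ifPn => ab; rewrite ?mule0// -!EFinB -EFinM -mulrBl.
by rewrite mulrC divfK// gt_eqF.
Qed.

Lemma ge0_integral_leb1_scale (s : R) (f : R -> \bar R) : (0 < s)%R ->
  measurable_fun setT f -> (forall t, 0 <= f t) ->
  s%:E * \int[leb1]_t f (s * t)%R = \int[leb1]_t f t.
Proof.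
move=> s0 mf f0.
have ms : measurable_fun [set: measurableTypeR R]
   ((fun t => s * t)%R : measurableTypeR R -> measurableTypeR R).
  exact: measurable_funM.
have := ge0_integral_pushforward ms leb1 measurableT mf (fun y _ => f0 y).
rewrite preimage_setT /comp => <-.
rewrite -(ge0_integral_mscale _ _ (NngNum (ltW s0)))//.
apply: eq_measure_integral => A mA _.
exact: leb1_scale.
Qed.

(** Induction on the dimension: each coordinate contributes one factor s through the one-dimensional
    dilation. *)
Lemma ge0_integral_row_scale n (s : R) (f : 'rV[R]_n -> \bar R) : (0 < s)%R ->
  measurable_fun setT f -> (forall t, 0 <= f t) ->
  (s ^+ n)%:E * \int[leb n]_v f (s *: v)%R = \int[leb n]_v f v.
Proof.
move=> s0; elim: n f => [|n IH] f mf f0.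
  rewrite expr0 mul1e /=; apply: eq_integral => v _.
  by congr f; apply/rowP => -[].
have msc m : measurable_fun setT (fun v : 'rV[R]_m => (s *: v)%R).
  apply: measurable_fun_coordP => i; under eq_fun do rewrite mxE.
  by apply: measurable_funM => //; exact: measurable_coord.
have E t x : (s *: row_cons (t, x) = row_cons (s * t, s *: x) :> 'rV[R]_n.+1)%R.
  apply/rowP => i; rewrite mxE.
  by case: (unliftP ord0 i) => [j ->|->]; rewrite ?row_cons0 ?row_consS ?mxE.
have mfc := measurable_row_cons_comp mf.
rewrite ge0_integral_row//; last exact: (measurableT_comp mf (msc n.+1)).
rewrite [RHS]ge0_integral_row//.
have mg := measurable_fun_fubini_tonelli_F (m2 := leb n) _ mfc (fun p => f0 (row_cons p)).
have g0 t : 0 <= \int[leb n]_x f (row_cons (t, x)) by exact: integral_ge0.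
have := @ge0_integral_leb1_scale s _ s0 mg g0; rewrite /fubini_F => <-.
rewrite exprS EFinM -muleA; congr (_ * _).
rewrite -ge0_integralZl//; last 3 first.
- have mfs := measurable_row_cons_comp (measurableT_comp mf (msc n.+1)).
  exact: (measurable_fun_fubini_tonelli_F (m2 := leb n) _ mfs (fun p => f0 _)).
- by move=> t _; exact: integral_ge0.
- by rewrite lee_fin exprn_ge0// ltW.
apply: eq_integral => t _; rewrite -(IH (fun x => f (row_cons (s * t, x))%R)) //.
  by congr (_ * _); apply: eq_integral => x _; rewrite E.
exact: (measurableT_comp mfc (pair1_measurable _)).
Qed.

End lebesgue_row_theory.
Arguments cube {R} n K.

(** * Measurability of continuous functions on row vectors *)

Section continuous_measurable.
Context {R : realType} {n : nat}.
Local Notation rV := 'rV[R]_n.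

Definition grid (k : nat) (v : rV) : rV :=
  \row_j ((Num.floor (k.+1%:R * v 0 j))%:~R / k.+1%:R).

Lemma grid_cvg (v : rV) : grid ^~ v @ \oo --> v.
Proof.
apply/cvgrPdist_le => e e0; near=> k.
rewrite [leLHS]mx_normrE; apply: bigmax_le; first exact: ltW.
move=> [i j] _ /=; rewrite ord1 !mxE.
have k0 : (0 : R) < k.+1%:R by rewrite ltr0n.
have H := floor_itv (k.+1%:R * v 0 j); move: H => /andP[H1 H2].
have -> : v 0 j - (Num.floor (k.+1%:R * v 0 j))%:~R / k.+1%:R =
  (k.+1%:R * v 0 j - (Num.floor (k.+1%:R * v 0 j))%:~R) / k.+1%:R.
  by rewrite mulrBl mulrAC divff ?mul1r// gt_eqF.
rewrite normrM normfV (ger0_norm (ltW k0)) ger0_norm ?subr_ge0//.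
apply: (@le_trans _ _ k.+1%:R^-1).
  rewrite ler_pdivrMr// mulVf ?gt_eqF// lerBlDl.
  by move: H2; rewrite intrD => /ltW.
by apply/ltW; near: k; exact: near_infty_natSinv_lt (PosNum e0).
Unshelve. all: by end_near. Qed.

(** The sigma-algebra on row vectors is generated by the coordinates and is not Borel by definition.
    The functions f \o [grid k] converge pointwise to f and are constant on countably many cells,
    which are boxes. *)
Lemma measurable_continuous (f : rV -> R) : continuous f -> measurable_fun setT f.
Proof.
move=> cf; apply: (@measurable_fun_cvg _ _ _ _ (fun k => f \o grid k)); last first.
  by move=> v _; apply: cvg_comp; [exact: grid_cvg|exact: cf].
move=> k _ Y mY; rewrite setTI.
pose G (z : {ffun 'I_n -> int}) : rV := \row_j ((z j)%:~R / k.+1%:R).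
pose F z : set rV := if f (G z) \in Y then
  boxset (fun j => [set t | Num.floor (k.+1%:R * t) = z j]) else set0.
rewrite (_ : _ @^-1` _ = \bigcup_z F z).
  apply: countable_bigcupT_measurable; first exact: countableP.
  move=> z; rewrite /F; case: ifP => _; last exact: measurable0.
  apply: measurable_boxset => j.
  rewrite (_ : [set _ | _] = `[(z j)%:~R / k.+1%:R, (z j + 1)%:~R / k.+1%:R[%classic)//.
  apply/seteqP; split => t /=; rewrite in_itv/=.
    move=> <-; rewrite ler_pdivrMr ?ltr0n// ltr_pdivlMr ?ltr0n// mulrC.
    exact: floor_itv.
  rewrite ler_pdivrMr ?ltr0n// ltr_pdivlMr ?ltr0n// mulrC => H.
  exact: floor_def.
apply/seteqP; split => [v /= Yv|v [z _]].
  pose z : {ffun 'I_n -> int} := [ffun j => Num.floor (k.+1%:R * v 0 j)].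
  have Gz : G z = grid k v by apply/rowP => j; rewrite !mxE ffunE.
  by exists z => //; rewrite /F Gz mem_set// => j /=; rewrite ffunE.
rewrite /F; case: ifPn => // /set_mem YG Hz /=.
by have -> : grid k v = G z by apply/rowP => j; rewrite !mxE Hz.
Qed.

End continuous_measurable.

(** * The hyperbolic metric and measure in the chart *)

Section metric.
Context {R : realType} {n : nat}.
Local Notation rV := 'rV[R]_n.
Implicit Types (v : rV).

Lemma heightE v : height v = Num.sqrt (1 + nsq v). Proof. by []. Qed.

Lemma sqr_height v : height v ^+ 2 = 1 + nsq v.
Proof. by rewrite sqr_sqrtr// addr_ge0// nsq_ge0. Qed.

Lemma height_ge1 v : 1 <= height v.
Proof. by rewrite -[leLHS]sqrtr1 ler_sqrt ?addr_ge0 ?nsq_ge0// lerDl nsq_ge0. Qed.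

Lemma metric_mx v : metric v = 1%:M - (height v ^+ 2)^-1 *: (v^T *m v).
Proof.
apply/matrixP => i j; rewrite metricE !mxE big_ord1 !mxE.
by rewrite mulrC.
Qed.

Lemma row_mul_tr v : v *m v^T = (nsq v)%:M.
Proof.
rewrite [LHS]mx11_scalar mxE; congr (_%:M); apply: eq_bigr => i _.
by rewrite mxE expr2.
Qed.

(** Sherman-Morrison: the metric is the rank-one perturbation 1 - v^T v / (1 + |v|^2) of the
    identity. *)
Lemma invmx_metric v : invmx (metric v) = 1%:M + v^T *m v.
Proof.
have h0 : 1 + nsq v != 0 by rewrite -sqr_height expf_neq0// gt_eqF// height_gt0.
have E : metric v *m (1%:M + v^T *m v) = 1%:M.
  rewrite metric_mx mulmxBl !mulmxDr !mul1mx !mulmx1 -scalemxAl.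
  rewrite mulmxA -[v^T *m v *m v^T]mulmxA row_mul_tr mul_mx_scalar -!scalemxAl.
  rewrite scalerA -scalerDl addrAC -[RHS]addr0 -addrA; congr (_ + _).
  rewrite sqr_height (_ : _ + _ * _ = 1) ?scale1r ?addNr//; by field.
have [um _] := mulmx1_unit E.
by have := congr1 (mulmx (invmx (metric v))) E; rewrite mulmxA mulVmx// mul1mx mulmx1.
Qed.

Lemma det_metric v : \det (metric v) = (height v ^+ 2)^-1.
Proof.
set c := (height v ^+ 2)^-1.
(* This bordered matrix has two block-triangular factorizations, one with determinant det(metric)
   and one with determinant 1 - c |v|^2; comparing them is the matrix determinant lemma. *)
pose M : 'M[R]_(1 + n) := block_mx 1%:M v (c *: v^T) 1%:M.
have E1 : M = block_mx 1%:M 0 (c *: v^T) 1%:M *m block_mx 1%:M v 0 (metric v).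
  rewrite mulmx_block !(mul1mx, mulmx1, mul0mx, mulmx0, addr0) metric_mx.
  by rewrite -scalemxAl addrC subrK.
have E2 : M = block_mx (1%:M - c *: (nsq v)%:M) v 0 1%:M *m block_mx 1%:M 0 (c *: v^T) 1%:M.
  rewrite mulmx_block !(mul1mx, mulmx1, mul0mx, mulmx0, add0r).
  by rewrite -scalemxAr row_mul_tr subrK.
have := congr1 (@determinant _ _) E1; rewrite E2 !det_mulmx !det_lblock !det_ublock !det1 !mul1r !mulr1 => <-.
rewrite scale_scalar_mx -raddfB/= det_scalar1.
rewrite /c sqr_height; field.
by rewrite -sqr_height expf_neq0// gt_eqF// height_gt0.
Qed.

Lemma volume_densityE v : volume_density v = (height v)^-1.
Proof.
by rewrite /volume_density det_metric sqrtrV ?exprn_ge0 ?sqrtr_ge0// sqrtr_sqr ger0_norm// sqrtr_ge0.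
Qed.

Lemma volume_density_gt0 v : 0 < volume_density v.
Proof. by rewrite volume_densityE invr_gt0 height_gt0. Qed.

Lemma volume_density_le1 v : volume_density v <= 1.
Proof. by rewrite volume_densityE invf_le1 ?height_gt0// height_ge1. Qed.

(** By [invmx_metric] this is the inverse metric on real covectors. The Hermitian product [coinner]
    decouples into it on real and imaginary parts, so the analysis below is carried out for real
    functions. *)
Definition gip v (a b : 'I_n -> R) : R :=
  \sum_i a i * b i + (\sum_i v 0 i * a i) * (\sum_i v 0 i * b i).

Lemma gip_ge0 v a : 0 <= gip v a a.
Proof.
by rewrite addr_ge0// -?expr2 ?sqr_ge0//; apply: sumr_ge0 => i _; rewrite -expr2 sqr_ge0.
Qed.

Lemma gipDl v a b c : gip v (fun i => a i + b i) c = gip v a c + gip v b c.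
Proof.
rewrite /gip; under eq_bigr do rewrite mulrDl.
under [X in _ + X * _]eq_bigr do rewrite mulrDr.
by rewrite !big_split/= mulrDl addrACA.
Qed.

Lemma gipZl v k a c : gip v (fun i => k * a i) c = k * gip v a c.
Proof.
rewrite /gip; under eq_bigr do rewrite -mulrA.
under [X in _ + X * _]eq_bigr do rewrite mulrCA.
by rewrite -!mulr_sumr mulrDr mulrA.
Qed.

Lemma gipC v a b : gip v a b = gip v b a.
Proof. by rewrite /gip [X in _ + X]mulrC; congr (_ + _); apply: eq_bigr => i _; rewrite mulrC. Qed.

Lemma gipDr v a b c : gip v c (fun i => a i + b i) = gip v c a + gip v c b.
Proof. by rewrite gipC gipDl !(gipC v c). Qed.

Lemma gipZr v k a c : gip v c (fun i => k * a i) = k * gip v c a.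
Proof. by rewrite gipC gipZl gipC. Qed.

Lemma coinnerE v (a b : 'I_n -> R[i]) : coinner v a b =
  \sum_i a i * conjc (b i) + (\sum_i (v 0 i)%:C * a i) * (\sum_i (v 0 i)%:C * conjc (b i)).
Proof.
rewrite /coinner mulr_suml -big_split/=; apply: eq_bigr => i _.
rewrite mulr_sumr [X in X + _](_ : _ = \sum_j ((i == j)%:R : R)%:C * a i * conjc (b j)).
  rewrite -big_split/=; apply: eq_bigr => j _.
  rewrite invmx_metric !mxE big_ord1 !mxE rmorphD rmorphM/=.
  by rewrite 2!mulrDl; congr (_ + _); rewrite -!mulrA; congr (_ * _); rewrite mulrCA.
rewrite (bigD1 i)//= eqxx mul1r big1 ?addr0// => j /negPf ji.
by rewrite eq_sym ji !mul0r.
Qed.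

End metric.

(** * Real and imaginary parts *)

Section complex_parts.
Context {R : realType}.
Implicit Types (z w : R[i]).

Lemma Re_mul z w : complex.Re (z * w) = complex.Re z * complex.Re w - complex.Im z * complex.Im w.
Proof. by case: z w => [a b] [c d]. Qed.

Lemma Im_mul z w : complex.Im (z * w) = complex.Re z * complex.Im w + complex.Im z * complex.Re w.
Proof. by case: z w => [a b] [c d]. Qed.

Lemma Re_add z w : complex.Re (z + w) = complex.Re z + complex.Re w.
Proof. by case: z w => [a b] [c d]. Qed.

Lemma Im_add z w : complex.Im (z + w) = complex.Im z + complex.Im w.
Proof. by case: z w => [a b] [c d]. Qed.

Lemma Re_opp z : complex.Re (- z) = - complex.Re z. Proof. by case: z. Qed.

Lemma Im_opp z : complex.Im (- z) = - complex.Im z. Proof. by case: z. Qed.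

Lemma Re_sum (I : Type) (s : seq I) (F : I -> R[i]) :
  complex.Re (\sum_(i <- s) F i) = \sum_(i <- s) complex.Re (F i).
Proof. by elim: s => [|i s IH]; rewrite ?big_nil// !big_cons Re_add IH. Qed.

Lemma Im_sum (I : Type) (s : seq I) (F : I -> R[i]) :
  complex.Im (\sum_(i <- s) F i) = \sum_(i <- s) complex.Im (F i).
Proof. by elim: s => [|i s IH]; rewrite ?big_nil// !big_cons Im_add IH. Qed.

Lemma eqc z w : complex.Re z = complex.Re w -> complex.Im z = complex.Im w -> z = w.
Proof. by case: z w => [a b] [c d] /= -> ->. Qed.

Lemma cabsE z : cabs z = Num.sqrt (complex.Re z ^+ 2 + complex.Im z ^+ 2).
Proof. by case: z. Qed.

Lemma sqr_cabs z : cabs z ^+ 2 = complex.Re z ^+ 2 + complex.Im z ^+ 2.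
Proof. by rewrite cabsE sqr_sqrtr// addr_ge0// sqr_ge0. Qed.


Lemma ltc0 z : (0 < z) = (complex.Im z == 0) && (0 < complex.Re z).
Proof. by case: z => a b; rewrite ltcE/=. Qed.

Context {n : nat} (v : 'rV[R]_n).
Implicit Types (a : 'I_n -> R[i]) (b : 'I_n -> R).

Lemma Re_coinner_sq a : complex.Re (coinner v a a) =
  gip v (fun i => complex.Re (a i)) (fun i => complex.Re (a i)) +
  gip v (fun i => complex.Im (a i)) (fun i => complex.Im (a i)).
Proof.
have ReC (x : R) z : complex.Re (x%:C * z) = x * complex.Re z by rewrite Re_mul/= mul0r subr0.
have ImC (x : R) z : complex.Im (x%:C * z) = x * complex.Im z by rewrite Im_mul/= mul0r addr0.
rewrite coinnerE Re_add Re_mul !Re_sum !Im_sum /gip.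
under eq_bigr do rewrite Re_mul.
under [X in _ + (X * _ - _)]eq_bigr do rewrite ReC.
under [X in _ + (_ * X - _)]eq_bigr do rewrite ReC.
under [X in _ + (_ * _ - X * _)]eq_bigr do rewrite ImC.
under [X in _ + (_ * _ - _ * X)]eq_bigr do rewrite ImC.
have cR z : complex.Re (conjc z) = complex.Re z by case: z.
have cI z : complex.Im (conjc z) = - complex.Im z by case: z.
under eq_bigr do rewrite cR cI mulrN opprK.
under [X in _ + (_ * X - _)]eq_bigr do rewrite cR.
under [X in _ + (_ * _ - _ * X)]eq_bigr do rewrite cI mulrN.
by rewrite sumrN mulrN opprK big_split/= addrACA.
Qed.

Lemma coinner_real a b : coinner v a (fun i => (b i)%:C) =
  gip v (fun i => complex.Re (a i)) b +i* gip v (fun i => complex.Im (a i)) b.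
Proof.
have ReC (x : R) z : complex.Re (x%:C * z) = x * complex.Re z by rewrite Re_mul/= mul0r subr0.
have ImC (x : R) z : complex.Im (x%:C * z) = x * complex.Im z by rewrite Im_mul/= mul0r addr0.
have cC (x : R) : conjc x%:C = x%:C by rewrite /= oppr0.
have -> : coinner v a (fun i => (b i)%:C) =
  \sum_i (b i)%:C * a i + (\sum_i v 0 i * b i)%:C * (\sum_i (v 0 i)%:C * a i).
  rewrite coinnerE; congr (_ + _).
    by apply: eq_bigr => i _; rewrite cC mulrC.
  rewrite mulrC; congr (_ * _); rewrite rmorph_sum; apply: eq_bigr => i _.
  by rewrite cC rmorphM.
apply: eqc => /=.
  rewrite Re_add ReC !Re_sum /gip [X in _ = _ + X]mulrC; congr (_ + _ * _).
    by apply: eq_bigr => i _; rewrite ReC mulrC.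
  by apply: eq_bigr => i _; rewrite ReC.
rewrite Im_add ImC !Im_sum /gip [X in _ = _ + X]mulrC; congr (_ + _ * _).
  by apply: eq_bigr => i _; rewrite ImC mulrC.
by apply: eq_bigr => i _; rewrite ImC.
Qed.

End complex_parts.

(** * Integration against the hyperbolic measure *)

Section hyp_integral.
Context {R : realType} {n : nat}.
Local Notation rV := 'rV[R]_n.
Local Notation mu := (@hyp_measure R n).
Local Notation leb := (lebesgue_row R n).
Local Notation w := (@volume_density R n).
Local Open Scope ereal_scope.

Let mw : measurable_fun setT (EFin \o w).
Proof. by apply/measurable_EFinP; exact: measurable_volume_density. Qed.

Let w0 v : 0 <= (w v)%:E. Proof. by rewrite lee_fin ltW// volume_density_gt0. Qed.

Import HBNNSimple.

(** For indicators this is the definition of [hyp_measure]; monotone approximation by simple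
    functions gives the general case. *)
Lemma ge0_integral_hyp (f : rV -> \bar R) : measurable_fun setT f ->
  (forall v, 0 <= f v) -> \int[mu]_v f v = \int[leb]_v (f v * (w v)%:E).
Proof.
move=> mf f0; pose f_ := nnsfun_approx measurableT mf.
have lim_f v : (f_ k v)%:E @[k --> \oo] --> f v by exact: cvg_nnsfun_approx.
transitivity (limn (fun k => \int[mu]_v (f_ k v)%:E)).
  rewrite -monotone_convergence//.
  - by apply: eq_integral => v _; apply/esym/cvg_lim.
  - by move=> k; exact/measurable_EFinP.
  - by move=> k v _; rewrite lee_fin.
  - by move=> v _ k m km; rewrite lee_fin; exact/lefP/nd_nnsfun_approx.
rewrite [X in limn X](_ : _ = (fun k => \int[leb]_v ((f_ k v)%:E * (w v)%:E))).
  rewrite -monotone_convergence//.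
  - apply: eq_integral => v _; apply/cvg_lim => //.
    by apply: cvgeZr.
  - by move=> k; apply: emeasurable_funM => //; exact/measurable_EFinP.
  - by move=> k v _; rewrite mule_ge0// lee_fin.
  - move=> v _ k m km; rewrite lee_wpmul2r// lee_fin; exact/lefP/nd_nnsfun_approx.
apply/funext => k.
rewrite integralT_nnsfun sintegralE.
transitivity (\int[leb]_v \sum_(r \in range (f_ k))
    ((r * \1_(f_ k @^-1` [set r]) v)%:E * (w v)%:E)); last first.
  apply: eq_integral => v _; rewrite [in RHS]fimfunE -fsumEFin// ge0_mule_fsuml// => r.
  exact: nnfun_muleindic_ge0.
rewrite ge0_integral_fsum//; last 2 first.
- move=> r; apply: emeasurable_funM => //; apply/measurable_EFinP.
  exact: measurable_funM.
- by move=> r v _; rewrite mule_ge0// nnfun_muleindic_ge0.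
apply: eq_fsbigr => r _.
have mfr : measurable (f_ k @^-1` [set r]) by exact: measurable_funPTI.
(* The scalar is taken out of the integral for r >= 0 only; for r < 0 the level set of a nonnegative
   function is empty. *)
have [r0|r0] := ltP r 0%R.
  rewrite preimage_nnfun0// measure0 mule0 integral0_eq// => v _.
  by rewrite indic0 mulr0 mul0e.
under eq_integral do rewrite EFinM -muleA.
rewrite ge0_integralZl//; last 2 first.
- by apply: emeasurable_funM => //; exact/measurable_EFinP.
- by move=> v _; rewrite mule_ge0// lee_fin.
congr (_ * _); rewrite [LHS](@integral_mkcond _ _ _ leb).
by rewrite epatch_indic; apply: eq_integral => v _; rewrite muleC.
Qed.

Lemma integral_hyp (f : rV -> R) : measurable_fun setT f ->
  \int[mu]_v (f v)%:E = \int[leb]_v (f v * w v)%:E.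
Proof.
move=> mf; rewrite integralE [RHS]integralE; congr (_ - _).
  rewrite ge0_integral_hyp//; last first.
    by apply: measurable_funepos; exact/measurable_EFinP.
  apply: eq_integral => v _; rewrite !funeposE -!EFin_max -EFinM maxr_pMl ?mul0r//.
  by rewrite ltW// volume_density_gt0.
rewrite ge0_integral_hyp//; last first.
  by apply: measurable_funeneg; exact/measurable_EFinP.
apply: eq_integral => v _; rewrite !funenegE -!EFinN -!EFin_max -EFinM maxr_pMl ?mul0r ?mulNr//.
by rewrite ltW// volume_density_gt0.
Qed.


Lemma integrable_hyp (f : rV -> R) : measurable_fun setT f ->
  mu.-integrable setT (EFin \o f) <-> leb.-integrable setT (fun v => (f v * w v)%:E).
Proof.
move=> mf.
have mfw : measurable_fun setT (fun v => (f v * w v)%R).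
  by apply: measurable_funM => //; exact: measurable_volume_density.
have E : \int[mu]_v `|(f v)%:E| = \int[leb]_v `|(f v * w v)%:E|.
  rewrite ge0_integral_hyp//; last by apply: measurableT_comp => //; exact/measurable_EFinP.
  apply: eq_integral => v _; rewrite /= -EFinM normrM (gtr0_norm (volume_density_gt0 _))//.
by split=> /integrableP[_ fi]; apply/integrableP; (split; [exact/measurable_EFinP|]); rewrite /= -?E// E.
Qed.

(** The density is positive everywhere, so the two measures have the same null sets and
    almost-everywhere statements pass freely between them. *)
Lemma hyp_measure0P (A : set rV) : measurable A -> mu A = 0 <-> leb A = 0.
Proof.
move=> mA; have E : mu A = \int[leb]_(v in A) (w v)%:E by [].
split=> [mA0|lA0]; last by rewrite E null_set_integral//; exact: measurable_funTS.
have : \int[leb]_(v in A) `|(w v)%:E| = 0.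
  by rewrite -[RHS]mA0 E; apply: eq_integral => v _; rewrite gee0_abs.
move=> /(ae_eq_integral_abs leb mA (measurable_funTS mw))[N [mN N0 AN]].
apply/(subset_measure0 mA mN) => // v Av; apply: AN => /= /(_ Av) [].
by apply/eqP; rewrite gt_eqF// volume_density_gt0.
Qed.

Lemma ae_hypP (P : rV -> Prop) : {ae mu, forall v, P v} <-> {ae leb, forall v, P v}.
Proof.
by split=> -[N [mN N0 PN]]; exists N; split=> //; apply/hyp_measure0P.
Qed.

End hyp_integral.

(** * Test functions, integration by parts, uniqueness of weak derivatives *)

Section test_functions.
Context {R : realType} {n : nat}.
Local Notation rV := 'rV[R]_n.
Local Notation leb := (lebesgue_row R n).
Implicit Types (phi psi f : rV -> R) (v : rV) (i : 'I_n).

Lemma coord_le_norm v i : `|v 0 i| <= `|v|.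
Proof. by rewrite [leRHS]mx_normrE; apply: le_trans (le_bigmax _ _ (0, i)). Qed.

Lemma test_diff phi v : test_function phi -> differentiable phi v.
Proof. by move=> [/(_ [::])]. Qed.

Lemma test_continuous phi : test_function phi -> continuous phi.
Proof. by move=> tphi v; apply: differentiable_continuous; exact: test_diff. Qed.

Lemma closure_partial phi i :
  closure [set v | partial i phi v != 0] `<=` closure [set v | phi v != 0].
Proof.
have key (v : rV) : (\forall w \near v, (cst 0 : rV -> R) w = phi w) -> partial i phi v = 0.
  move=> N; have d0 : is_derive v ('e_i : rV) phi 0.
    exact: near_eq_is_derive N (is_derive_cst _ _ _).
  exact: derive_val.
rewrite [X in _ `<=` X](iffLR (closure_id _) (@closed_closure _ _)).
apply: closureS => v /= pv; apply: contrapT => nv; move/eqP: pv; apply.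
have N : \near v, cst 0 v = phi v.
  have /(open_nbhs_nbhs) : open_nbhs v (~` closure [set v | phi v != 0]).
    by split=> //; apply: closed_openC; exact: closed_closure.
  apply: filterS => w nw; apply/esym/eqP; apply: contrapT => /negP pw.
  by apply: nw; apply: subset_closure.
exact: key N.
Qed.

Lemma test_partial phi i : test_function phi -> test_function (partial i phi).
Proof.
move=> [dphi cphi]; split.
  by move=> s v; have := dphi (rcons s i) v; rewrite foldr_rcons.
by apply: (subclosed_compact _ cphi); [exact: closed_closure|exact: closure_partial].
Qed.

Lemma test_bounded phi : test_function phi ->
  exists M K : R, [/\ 0 <= M, forall v, `|phi v| <= M &
    forall v, phi v != 0 -> cube n K v].
Proof.
move=> tphi; have [_ cphi] := tphi.
have [K [_ HK]] := compact_bounded cphi.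
have : compact (phi @` closure [set v | phi v != 0]).
  apply: continuous_compact => //; apply: continuous_subspaceT.
  exact: test_continuous.
move=> /compact_bounded[M [_ HM]].
exists (`|M| + 1), (`|K| + 1); split.
- by rewrite addr_ge0.
- move=> v; have [->|pv] := eqVneq (phi v) 0; first by rewrite normr0 addr_ge0.
  apply: HM; first by rewrite ltr_pwDr// ler_norm.
  by exists v => //; exact: subset_closure.
- move=> v pv i; rewrite /= in_itv/= -ler_norml.
  have /HK : `|K| + 1 > K by rewrite ltr_pwDr// ler_norm.
  have pc : closure [set v | phi v != 0] v by exact: subset_closure.
  move=> /(_ v pc); apply: le_trans.
  exact: coord_le_norm.
Qed.

Lemma measurable_test phi : test_function phi -> measurable_fun setT phi.
Proof. by move=> /test_continuous; exact: measurable_continuous. Qed.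

Definition loc_integrable f := measurable_fun setT f /\
  forall K, leb.-integrable (cube n K) (EFin \o f).

Lemma loc_integrableM f phi M K : loc_integrable f -> measurable_fun setT phi ->
  (forall v, `|phi v| <= M) -> (forall v, phi v != 0 -> cube n K v) ->
  leb.-integrable setT (fun v => (f v * phi v)%:E).
Proof.
move=> [mf fi] mphi phiM phiK.
have : leb.-integrable (cube n K) ((EFin \o f) \* (EFin \o phi))%E.
  apply: integrableMl => //.
  - exact: measurable_cube.
  - exact: measurable_funTS.
  - exists M; split; first exact: num_real.
    by move=> x Mx v _ /=; rewrite (le_trans (phiM v))// ltW.
move=> /(iffLR (integrable_mkcond _ (measurable_cube K))).
apply: eq_integrable => // v _; rewrite patchE; case: ifPn => // /negP nv.
rewrite /= (_ : phi v = 0) ?mulr0//; apply/eqP; apply: contrapT => /negP pv.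
by apply: nv; rewrite inE; exact: phiK.
Qed.

Lemma loc_integrable_test f phi : loc_integrable f -> test_function phi ->
  leb.-integrable setT (fun v => (f v * phi v)%:E).
Proof.
move=> fi tphi; have [M [K [_ phiM phiK]]] := test_bounded tphi.
exact: loc_integrableM (measurable_test tphi) phiM phiK.
Qed.

Lemma loc_integrable_cst c : loc_integrable (fun=> c).
Proof.
split=> // K; apply: measurable_bounded_integrable => //.
- exact: measurable_cube.
- exact: leb_cube_lty.
- by exists `|c|; split=> // x cx v _; exact: ltW.
Qed.

Lemma integrable_continuous f K : continuous f ->
  (forall v i, K < `|v 0 i| -> f v = 0) -> leb.-integrable setT (EFin \o f).
Proof.
move=> cf fK; have fK' v : f v != 0 -> cube n K v.
  move=> fv i; rewrite /= in_itv/= -ler_norml; case: leP => // /fK fv0.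
  by rewrite fv0 eqxx in fv.
have cc : compact (f @` cube n K).
  apply: continuous_compact; first exact: continuous_subspaceT.
  by apply: (@rV_compact _ _ (fun=> _)) => i; exact: segment_compact.
have [M [_ HM]] := compact_bounded cc.
have fM v : `|f v| <= `|M| + 1.
  have [->|fv] := eqVneq (f v) 0; first by rewrite normr0 addr_ge0.
  apply: HM; first by rewrite ltr_pwDr// ler_norm.
  by exists v => //; exact: fK'.
have := loc_integrableM (loc_integrable_cst 1) (measurable_continuous cf) fM fK'.
by apply: eq_integrable => // v _; rewrite mul1r.
Qed.

Lemma integrable_test phi : test_function phi -> leb.-integrable setT (EFin \o phi).
Proof.
move=> tphi; have := loc_integrable_test (loc_integrable_cst 1) tphi.
by apply: eq_integrable => // v _; rewrite mul1r.
Qed.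

End test_functions.

(** * Integration by parts for test functions *)

Section integration_by_parts.
Context {R : realType}.
Local Notation leb1 := (@lebesgue_measure R).
Local Notation leb n := (lebesgue_row R n).

Lemma integral_derive0 (g g' : R -> R) (K : R) : (forall t : R, is_derive t 1 g (g' t)) ->
  continuous g' -> (forall t, K < `|t| -> g t = 0) ->
  (\int[leb1]_t (g' t)%:E = 0)%E.
Proof.
(* [K] may be negative; [L] is positive and exceeds [K], so [g] vanishes at both ends of [-L, L]. *)
move=> dg cg gK; pose L : R := `|K| + 1.
have KL : K < L by rewrite ltr_pwDr// ler_norm.
have g'0 t : K < `|t| -> g' t = 0.
  move=> Kt; have N : \near t, cst (0 : R) t = g t.
    near=> s; rewrite gK//; near: s.
    have : `|s| @[s --> t] --> `|t| by apply: continuous_comp => //; exact: norm_continuous.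
    by move=> /(_ _ (lt_nbhsr Kt)).
  have d0 : is_derive t 1 g 0 by apply: near_eq_is_derive N _ => //; exact: is_derive_cst.
  by rewrite -(@derive_val _ _ _ _ _ _ _ (dg t)); exact: derive_val.
rewrite -(setTI [set: R]) (_ : setT `&` setT = setT) ?setTI//.
transitivity (\int[leb1]_(t in `[(- L)%R, L]) (g' t)%:E)%E.
  rewrite [RHS]integral_mkcond; apply: eq_integral => t _.
  rewrite patchE; case: ifPn => //; rewrite notin_setE/= in_itv/= -ler_norml => /negP.
  by rewrite -ltNge => Lt; rewrite g'0// (lt_trans KL).
have L0 : - L < L by rewrite gtrN// ltr_wpDl.
have cgg : continuous g.
  by move=> t; apply/differentiable_continuous/derivable1_diffP; have [] := dg t.
rewrite (@continuous_FTC2 _ g' g)//.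
- by rewrite !gK ?sube0// ?normrN (lt_le_trans KL)// ler_norm.
- exact: continuous_subspaceT.
- split.
  + by move=> t _; have [] := dg t.
  + exact/cvg_at_right_filter/cgg.
  + exact/cvg_at_left_filter/cgg.
- by move=> t _; rewrite derive1E; exact: derive_val.
Unshelve. all: by end_near. Qed.

Lemma row_cons_line0 n (h t : R) (x : 'rV[R]_n) :
  h *: 'e_ord0 + row_cons (t, x) = row_cons (h + t, x).
Proof.
apply/rowP => i; rewrite !mxE eqxx/=.
case: (unliftP ord0 i) => [j ->|->]; rewrite ?liftK ?unlift_none/= ?mulr1//.
by rewrite mulr0 add0r.
Qed.

Lemma row_cons_lineS n (h t : R) (x : 'rV[R]_n) j :
  h *: 'e_(lift ord0 j) + row_cons (t, x) = row_cons (t, h *: 'e_j + x).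
Proof.
apply/rowP => i; rewrite !mxE eqxx/=.
case: (unliftP ord0 i) => [k ->|->]; rewrite ?liftK ?unlift_none/= ?mxE ?eqxx//=.
by rewrite mulr0 add0r.
Qed.

Lemma row_cons_continuous n (x : 'rV[R]_n) : continuous (fun t : R => row_cons (t, x)).
Proof.
move=> t; apply/cvgrPdist_le => e e0; near=> s.
rewrite [leLHS]mx_normrE; apply: bigmax_le; first exact: ltW.
move=> [i j] _ /=; rewrite ord1 !mxE.
case: (unlift _ _) => [k|] /=; first by rewrite subrr normr0 ltW.
by near: s; apply: (@cvgr_dist_le _ _ _ (nbhs t) _ id t).
Unshelve. all: by end_near. Qed.

Lemma row_cons_continuous2 n (t : R) : continuous (fun x : 'rV[R]_n => row_cons (t, x)).
Proof.
move=> x; apply/(@cvgrPdist_le _ _ _ (nbhs x)) => e e0; near=> y.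
have : `|x - y| <= e by near: y; exact: cvgr_dist_le.
rewrite [X in X <= _ -> _]mx_normrE => H.
rewrite [leLHS]mx_normrE; apply: bigmax_le; first exact: ltW.
move=> [i j] _ /=; rewrite ord1 !mxE.
case: (unlift _ _) => [k|] /=; last by rewrite subrr normr0 ltW.
apply: le_trans H; apply: le_trans (le_bigmax _ _ (ord0, k)).
by rewrite !mxE.
Unshelve. all: by end_near. Qed.

(** Induction on the dimension by Fubini. Either the differentiated coordinate is the first one, and
    the innermost integral vanishes by [integral_derive0], or it is a coordinate of the slice at a
    fixed first coordinate. *)
Lemma integral_partial0 n (i : 'I_n) (u : 'rV[R]_n -> R) (K : R) :
  (forall v, derivable u v 'e_i) -> continuous (partial i u) ->
  (forall (v : 'rV[R]_n) j, K < `|v 0 j| -> partial i u v = 0) ->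
  (forall (v : 'rV[R]_n) j, K < `|v 0 j| -> u v = 0) ->
  (\int[lebesgue_row R n]_w (partial i u w)%:E = 0)%E.
Proof.
elim: n i u => [[]//|n IH] i u du cu duK uK.
have iu := integrable_continuous cu duK.
case: (unliftP ord0 i) => [j ij|i0]; last first.
  rewrite integral_row21// integral0_eq// => x _.
  apply: (@integral_derive0 (fun t => u (row_cons (t, x))) _ K).
  - move=> t; rewrite i0.
    have E : (fun h : R => h^-1 *: (((fun s => u (row_cons (s, x))) \o shift t) (h *: 1) - u (row_cons (t, x))))
       = (fun h : R => h^-1 *: ((u \o shift (row_cons (t, x))) (h *: 'e_ord0) - u (row_cons (t, x)))).
      by apply/funext => h /=; rewrite row_cons_line0 [h *: 1]mulr1.
    split; last by rewrite /derive E.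
    by rewrite /derivable E -i0; exact: du.
  - by move=> t; apply: continuous_comp; [exact: row_cons_continuous|exact: cu].
  - by move=> t Kt; rewrite (uK _ ord0)// row_cons0.
rewrite integral_row// integral0_eq// => t _.
have E x : (fun h : R => h^-1 *: (((fun y => u (row_cons (t, y))) \o shift x) (h *: 'e_j) - u (row_cons (t, x))))
       = (fun h : R => h^-1 *: ((u \o shift (row_cons (t, x))) (h *: 'e_i) - u (row_cons (t, x)))).
  by apply/funext => h /=; rewrite ij row_cons_lineS.
have pE x : partial i u (row_cons (t, x)) = partial j (fun y => u (row_cons (t, y))) x.
  by rewrite /partial /derive E.
under eq_integral do rewrite pE.
apply: IH.
- by move=> x; rewrite /derivable E; exact: du.
- have -> : partial j (fun y => u (row_cons (t, y))) = (fun x => partial i u (row_cons (t, x))).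
    by apply/funext => x; rewrite pE.
  by move=> x; apply: continuous_comp; [exact: row_cons_continuous2|exact: cu].
- by move=> x k Kx; rewrite -pE (duK _ (lift ord0 k))// row_consS.
- by move=> x k Kx; rewrite (uK _ (lift ord0 k))// row_consS.
Qed.

Lemma loc_integrable_test_fun n (phi : 'rV[R]_n -> R) : test_function phi -> loc_integrable phi.
Proof.
move=> tphi; split; first exact: measurable_test.
move=> K; apply: integrableS (integrable_test tphi) => //; exact: measurable_cube.
Qed.

Lemma test_mul_partial n (i : 'I_n) (phi psi : 'rV[R]_n -> R) :
  test_function phi -> test_function psi ->
  \int[lebesgue_row R n]_w (phi w * partial i psi w) =
   - \int[lebesgue_row R n]_w (partial i phi w * psi w).
Proof.
move=> tphi tpsi.
have i1 := loc_integrable_test (loc_integrable_test_fun tphi) (test_partial i tpsi).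
have i2 := loc_integrable_test (loc_integrable_test_fun (test_partial i tphi)) tpsi.
have dE v : partial i (fun w => phi w * psi w) v = phi v * partial i psi v + partial i phi v * psi v.
  rewrite partialM; [|exact: test_diff|exact: test_diff].
  by congr (_ + _); exact: mulrC.
have [_ [K [_ _ phiK]]] := test_bounded tphi.
have [_ [K' [_ _ phiK']]] := test_bounded (test_partial i tphi).
have vanish L (v : 'rV[R]_n) j : Num.max K K' < `|v 0 j| -> L <= Num.max K K' -> ~ cube n L v.
  move=> Kv LK /(_ j); rewrite /= in_itv/= -ler_norml leNgt => /negP; apply.
  exact: le_lt_trans Kv.
have phi0 (v : 'rV[R]_n) j : Num.max K K' < `|v 0 j| -> phi v = 0.
  move=> Kv; apply/eqP; apply: contrapT => /negP/phiK; apply: vanish Kv _.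
  by rewrite le_max lexx.
have dphi0 (v : 'rV[R]_n) j : Num.max K K' < `|v 0 j| -> partial i phi v = 0.
  move=> Kv; apply/eqP; apply: contrapT => /negP/phiK'; apply: vanish Kv _.
  by rewrite le_max lexx orbT.
have dEf : partial i (fun w => phi w * psi w) =
    (fun v => phi v * partial i psi v + partial i phi v * psi v) by apply/funext.
have H : (\int[lebesgue_row R n]_w (partial i (fun w => phi w * psi w) w)%:E = 0)%E.
  apply: (@integral_partial0 n i _ (Num.max K K')).
  - move=> v; apply/diff_derivable/differentiableM; exact: test_diff.
  - have c1 := test_continuous tphi; have c2 := test_continuous tpsi.
    have c3 := test_continuous (test_partial i tphi).
    have c4 := test_continuous (test_partial i tpsi).
    rewrite dEf => v; apply: (@continuousD _ _ _ (fun v => phi v * partial i psi v)).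
      exact: continuousM (c1 v) (c4 v).
    exact: continuousM (c3 v) (c2 v).
  - by move=> v j Kv; rewrite dE (phi0 _ _ Kv) (dphi0 _ _ Kv) !mul0r addr0.
  - by move=> v j Kv; rewrite (phi0 _ _ Kv) mul0r.
apply/eqP; rewrite -addr_eq0 -RintegralD//; apply/eqP.
rewrite /Rintegral -[RHS]/(fine 0%E) -H; congr fine; apply: eq_integral => v _.
by rewrite dE.
Qed.

End integration_by_parts.

(** * Fundamental lemma of the calculus of variations *)

Section weak_unique.
Context {R : realType} {n : nat}.
Local Notation rV := 'rV[R]_n.
Local Notation leb := (lebesgue_row R n).
Local Open Scope ereal_scope.

Definition hbox (a b : 'I_n -> R) : set rV := boxset (fun i => `]a i, b i]%classic).

Lemma measurable_hbox a b : measurable (hbox a b).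
Proof. exact: measurable_boxset. Qed.

Lemma hboxI a b a' b' : hbox a b `&` hbox a' b' =
  hbox (fun i => Num.max (a i) (a' i)) (fun i => Num.min (b i) (b' i)).
Proof.
apply/seteqP; split => [v [H H'] i|v H].
  have := H i; have := H' i; rewrite /= !in_itv/= gt_max le_min.
  by move=> /andP[-> ->] /andP[-> ->].
by split=> i; have := H i; rewrite /= !in_itv/= gt_max le_min =>
  /andP[/andP[? ?] /andP[? ?]]; apply/andP.
Qed.

Let hboxes : set (set rV) := [set A | exists a b, A = hbox a b].

(** A strip that constrains one coordinate is a countable union of boxes, and the strips generate
    the sigma-algebra. *)
Lemma hbox_generates : @measurable _ rV = <<s hboxes >>.
Proof.
apply/seteqP; split; last first.
  apply: smallest_sub; first exact: sigma_algebra_measurable.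
  by move=> _ [a [b ->]]; exact: measurable_hbox.
have mid : measurable_fun setT (fun v : g_sigma_algebraType hboxes => v : rV).
  apply: measurable_fun_coordP => i.
  apply: (@measurability _ _ _ _ _ _ (@ocitv R)) => //.
  move=> _ [_ [[a b] _ <-] <-]; rewrite setTI /=.
  rewrite (_ : _ @^-1` _ = \bigcup_k
     hbox (fun j => if j == i then a else (- k%:R)%R) (fun j => if j == i then b else k%:R%R)).
    apply: bigcupT_measurable => k; apply: sub_sigma_algebra.
    by exists (fun j => if j == i then a else (- k%:R)%R), (fun j => if j == i then b else k%:R%R).
  apply/seteqP; split => [v /= vi|v [k _ /(_ i)]]; last by rewrite /= eqxx.
  pose k := (Num.truncn (\sum_j `|v 0%R j|)).+1.
  exists k => // j /=; have [->//|ji] := eqVneq j i.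
  have vk : (`|v 0 j| < k%:R)%R.
    apply: le_lt_trans (truncnS_gt _).
    by rewrite (bigD1 j)//= lerDl; apply: sumr_ge0.
  move: vk; rewrite ltr_norml in_itv/= => /andP[-> /ltW ->].
  by [].
by move=> A mA; have := mid measurableT A mA; rewrite setTI.
Qed.

(** For each t the sequence is eventually constant, at t = a and t = b as well, because both ramps
    lie to the right of their base point. *)
Lemma cutoff_cvg (a b t : R) : (a <= b)%R ->
  cutoff a b k.+1%:R^-1 t @[k --> \oo] --> (\1_(`]a, b]%classic) t : R).
Proof.
move=> ab; apply: cvg_near_cst; rewrite indicE mem_setE in_itv/=.
have [ta|at_] := leP t a => /=.
  by near=> k; rewrite cutoff_lt// invr_gt0.
have [tb|bt] := leP t b => /=.
  have t0 : (0 < t - a)%R by rewrite subr_gt0.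
  near=> k; rewrite /cutoff step_ge1 ?step_le0 ?subr0//.
    by rewrite pmulr_lle0 ?invr_gt0 ?subr_le0.
  rewrite invrK -ler_pdivrMr ?ltr0n// mul1r; apply: ltW.
  by near: k; exact: near_infty_natSinv_lt (PosNum t0).
have t0 : (0 < t - b)%R by rewrite subr_gt0.
near=> k; rewrite cutoff_gt// ?invr_gt0// -lerBrDl; apply: ltW.
by near: k; exact: near_infty_natSinv_lt (PosNum t0).
Unshelve. all: by end_near. Qed.

Lemma cvg_prodr (I : Type) (s : seq I) (F : I -> nat -> R) (L : I -> R) :
  (forall i, F i k @[k --> \oo] --> L i) ->
  (\prod_(i <- s) F i k)%R @[k --> \oo] --> (\prod_(i <- s) L i)%R.
Proof.
move=> FL; elim: s => [|i s IH].
  by under eq_fun do rewrite big_nil; rewrite big_nil; exact: cvg_cst.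
by under eq_fun do rewrite big_cons; rewrite big_cons; exact: cvgM.
Qed.

Lemma prod_indic_hbox a b (v : rV) :
  (\prod_i (\1_(`]a i, b i]%classic) (v 0%R i) : R))%R = \1_(hbox a b) v.
Proof.
rewrite [RHS]indicE; case: (boolP (v \in _)) => [/set_mem vb|/negP nv].
  by rewrite big1// => i _; rewrite indicE mem_set//; exact: vb.
have [i ni] : exists i, ~ `]a i, b i]%classic (v 0%R i).
  by apply/existsNP => H; apply: nv; rewrite inE.
by rewrite (bigD1 i)//= indicE memNset// mul0r.
Qed.

Lemma hbox_sub_cube a b : exists K, hbox a b `<=` cube n K.
Proof.
exists (\sum_i (`|a i| + `|b i|))%R => v vab i; rewrite /= in_itv/= -ler_norml.
have : (`|a i| + `|b i| <= \sum_i (`|a i| + `|b i|))%R.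
  by rewrite [leRHS](bigD1 i)//= lerDl; apply: sumr_ge0 => j _; rewrite addr_ge0.
apply: le_trans; have := vab i; rewrite /= in_itv/= => /andP[av vb].
have := ler_norm (b i); have := ler_norm (- a i); rewrite normrN.
have := normr_ge0 (a i); have := normr_ge0 (b i).
by rewrite ler_norml; lra.
Qed.

Variable G : rV -> R.
Hypothesis iG : loc_integrable G.
Hypothesis G0 : forall phi, test_function phi -> (\int[leb]_v (G v * phi v) = 0)%R.

Lemma weak0_hbox a b : (forall i, a i <= b i)%R -> \int[leb]_(v in hbox a b) (G v)%:E = 0.
Proof.
move=> ab; pose f k v := (G v * box_cutoff a b k.+1%:R^-1 v)%:E.
have tb k : test_function (@box_cutoff R n a b k.+1%:R^-1).
  by apply: test_box_cutoff => //; rewrite invr_gt0.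
have [mG _] := iG.
(* The ramps have length at most 1, so enlarging the upper corner by 1 gives one cube that contains
   the supports of all the cutoffs and serves for domination. *)
have [K HK] := hbox_sub_cube (fun i => a i) (fun i => b i + 1)%R.
have cub k v : box_cutoff a b k.+1%:R^-1 v != 0%R -> cube n K v.
  move=> bv; apply: HK => i; rewrite /= in_itv/=.
  have e0 : (0 < k.+1%:R^-1 :> R)%R by rewrite invr_gt0.
  have c0 : cutoff (a i) (b i) k.+1%:R^-1 (v 0%R i) != 0%R.
    by move: bv; rewrite /box_cutoff (bigD1 i)//= mulf_eq0 negb_or => /andP[].
  apply/andP; split.
    by rewrite ltNge; apply/negP => H; move/eqP: c0; apply; exact: cutoff_lt.
  rewrite leNgt; apply/negP => H; move/eqP: c0; apply; apply: cutoff_gt => //.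
  by apply: le_trans (ltW H); rewrite lerD2l invf_le1 ?ler1n ?ltr0n.
have : \int[leb]_v f k v @[k --> \oo] --> \int[leb]_v (G v * \1_(hbox a b) v)%:E.
  have [] := @dominated_convergence _ _ _ leb setT measurableT f
    (fun v => (G v * \1_(hbox a b) v)%:E) (fun v => (`|G v| * \1_(cube n K) v)%:E).
  - by move=> k; apply/measurable_EFinP/measurable_funM => //; exact: measurable_test.
  - by apply/measurable_EFinP/measurable_funM => //; apply: measurable_indic; exact: measurable_hbox.
  - apply: aeW => v _; apply/cvg_EFin; first by near=> k.
    apply: cvgM; first exact: cvg_cst.
    rewrite -prod_indic_hbox; apply: cvg_prodr => i; exact: cutoff_cvg.
  - have := integrable_norm (iG.2 K).
    move=> /(iffLR (integrable_mkcond _ (measurable_cube K))).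
    apply: eq_integrable => // v _; rewrite patchE indicE.
    by case: ifPn => _; rewrite ?mulr1 ?mulr0.
  - apply: aeW => v k _; rewrite lee_fin normrM ler_wpM2l//.
    rewrite indicE; case: (boolP (v \in _)) => [_|/negP nv].
      rewrite ger0_norm; last by apply: prodr_ge0 => i _; rewrite cutoff_ge0// invr_gt0.
      by apply: prodr_ile1 => i _; rewrite cutoff_ge0 ?cutoff_le1// invr_gt0.
    rewrite (_ : box_cutoff _ _ _ _ = 0%R) ?normr0//.
    by apply/eqP; apply: contrapT => /negP/cub vK; apply: nv; rewrite inE.
  - by [].
have -> : (fun k => \int[leb]_v f k v) = cst 0.
  apply/funext => k; have := G0 (tb k); rewrite /Rintegral => H.
  by rewrite -[LHS]fineK ?H//; apply: integrable_fin_num => //; exact: loc_integrable_test.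
move=> H; have {H} : \int[leb]_v (G v * \1_(hbox a b) v)%:E = 0.
  by rewrite -(cvg_lim (@ereal_hausdorff R) H); apply: lim_cst; exact: ereal_hausdorff.
move=> H; rewrite integral_mkcond -[RHS]H; apply: eq_integral => v _.
by rewrite patchE indicE; case: ifPn => _; rewrite ?mulr1 ?mulr0.
Unshelve. all: by end_near. Qed.

Lemma weak0_hboxT a b : \int[leb]_(v in hbox a b) (G v)%:E = 0.
Proof.
have [ab|/existsNP[i /negP]] := pselect (forall i, a i <= b i)%R; first exact: weak0_hbox.
rewrite -ltNge => bai; rewrite (_ : hbox a b = set0) ?integral_set0//.
apply/seteqP; split => // v /(_ i); rewrite /= in_itv/= => /andP[av vb].
by have := lt_le_trans av vb; rewrite ltNge ltW.
Qed.

(** The integral of [G] vanishes over all half-open boxes, which form a pi-system. Inside a bounded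
    box, where [G] is integrable, Dynkin's theorem extends this to all measurable sets; bounded
    boxes exhaust the space. *)
Lemma weak0_ae : {ae leb, forall v, G v = 0%R}.
Proof.
have [mG lG] := iG.
suff H (k : nat) : {ae leb, forall v, hbox (fun=> - k%:R)%R (fun=> k%:R)%R v -> G v = 0%R}.
  have := ae_foralln H; apply: filterS => v Hv.
  apply: (Hv (Num.truncn (\sum_j `|v 0%R j|)).+1) => j /=.
  have vk : (`|v 0%R j| < (Num.truncn (\sum_j `|v 0%R j|)).+1%:R)%R.
    apply: le_lt_trans (truncnS_gt _).
    by rewrite [leRHS](bigD1 j)//= lerDl; apply: sumr_ge0.
  by move: vk; rewrite ltr_norml in_itv/= => /andP[-> /ltW ->].
set B := hbox _ _; have mB : measurable B by exact: measurable_hbox.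
have iB : leb.-integrable B (EFin \o G).
  have [K BK] := hbox_sub_cube (fun=> - k%:R)%R (fun=> k%:R)%R.
  exact: integrableS (measurable_cube K) mB BK (lG K).
have iBA A : measurable A -> leb.-integrable (A `&` B) (EFin \o G).
  by move=> mA; apply: integrableS iB => //; exact: measurableI.
have key : forall A, <<s hboxes >> A -> \int[leb]_(v in A `&` B) (G v)%:E = 0.
  apply: (dynkin_induction (T := rV) (G := hboxes)).
  - exact: hbox_generates.
  - by move=> _ _ [a [b ->]] [a' [b' ->]]; rewrite hboxI; eexists; eexists.
  - by rewrite setTI; exact: weak0_hboxT.
  - by move=> _ [a [b ->]]; rewrite hboxI; exact: weak0_hboxT.
  - move=> S mS S0.
    have := @integral_setU _ _ _ leb (S `&` B) (~` S `&` B) (EFin \o G).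
    rewrite -setIUl setUv setTI /=; rewrite /B weak0_hboxT -/B S0 add0e => <-//.
    + exact: measurableI.
    + by apply: measurableI => //; exact: measurableC.
    + exact: (measurable_int leb iB).
    + by apply/disj_setPS => v [[? _] []].
  - move=> F mF tF F0; rewrite setI_bigcupl integral_bigcup//.
    + by rewrite eseries0// => i _ _; exact: F0.
    + apply/trivIsetP => i j _ _ ij; rewrite setIACA setIid.
      by move/trivIsetP : tF => -> //; rewrite set0I.
    + by move=> i; exact: measurableI.
    + rewrite -setI_bigcupl; apply: iBA; exact: bigcup_measurable.
have := @integral_ae_eq _ _ _ leb B mB (cst 0) (EFin \o G) iB.
move=> /(_ (measurable_cst _)) H.
have {}H : ae_eq leb B (EFin \o G) (cst 0).
  apply: H => E EB mE; rewrite integral0.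
  by rewrite -(setIidl EB); apply: key; rewrite -hbox_generates.
by move: H; apply: filterS => v Hv /Hv [].
Qed.

End weak_unique.

(** * The Sobolev space *)

Section real_sobolev.
Context {R : realType} {n : nat}.
Local Notation rV := 'rV[R]_n.
Local Notation mu := (@hyp_measure R n).
Local Notation leb := (lebesgue_row R n).
Local Notation w := (@volume_density R n).
Implicit Types (g h : rV -> R) (G H : 'I_n -> rV -> R) (phi : rV -> R).

Definition weakR g G : Prop := forall phi, test_function phi -> forall i,
  \int[leb]_v (g v * partial i phi v) = - \int[leb]_v (G i v * phi v).

Definition sq_integrable g : Prop :=
  measurable_fun setT g /\ (\int[mu]_v (g v ^+ 2)%:E < +oo)%E.

Definition gip_integrable G : Prop := (forall i, measurable_fun setT (G i)) /\
  (\int[mu]_v (gip v (G ^~ v) (G ^~ v))%:E < +oo)%E.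

Definition sobolevR g G : Prop := [/\ sq_integrable g, gip_integrable G & weakR g G].

Lemma sq_integrableP g : sq_integrable g <->
  measurable_fun setT g /\ mu.-integrable setT (fun v => (g v ^+ 2)%:E).
Proof.
split=> -[mg ig]; split=> //.
  apply/integrableP; split; first by apply/measurable_EFinP; exact: measurable_funX.
  by under eq_integral do rewrite gee0_abs ?lee_fin ?sqr_ge0//.
move/integrableP : ig => [_].
by under eq_integral do rewrite gee0_abs ?lee_fin ?sqr_ge0//.
Qed.

Lemma measurable_gip G H : (forall i, measurable_fun setT (G i)) ->
  (forall i, measurable_fun setT (H i)) ->
  measurable_fun setT (fun v => gip v (G ^~ v) (H ^~ v)).
Proof.
move=> mG mH; apply: measurable_funD.
  by apply: measurable_sum => i; exact: measurable_funM.
apply: measurable_funM; apply: measurable_sum => i; apply: measurable_funM => //;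
  exact: measurable_coord.
Qed.

Lemma gip_integrableP G : gip_integrable G <-> (forall i, measurable_fun setT (G i)) /\
  mu.-integrable setT (fun v => (gip v (G ^~ v) (G ^~ v))%:E).
Proof.
split=> -[mG iG]; split=> //.
  apply/integrableP; split; first by apply/measurable_EFinP; exact: measurable_gip.
  by under eq_integral do rewrite gee0_abs ?lee_fin ?gip_ge0//.
move/integrableP : iG => [_].
by under eq_integral do rewrite gee0_abs ?lee_fin ?gip_ge0//.
Qed.

(** Expansion of the squared lengths of a + b and a - b, both nonnegative. *)
Lemma gip_bound (v : rV) (a b : 'I_n -> R) : `|gip v a b| <= gip v a a + gip v b b.
Proof.
have h1 := gip_ge0 v (fun i => a i + b i).
have h2 := gip_ge0 v (fun i => a i + (-1) * b i).
move: h1 h2; rewrite !(gipDl, gipDr, gipZl, gipZr) (gipC v b a) => h1 h2.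
have ha := gip_ge0 v a; have hb := gip_ge0 v b.
by rewrite ler_norml; lra.
Qed.

Lemma integrable_gip G H : gip_integrable G -> gip_integrable H ->
  mu.-integrable setT (fun v => (gip v (G ^~ v) (H ^~ v))%:E).
Proof.
move=> /gip_integrableP[mG iG] /gip_integrableP[mH iH].
apply: le_integrable (integrableD measurableT iG iH) => //.
  by apply/measurable_EFinP; exact: measurable_gip.
move=> v _ /=; rewrite lee_fin (le_trans (gip_bound _ _ _))// ger0_norm//.
by rewrite addr_ge0 ?gip_ge0.
Qed.

Lemma integrable_mul g h : sq_integrable g -> sq_integrable h ->
  mu.-integrable setT (fun v => (g v * h v)%:E).
Proof.
move=> /sq_integrableP[mg ig] /sq_integrableP[mh ih].
apply: le_integrable (integrableD measurableT ig ih) => //.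
  by apply/measurable_EFinP; exact: measurable_funM.
move=> v _ /=; rewrite lee_fin [leRHS]ger0_norm ?addr_ge0 ?sqr_ge0//.
have := sqr_ge0 (g v + h v); have := sqr_ge0 (g v - h v).
have := sqr_ge0 (g v); have := sqr_ge0 (h v).
by rewrite sqrrB sqrrD ler_norml; lra.
Qed.

Lemma sq_integrable_lin g h (t : R) : sq_integrable g -> sq_integrable h ->
  sq_integrable (fun v => g v + t * h v).
Proof.
move=> sg sh; have igh := integrable_mul sg sh.
move: sg sh => /sq_integrableP[mg ig] /sq_integrableP[mh ih].
apply/sq_integrableP; split.
  by apply: measurable_funD => //; exact: measurable_funM.
rewrite (_ : (fun v => _) = (fun v => (g v ^+ 2)%:E +
    ((2 * t)%:E * (g v * h v)%:E + (t ^+ 2)%:E * (h v ^+ 2)%:E))%E).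
  apply: integrableD => //; apply: integrableD => //; exact: integrableZl.
by apply/funext => v; rewrite -!EFinM -!EFinD; congr EFin; ring.
Qed.

Lemma gip_integrable_lin G H (t : R) : gip_integrable G -> gip_integrable H ->
  gip_integrable (fun i v => G i v + t * H i v).
Proof.
move=> sG sH; have iGH := integrable_gip sG sH.
move: sG sH => /gip_integrableP[mG iG] /gip_integrableP[mH iH].
apply/gip_integrableP; split.
  by move=> i; apply: measurable_funD => //; exact: measurable_funM.
rewrite (_ : (fun v => _) = (fun v => (gip v (G ^~ v) (G ^~ v))%:E +
    ((2 * t)%:E * (gip v (G ^~ v) (H ^~ v))%:E + (t ^+ 2)%:E * (gip v (H ^~ v) (H ^~ v))%:E))%E).
  apply: integrableD => //; apply: integrableD => //; exact: integrableZl.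
apply/funext => v; rewrite -!EFinM -!EFinD; congr EFin.
rewrite !(gipDl, gipDr, gipZl, gipZr) (gipC v (H ^~ v) (G ^~ v)); ring.
Qed.

Lemma height_cube K (v : rV) : cube n K v -> height v <= Num.sqrt (1 + n%:R * K ^+ 2).
Proof.
move=> vK; rewrite heightE ler_sqrt; last by rewrite addr_ge0// mulr_ge0// sqr_ge0.
rewrite lerD2l /nsq; apply: (@le_trans _ _ (\sum_(i < n) K ^+ 2)).
  apply: ler_sum => i _; rewrite -(real_normK (num_real (v 0 i))).
  have := vK i; rewrite /= in_itv/= -ler_norml => vi.
  have K0 : 0 <= K by rewrite (le_trans _ vi).
  by rewrite lerXn2r ?nnegrE ?normr_ge0.
by rewrite sumr_const card_ord mulr_natl.
Qed.

(** On a cube the density is bounded below, by 1/[h0], and |g| <= 1 + g^2. Local integrability for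
    Lebesgue measure is what the uniqueness of weak derivatives requires. *)
Lemma sq_integrable_loc g : sq_integrable g -> loc_integrable g.
Proof.
move=> /sq_integrableP[mg ig]; split=> // K.
have := ig => /(iffLR (integrable_hyp (measurable_funX 2 mg))) igw.
pose h0 := Num.sqrt (1 + n%:R * K ^+ 2) : R.
have i1 : leb.-integrable (cube n K) (fun v => (1%:E + h0%:E * (g v ^+ 2 * w v)%:E)%E).
  have mK := @measurable_cube R n K.
  apply: integrableD => //; first exact: (loc_integrable_cst 1).2.
  by apply: integrableZl => //; exact: integrableS igw.
apply: le_integrable i1 => //; first exact: measurable_cube.
  by apply/measurable_EFinP; exact: measurable_funTS.
move=> v vK; rewrite /= lee_fin.
have hw : 1 <= h0 * w v.
  by rewrite volume_densityE ler_pdivlMr ?height_gt0// mul1r height_cube.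
have g2 : g v ^+ 2 <= h0 * (g v ^+ 2 * w v).
  by rewrite mulrCA ler_peMr// sqr_ge0.
have g0 := sqr_ge0 (g v).
rewrite [leRHS]ger0_norm; last by rewrite addr_ge0// (le_trans g0).
apply: le_trans (lerD (lexx _) g2).
have := sqr_ge0 (`|g v| - 1); rewrite sqrrB real_normK ?num_real//.
have := normr_ge0 (g v); lra.
Qed.

(** The inverse metric dominates the Euclidean form. *)
Lemma gip_component G i : gip_integrable G -> sq_integrable (G i).
Proof.
move=> [mG iG]; split=> //; apply: le_lt_trans iG.
apply: ge0_le_integral => //.
- by move=> v _; rewrite lee_fin sqr_ge0.
- by apply/measurable_EFinP; exact: measurable_funX.
- by apply/measurable_EFinP; exact: measurable_gip.
- move=> v _; rewrite lee_fin /gip (bigD1 i)//= -expr2 -addrA lerDl.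
  by rewrite addr_ge0// -?expr2 ?sqr_ge0// sumr_ge0// => j _; rewrite -expr2 sqr_ge0.
Qed.

Lemma sobolevR_loc g G i : sobolevR g G -> loc_integrable g /\ loc_integrable (G i).
Proof.
by move=> [sg sG _]; split; apply: sq_integrable_loc => //; exact: gip_component.
Qed.

Lemma sobolevR_lin g h G H (t : R) : sobolevR g G -> sobolevR h H ->
  sobolevR (fun v => g v + t * h v) (fun i v => G i v + t * H i v).
Proof.
move=> sgG shH; have [sg sG wG] := sgG; have [sh sH wH] := shH.
split; [exact: sq_integrable_lin|exact: gip_integrable_lin|].
move=> phi tphi i.
have [lg lG] := sobolevR_loc i sgG; have [lh lH] := sobolevR_loc i shH.
have tp := test_partial i tphi.
have E (a b c : rV -> R) : loc_integrable a -> loc_integrable b -> test_function c ->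
    \int[leb]_v ((a v + t * b v) * c v) = \int[leb]_v (a v * c v) + t * \int[leb]_v (b v * c v).
  move=> la lb tc; rewrite -RintegralZl//; last exact: loc_integrable_test.
  rewrite -RintegralD//; last 2 first.
  - exact: loc_integrable_test.
  - have := integrableZl measurableT t (loc_integrable_test lb tc).
    by apply: eq_integrable => // v _; rewrite -EFinM.
  by apply: eq_Rintegral => v _; rewrite mulrDl mulrA.
by rewrite !E// wG// wH// mulrN -opprD.
Qed.

Lemma sobolevR_unique g G H : sobolevR g G -> sobolevR g H ->
  {ae mu, forall v, forall i, G i v = H i v}.
Proof.
move=> sG sH; apply/ae_hypP; apply: filter_forall => i.
have [_ lG] := sobolevR_loc i sG; have [_ lH] := sobolevR_loc i sH.
have [_ _ wG] := sG; have [_ _ wH] := sH.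
have lGH : loc_integrable (fun v => G i v - H i v).
  split; first by apply: measurable_funB; [exact: lG.1|exact: lH.1].
  move=> K; have := integrableB (measurable_cube K) (lG.2 K) (lH.2 K).
  by apply: eq_integrable => //; exact: measurable_cube.
have := @weak0_ae R n _ lGH; set P := (X in (X -> _) -> _).
suff p : P by move=> /(_ p); apply: filterS => v /subr0_eq.
move=> phi tphi.
have i1 := loc_integrable_test lG tphi; have i2 := loc_integrable_test lH tphi.
have := RintegralB measurableT i1 i2.
under eq_Rintegral do rewrite -mulrBl.
by move=> ->; rewrite -[X in X - _]opprK -wG// -[X in _ - X]opprK -wH// subrr.
Qed.

Lemma sq_integrable_test phi : test_function phi -> sq_integrable phi.
Proof.
move=> tphi; apply/sq_integrableP; split; first exact: measurable_test.
have mp := measurable_test tphi.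
apply/(integrable_hyp (measurable_funX 2 mp)).
have := loc_integrable_test (loc_integrable_test_fun tphi) tphi.
move=> /le_integrable; apply => //.
  apply/measurable_EFinP; apply: measurable_funM; first exact: measurable_funX.
  exact: measurable_volume_density.
move=> v _; rewrite /= lee_fin expr2 normrM ler_piMr//.
by rewrite ger0_norm ?volume_density_le1// ltW// volume_density_gt0.
Qed.

Lemma gip_integrable_test phi : test_function phi ->
  gip_integrable (fun i => partial i phi).
Proof.
move=> tphi; have mG i := measurable_test (test_partial i tphi).
have cG i := test_continuous (test_partial i tphi).
apply/gip_integrableP; split => //.
have mg := measurable_gip mG mG.
apply/(integrable_hyp mg).
have ig : leb.-integrable setT (EFin \o (fun v => gip v (fun i => partial i phi v) (fun i => partial i phi v))).
  have cs (F : 'I_n -> rV -> R) : (forall i, continuous (F i)) -> continuous (fun v => \sum_i F i v).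
    move=> cF; elim: (index_enum _) => [|i s IH].
      rewrite (_ : (fun v : rV => _) = cst 0); first exact: cst_continuous.
      by apply/funext => v; rewrite big_nil.
    under eq_fun do rewrite big_cons.
    by move=> v; exact: continuousD (cF i v) (IH v).
  have [K HK] : exists K, forall i v, partial i phi v != 0 -> cube n K v.
    have H i : exists K : R, forall v, partial i phi v != 0 -> cube n K v.
      by have [_ [K [_ _]]] := test_bounded (test_partial i tphi); exists K.
    have [K HK] := choice H; exists (\sum_i `|K i|) => i v pv j.
    have := HK i v pv j; rewrite /= !in_itv/= -!ler_norml => /le_trans; apply.
    rewrite (bigD1 i)//=; apply: le_trans (ler_norm _) _; rewrite lerDl.
    exact: sumr_ge0.
  apply: (@integrable_continuous _ _ _ K).
    have c1 : continuous (fun v : rV => \sum_i partial i phi v * partial i phi v).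
      by apply: cs => i x; exact: continuousM (cG i x) (cG i x).
    have c2 : continuous (fun v : rV => \sum_i v 0 i * partial i phi v).
      apply: cs => i x; apply: (@continuousM _ _ (fun v : rV => v 0 i)).
        exact/differentiable_continuous/differentiable_coord.
      exact: cG.
    by move=> v; exact: (continuousD (c1 v) (continuousM (c2 v) (c2 v))).
  move=> v j Kv; have p0 i : partial i phi v = 0.
    apply/eqP; apply: contrapT => /negP/HK/(_ j); rewrite /= in_itv/= -ler_norml.
    by rewrite leNgt Kv.
  by rewrite /gip !big1 ?mul0r ?addr0// => i _; rewrite p0 ?mulr0.
apply: le_integrable ig => //.
  apply/measurable_EFinP; apply: measurable_funM => //.
  exact: measurable_volume_density.
move=> v _; rewrite /= lee_fin normrM ler_piMr//.
by rewrite ger0_norm ?volume_density_le1// ltW// volume_density_gt0.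
Qed.

Lemma sobolevR_test phi : test_function phi -> sobolevR phi (fun i => partial i phi).
Proof.
move=> tphi; split; [exact: sq_integrable_test|exact: gip_integrable_test|].
by move=> psi tpsi i; exact: test_mul_partial.
Qed.

Lemma sobolevR0 : sobolevR (fun=> 0) (fun _ _ => 0).
Proof.
split.
- split=> //; under eq_integral do rewrite expr0n/=.
  by rewrite integral0 ltry.
- split=> //; rewrite integral0_eq ?ltry// => v _.
  rewrite /gip big1 ?add0r; last by move=> i _; rewrite mulr0.
  by rewrite big1 ?mul0r// => i _; rewrite mulr0.
- move=> phi tphi i; under eq_Rintegral do rewrite mul0r.
  under [in RHS]eq_Rintegral do rewrite mul0r.
  by rewrite /Rintegral integral0/= oppr0.
Qed.

Lemma Rintegral_sq_lin g h (t : R) : sq_integrable g -> sq_integrable h ->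
  \int[mu]_v ((g v + t * h v) ^+ 2) =
  \int[mu]_v (g v ^+ 2) + 2 * t * \int[mu]_v (g v * h v) + t ^+ 2 * \int[mu]_v (h v ^+ 2).
Proof.
move=> sg sh; have igh := integrable_mul sg sh.
move: sg sh => /sq_integrableP[mg ig] /sq_integrableP[mh ih].
rewrite -!RintegralZl// -!RintegralD//.
- by apply: eq_Rintegral => v _; ring.
- have := integrableD measurableT ig (integrableZl measurableT (2 * t) igh).
  by apply: eq_integrable.
- exact: (integrableZl measurableT (t ^+ 2) ih).
- exact: (integrableZl measurableT (2 * t) igh).
Qed.

Lemma Rintegral_gip_lin G H (t : R) : gip_integrable G -> gip_integrable H ->
  \int[mu]_v gip v (fun i => G i v + t * H i v) (fun i => G i v + t * H i v) =
  \int[mu]_v gip v (G ^~ v) (G ^~ v) + 2 * t * \int[mu]_v gip v (G ^~ v) (H ^~ v) +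
  t ^+ 2 * \int[mu]_v gip v (H ^~ v) (H ^~ v).
Proof.
move=> sG sH; have iGH := integrable_gip sG sH.
move: sG sH => /gip_integrableP[mG iG] /gip_integrableP[mH iH].
rewrite -!RintegralZl// -!RintegralD//.
- apply: eq_Rintegral => v _.
  by rewrite !(gipDl, gipDr, gipZl, gipZr) (gipC v (H ^~ v) (G ^~ v)); ring.
- have := integrableD measurableT iG (integrableZl measurableT (2 * t) iGH).
  by apply: eq_integrable.
- exact: (integrableZl measurableT (t ^+ 2) iH).
- exact: (integrableZl measurableT (2 * t) iGH).
Qed.

End real_sobolev.

(** * Complex Sobolev functions through their real and imaginary parts *)

Section complex_sobolev.
Context {R : realType} {n : nat}.
Local Notation rV := 'rV[R]_n.
Local Notation C := R[i].
Local Notation mu := (@hyp_measure R n).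
Local Notation leb := (lebesgue_row R n).
Implicit Types (f g : rV -> C) (G H : 'I_n -> rV -> C) (phi : rV -> R).

Definition re f : rV -> R := fun v => complex.Re (f v).
Definition im f : rV -> R := fun v => complex.Im (f v).

Lemma Re_mul_real (z : C) (x : R) : complex.Re (z * x%:C) = complex.Re z * x.
Proof. by rewrite Re_mul/= mulr0 subr0. Qed.

Lemma Im_mul_real (z : C) (x : R) : complex.Im (z * x%:C) = complex.Im z * x.
Proof. by rewrite Im_mul/= mulr0 add0r. Qed.

Lemma cintegral_real (m : {measure set rV -> \bar R}) f phi :
  cintegral m (fun v => f v * (phi v)%:C) =
  (\int[m]_v (re f v * phi v)) +i* (\int[m]_v (im f v * phi v)).
Proof.
rewrite /cintegral; congr (_ +i* _); apply: eq_Rintegral => v _.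
  exact: Re_mul_real.
exact: Im_mul_real.
Qed.

Let sum_lty (a b : rV -> R) : measurable_fun setT a -> measurable_fun setT b ->
  (forall v, 0 <= a v) -> (forall v, 0 <= b v) ->
  (\int[mu]_v (a v + b v)%:E < +oo)%E <->
  (\int[mu]_v (a v)%:E < +oo)%E /\ (\int[mu]_v (b v)%:E < +oo)%E.
Proof.
move=> ma mb a0 b0; under eq_integral do rewrite EFinD.
rewrite ge0_integralD//; [|by move=> v _; rewrite lee_fin|exact/measurable_EFinP|by move=> v _; rewrite lee_fin|exact/measurable_EFinP].
have Ia : (0 <= \int[mu]_v (a v)%:E)%E by apply: integral_ge0 => v _; rewrite lee_fin.
have Ib : (0 <= \int[mu]_v (b v)%:E)%E by apply: integral_ge0 => v _; rewrite lee_fin.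
split=> [ab|[? ?]]; last exact: lte_add_pinfty.
by split; apply: le_lt_trans ab; [exact: leeDl|exact: leeDr].
Qed.

(** The modulus, the Hermitian energy and the weak derivative (whose test functions are real) all
    decouple, so complex statements reduce to pairs of real ones. *)
Lemma sobolev_differentialP f G : sobolev_differential f G <->
  sobolevR (re f) (fun i => re (G i)) /\ sobolevR (im f) (fun i => im (G i)).
Proof.
have E1 : cmeasurable f -> (\int[mu]_v (cabs (f v) ^+ 2)%:E < +oo)%E <->
   (\int[mu]_v (re f v ^+ 2)%:E < +oo)%E /\ (\int[mu]_v (im f v ^+ 2)%:E < +oo)%E.
  move=> [mr mi]; under eq_integral do rewrite sqr_cabs.
  by apply: sum_lty => [||v|v]; try exact: measurable_funX; exact: sqr_ge0.
have E2 : (forall i, cmeasurable (G i)) ->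
   (\int[mu]_v (complex.Re (coinner v (G ^~ v) (G ^~ v)))%:E < +oo)%E <->
   (\int[mu]_v (gip v (fun i => re (G i) v) (fun i => re (G i) v))%:E < +oo)%E /\
   (\int[mu]_v (gip v (fun i => im (G i) v) (fun i => im (G i) v))%:E < +oo)%E.
  move=> mG; under eq_integral do rewrite Re_coinner_sq.
  by apply: sum_lty => [||v|v]; try (by apply: measurable_gip => i; case: (mG i)); exact: gip_ge0.
have E3 : weak_differential f G <-> weakR (re f) (fun i => re (G i)) /\ weakR (im f) (fun i => im (G i)).
  split=> [wd|[wr wi] phi tphi i].
    by split=> phi tphi i; have := wd phi tphi i; rewrite !cintegral_real => -[].
  by rewrite !cintegral_real wr// wi.
split.
  move=> [mf mG lf lG wf]; have [? ?] := (E1 mf).1 lf; have [? ?] := (E2 mG).1 lG.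
  have [? ?] := E3.1 wf; split; split=> //; split=> //; try (by case: mf);
   by move=> i; case: (mG i).
move=> [[[mr lr] [mGr lGr] wr] [[mi li] [mGi lGi] wi]].
split.
- by [].
- by move=> i; split; [exact: mGr|exact: mGi].
- by apply/(E1 (conj mr mi)).
- by apply/(E2 (fun i => conj (mGr i) (mGi i))).
- by apply/E3.
Qed.

Lemma differentialP f : sobolev f -> sobolev_differential f (differential f).
Proof. by move=> [G fG]; apply: xgetPex; exists G. Qed.

Lemma sobolev_parts f G : sobolev_differential f G ->
  sobolevR (re f) (fun i => re (differential f i)) /\
  sobolevR (im f) (fun i => im (differential f i)).
Proof. by move=> fG; apply/sobolev_differentialP/differentialP; exists G. Qed.

Lemma Rintegral_gip_ae (G G' H H' : 'I_n -> rV -> R) :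
  (forall i, measurable_fun setT (G i)) -> (forall i, measurable_fun setT (G' i)) ->
  (forall i, measurable_fun setT (H i)) -> (forall i, measurable_fun setT (H' i)) ->
  {ae mu, forall v, forall i, G i v = G' i v} ->
  {ae mu, forall v, forall i, H i v = H' i v} ->
  \int[mu]_v gip v (G ^~ v) (H ^~ v) = \int[mu]_v gip v (G' ^~ v) (H' ^~ v).
Proof.
move=> mG mG' mH mH' GG' HH'; congr fine; apply: ae_eq_integral => //.
- by apply/measurable_EFinP; exact: measurable_gip.
- by apply/measurable_EFinP; exact: measurable_gip.
near=> v => _; congr EFin.
have gg' : G ^~ v = G' ^~ v by apply/funext; near: v.
have hh' : H ^~ v = H' ^~ v by apply/funext; near: v.
by rewrite gg' hh'.
Unshelve. all: by end_near. Qed.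

(** [differential f] is only a chosen weak differential; almost-everywhere uniqueness allows any
    other one to compute the energy. *)
Lemma dirichletE f G : sobolev_differential f G ->
  dirichlet f = \int[mu]_v gip v (fun i => re (G i) v) (fun i => re (G i) v) +
                \int[mu]_v gip v (fun i => im (G i) v) (fun i => im (G i) v).
Proof.
move=> fG; have [sr si] := sobolev_parts fG.
have [sr' si'] := (sobolev_differentialP _ _).1 fG.
have ur := sobolevR_unique sr sr'; have ui := sobolevR_unique si si'.
have [_ gr _] := sr; have [_ gi _] := si; have [_ gr' _] := sr'; have [_ gi' _] := si'.
rewrite /dirichlet; under eq_Rintegral do rewrite Re_coinner_sq.
rewrite RintegralD//; last 2 first.
- exact: (integrable_gip gr gr).
- exact: (integrable_gip gi gi).
by congr (_ + _); apply: Rintegral_gip_ae => //; solve [exact: gr.1|exact: gr'.1|exact: gi.1|exact: gi'.1].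
Qed.

Lemma l2_norm_sqE f : sobolev f ->
  l2_norm_sq f = \int[mu]_v (re f v ^+ 2) + \int[mu]_v (im f v ^+ 2).
Proof.
move=> [G /sobolev_differentialP[[/sq_integrableP[_ sr] _ _] [/sq_integrableP[_ si] _ _]]].
rewrite /l2_norm_sq; under eq_Rintegral do rewrite sqr_cabs.
by rewrite RintegralD.
Qed.

Lemma l2_pairingE f phi : l2_pairing f phi =
  (\int[mu]_v (re f v * phi v)) +i* (\int[mu]_v (im f v * phi v)).
Proof. exact: cintegral_real. Qed.

Lemma dirichlet_pairingE f G phi : sobolev_differential f G -> test_function phi ->
  dirichlet_pairing f phi =
  (\int[mu]_v gip v (fun i => re (G i) v) (fun i => partial i phi v)) +i*
  (\int[mu]_v gip v (fun i => im (G i) v) (fun i => partial i phi v)).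
Proof.
move=> fG tphi; have [sr si] := sobolev_parts fG.
have [sr' si'] := (sobolev_differentialP _ _).1 fG.
have ur := sobolevR_unique sr sr'; have ui := sobolevR_unique si si'.
have [_ gr _] := sr; have [_ gi _] := si; have [_ gr' _] := sr'; have [_ gi' _] := si'.
have [mp _] := gip_integrable_test tphi.
rewrite /dirichlet_pairing /cintegral.
under eq_Rintegral do rewrite coinner_real /=.
under [in X in _ +i* X]eq_Rintegral do rewrite coinner_real /=.
have aeT : {ae mu, forall v, forall i, partial i phi v = partial i phi v} by apply: aeW.
by congr (_ +i* _); apply: Rintegral_gip_ae => //; solve [exact: gr.1|exact: gr'.1|exact: gi.1|exact: gi'.1].
Qed.

Lemma sobolev_differential_lin f g G H (t : R) : sobolev_differential f G -> sobolev_differential g H ->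
  sobolev_differential (fun v => f v + t%:C * g v) (fun i v => G i v + t%:C * H i v).
Proof.
move=> /sobolev_differentialP[fr fi] /sobolev_differentialP[gr gi].
have Er (a b : C) : complex.Re (a + t%:C * b) = complex.Re a + t * complex.Re b.
  by rewrite Re_add Re_mul/= mul0r subr0.
have Ei (a b : C) : complex.Im (a + t%:C * b) = complex.Im a + t * complex.Im b.
  by rewrite Im_add Im_mul/= mul0r addr0.
apply/sobolev_differentialP; split.
- have e1 : (fun v => re f v + t * re g v) = re (fun v => f v + t%:C * g v).
    by apply/funext => v; rewrite /re Er.
  have e2 : (fun i v => re (G i) v + t * re (H i) v) = (fun i => re (fun v => G i v + t%:C * H i v)).
    by apply/funext => i; apply/funext => v; rewrite /re Er.
  by have := sobolevR_lin t fr gr; rewrite e1 e2.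
- have e1 : (fun v => im f v + t * im g v) = im (fun v => f v + t%:C * g v).
    by apply/funext => v; rewrite /im Ei.
  have e2 : (fun i v => im (G i) v + t * im (H i) v) = (fun i => im (fun v => G i v + t%:C * H i v)).
    by apply/funext => i; apply/funext => v; rewrite /im Ei.
  by have := sobolevR_lin t fi gi; rewrite e1 e2.
Qed.

Lemma sobolev_differential_test phi : test_function phi ->
  sobolev_differential (fun v => (phi v)%:C) (fun i v => (partial i phi v)%:C).
Proof.
move=> tphi; apply/sobolev_differentialP; split; first exact: sobolevR_test.
exact: sobolevR0.
Qed.

End complex_sobolev.

(** * Measurability *)

Section measurability.
Context {R : realType} {d : measure_display} {T : measurableType d}.

Lemma measurable_invr : measurable_fun [set: R] (@GRing.inv R).
Proof.
rewrite (_ : [set: R] = [set 0] `|` ~` [set 0]); last by rewrite setUv.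
apply/measurable_funU => //; first by apply: measurableC.
split; first exact: measurable_fun_set1.
apply: open_continuous_measurable_fun; first exact: closed_openC.
by move=> x; rewrite inE/= => /eqP x0; exact: inv_continuous.
Qed.

Lemma measurable_inv_comp (f : T -> R) : measurable_fun setT f ->
  measurable_fun setT (fun x => (f x)^-1).
Proof. exact: (measurableT_comp measurable_invr). Qed.

Lemma measurable_powR_comp (f : T -> R) (r : R) : measurable_fun setT f ->
  measurable_fun setT (fun x => f x `^ r).
Proof. exact: (measurableT_comp (measurable_powR r)). Qed.

Lemma measurable_indic_comp d' (U : measurableType d') (A : set U) (f : T -> U) :
  measurable A -> measurable_fun setT f ->
  measurable_fun setT (fun x => \1_A (f x) : R).
Proof. by move=> mA; apply: measurableT_comp; exact: measurable_indic. Qed.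

Lemma measurable_cabs (f : T -> R[i]) :
  measurable_fun setT (fun x => complex.Re (f x)) ->
  measurable_fun setT (fun x => complex.Im (f x)) ->
  measurable_fun setT (fun x => cabs (f x)).
Proof.
move=> mr mi; under eq_fun do rewrite cabsE.
apply: (measurableT_comp (continuous_measurable_fun (@sqrt_continuous R))).
by apply: measurable_funD; exact: measurable_funX.
Qed.

End measurability.

(** * Polar coordinates *)

Section polar.
Context {R : realType} {n : nat}.
Local Notation rV := 'rV[R]_n.
Local Notation leb1 := (@lebesgue_measure R).
Local Notation leb := (lebesgue_row R n).
Hypothesis n1 : (1 < n)%N.
Implicit Types (v : rV) (g : R -> \bar R).

Lemma enormZ (s : R) v : 0 <= s -> enorm (s *: v) = s * enorm v.
Proof.
move=> s0; rewrite /enorm /nsq -[in RHS](ger0_norm s0) -sqrtr_sqr -sqrtrM ?sqr_ge0//.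
by congr Num.sqrt; rewrite mulr_sumr; apply: eq_bigr => i _; rewrite mxE exprMn.
Qed.

Lemma measurable_enorm : measurable_fun setT (@enorm R n).
Proof.
apply: measurableT_comp; first exact: (continuous_measurable_fun (@sqrt_continuous R)).
by apply: measurable_sum => j; apply: measurable_funX; exact: measurable_coord.
Qed.

Let A : set rV := [set v | 1 <= enorm v <= 2].

Let mA : measurable A.
Proof.
have -> : A = (@enorm R n) @^-1` `[1, 2]%classic.
  by apply/seteqP; split => v; rewrite /A /= in_itv.
by rewrite -[X in measurable X]setTI; exact: measurable_enorm.
Qed.

Let A_lty : (leb A < +oo)%E.
Proof.
apply: le_lt_trans (leb_cube_lty n 2); apply: le_measure; rewrite ?inE//.
  exact: measurable_cube.
by move=> v /andP[_ v2] i; rewrite /= in_itv/= -ler_norml (le_trans (coord_le_enorm v i)).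
Qed.

Lemma annulus_gt0 : (0 < leb A)%E.
Proof.
(* With n c^2 = 1 the box [c, 2c]^n satisfies 1 <= |v|^2 <= 4 and so lies in the annulus. *)
pose c : R := (Num.sqrt n%:R)^-1.
have n0 : 0 < (n%:R : R) by rewrite ltr0n ltnW.
have c0 : 0 < c by rewrite invr_gt0 sqrtr_gt0.
have c2 : n%:R * c ^+ 2 = 1 by rewrite exprVn sqr_sqrtr ?ltW// mulfV// gt_eqF.
apply: (@lt_le_trans _ _ (leb (boxset (fun=> `[c, 2 * c]%classic)))).
  apply: leb_boxset_gt0 => // i; rewrite lebesgue_measure_itv/= lte_fin ltr_pMl// ltr1n.
  by rewrite -EFinB lte_fin mulr_natl mulr2n addrK.
apply: le_measure; rewrite ?inE//; first exact: measurable_boxset.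
move=> v vb; have vi i : c <= v 0 i <= 2 * c by have := vb i; rewrite /= in_itv.
have lo : n%:R * c ^+ 2 <= nsq v.
  rewrite mulr_natl -[X in _ *+ X]card_ord -sumr_const; apply: ler_sum => i _.
  by have /andP[cv _] := vi i; rewrite lerXn2r ?nnegrE ?(le_trans _ cv)// ltW.
have hi : nsq v <= n%:R * (2 * c) ^+ 2.
  rewrite mulr_natl -[X in _ *+ X]card_ord -sumr_const; apply: ler_sum => i _.
  have /andP[cv vc] := vi i; have v0 : 0 <= v 0 i by rewrite (le_trans _ cv)// ltW.
  by rewrite lerXn2r ?nnegrE// (le_trans v0).
rewrite /A /= /enorm; apply/andP; split.
  by rewrite -[leLHS]sqrtr1 ler_sqrt ?nsq_ge0// -c2.
rewrite -[leRHS]ger0_norm// -sqrtr_sqr ler_sqrt ?sqr_ge0//.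
by apply: le_trans hi _; rewrite exprMn mulrCA c2 mulr1.
Qed.

Let k1 : \bar R := (\int[leb1]_t ((t ^+ n)^-1 * \1_(`[2^-1, 1]%classic) t)%:E)%E.


Let mpow : measurable_fun [set: R] (fun t : R => (t ^+ n)^-1).
Proof.
by apply: measurable_inv_comp; exact: measurable_funX.
Qed.

Let k1_ge0 : (0 <= k1)%E.
Proof.
apply: integral_ge0 => t _; rewrite lee_fin indicE mem_setE in_itv/=.
case: (boolP (_ <= t <= _)) => [/andP[t0 _]|_]; rewrite ?mulr0// mulr1 invr_ge0.
by rewrite exprn_ge0// (le_trans _ t0).
Qed.

Let itvI : (\int[leb1]_t (\1_(`[2^-1, 1]%classic) t)%:E = (1 - 2^-1 : R)%:E)%E.
Proof.
have lt1 : 2^-1 < 1 :> R by rewrite invf_lt1// ltr1n.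
transitivity (leb1 (`[2^-1, 1]%classic : set R)).
  by rewrite (integral_indic _ measurableT)// setIT.
by rewrite lebesgue_measure_itv/= lte_fin lt1 EFinB.
Qed.

Let k1_fin : k1 \is a fin_num.
Proof.
rewrite ge0_fin_numE//; apply: (@le_lt_trans _ _ (\int[leb1]_t ((2 ^+ n)%:E * (\1_(`[2^-1, 1]%classic) t)%:E))%E).
  apply: ge0_le_integral => //.
  - move=> t _; rewrite lee_fin indicE mem_setE in_itv/=.
    case: (boolP (_ <= t <= _)) => [/andP[t0 _]|_]; rewrite ?mulr0// mulr1 invr_ge0.
    by rewrite exprn_ge0// (le_trans _ t0).
  - by apply/measurable_EFinP; apply: measurable_funM => //; apply: measurable_indic; exact: measurable_itv.
  - by apply/measurable_EFinP; apply: measurable_funM => //; apply: measurable_indic; exact: measurable_itv.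
  - move=> t _; rewrite lee_fin indicE mem_setE in_itv/=.
    case: (boolP (_ <= t <= _)) => [/andP[t0 _]|_]; rewrite ?mulr0// !mulr1.
    have t1 : 0 < t by rewrite (lt_le_trans _ t0).
    rewrite -exprVn lerXn2r ?nnegrE ?invr_ge0 ?(ltW t1)//.
    by rewrite invf_ple ?posrE.
rewrite ge0_integralZl//; last by apply/measurable_EFinP; exact: measurable_indic.
by rewrite itvI -EFinM ltry.
Qed.

Let k1_gt0 : (0 < k1)%E.
Proof.
apply: (@lt_le_trans _ _ (\int[leb1]_t (\1_(`[2^-1, 1]%classic) t)%:E)%E).
  by rewrite itvI lte_fin subr_gt0 invf_lt1// ltr1n.
apply: ge0_le_integral => //.
- by apply/measurable_EFinP; apply: measurable_indic; exact: measurable_itv.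
- by apply/measurable_EFinP; apply: measurable_funM => //; apply: measurable_indic; exact: measurable_itv.
- move=> t _; rewrite lee_fin indicE mem_setE in_itv/=.
  case: (boolP (_ <= t <= _)) => [/andP[t0 t1]|_]; rewrite ?mulr0// mulr1.
  have t2 : 0 < t by rewrite (lt_le_trans _ t0).
  by rewrite invf_ge1 ?exprn_gt0// exprn_ile1// ltW.
Qed.

Let a1 : \bar R := (\int[leb]_(v in A) ((enorm v)^-1)%:E)%E.

Let mrinv : measurable_fun setT (fun v : rV => (enorm v)^-1).
Proof.
by apply: measurable_inv_comp; exact: measurable_enorm.
Qed.

Let a1_fin : a1 \is a fin_num.
Proof.
rewrite ge0_fin_numE; last by apply: integral_ge0 => v _; rewrite lee_fin invr_ge0 enorm_ge0.
apply: (@le_lt_trans _ _ (\int[leb]_(v in A) (cst 1%:E v))%E).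
  apply: ge0_le_integral => //.
  - by move=> v _; rewrite lee_fin invr_ge0 enorm_ge0.
  - by apply/measurable_EFinP; exact: measurable_funTS.
  - move=> v /andP[v1 _]; rewrite lee_fin invf_le1//.
    by rewrite (lt_le_trans _ v1).
by rewrite integral_cst// mul1e.
Qed.

Let a1_gt0 : (0 < a1)%E.
Proof.
apply: (@lt_le_trans _ _ (\int[leb]_(v in A) (cst (2^-1)%:E v))%E).
  by rewrite integral_cst// mule_gt0 ?annulus_gt0// lte_fin invr_gt0.
apply: ge0_le_integral => //.
- by move=> v _; rewrite lee_fin invr_ge0.
- by apply/measurable_EFinP; exact: measurable_funTS.
- move=> v /andP[v1 v2]; have v0 : 0 < enorm v by rewrite (lt_le_trans _ v1).
  by rewrite lee_fin lef_pV2 ?posrE.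
Qed.

(** This is the area of the unit sphere, obtained without a surface measure: [a1] is the integral of
    1/|v| over the annulus 1 <= |v| <= 2, and [k1], by t = 1/u, is the radial integral of u^(n-2)
    over [1, 2]. *)
Definition polar_cst : R := fine a1 / fine k1.

Lemma polar_cst_gt0 : 0 < polar_cst.
Proof. by rewrite divr_gt0// fine_gt0// ?a1_gt0 ?k1_gt0/= ltey_eq ?a1_fin ?k1_fin. Qed.

Section polar_formula.
Variable g : R -> \bar R.
Hypotheses (mg : measurable_fun setT g) (g0 : forall r, (0 <= g r)%E).

Let F (p : measurableTypeR R * rV) : \bar R :=
  (g (p.1 * enorm p.2)%R * (\1_A p.2)%:E * (\1_(`]0%R, +oo[%classic) p.1)%:E)%E.

Let mF : measurable_fun setT F.
Proof.
apply: emeasurable_funM; first apply: emeasurable_funM.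
- apply: (measurableT_comp mg); apply: measurable_funM.
    exact: (@measurable_fst _ _ (measurableTypeR R) rV).
  exact: (measurableT_comp measurable_enorm (@measurable_snd _ _ (measurableTypeR R) rV)).
- by apply/measurable_EFinP; apply: (measurable_indic_comp mA); exact: measurable_snd.
- apply/measurable_EFinP.
  by apply: (measurable_indic_comp (measurable_itv `]0%R, +oo[)); exact: measurable_fst.
Qed.

Let F0 p : (0 <= F p)%E.
Proof. by rewrite !mule_ge0// lee_fin. Qed.

Let J := (\int[leb1]_(r in `]0%R, +oo[) g r)%E.

(* Integrating F in s first gives a1 * J (J1); integrating in v first, after the
   dilation u = s *: v, gives k1 * \int h (J2). *)
Let J1 : (\int[leb]_v \int[leb1]_s F (s, v) = a1 * J)%E.
Proof.
have inner v : (\int[leb1]_s F (s, v) = ((enorm v)^-1 * \1_A v)%:E * J)%E.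
  rewrite /F /=; case: (boolP (v \in A)) => [/set_mem vA|/negP vA]; last first.
    rewrite indicE memNset ?mulr0 ?mul0e; last by move=> ?; apply: vA; rewrite inE.
    by rewrite integral0_eq// => s _; rewrite mule0 mul0e.
  rewrite indicE mem_set// mulr1.
  have v0 : 0 < enorm v by move: vA => /andP[v1 _]; rewrite (lt_le_trans _ v1).
  pose g' r := (g r * (\1_(`]0%R, +oo[%classic) r)%:E)%E.
  have mg' : measurable_fun setT g'.
    by apply: emeasurable_funM => //; apply/measurable_EFinP; exact: measurable_indic.
  have g'0 r : (0 <= g' r)%E by rewrite mule_ge0// lee_fin.
  have -> : J = (\int[leb1]_r g' r)%E.
    rewrite /J integral_mkcond; apply: eq_integral => r _.
    by rewrite /g' patchE indicE; case: ifPn => _; rewrite ?mule1 ?mule0.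
  rewrite -(ge0_integral_leb1_scale v0 mg' g'0) muleA -EFinM mulVf ?gt_eqF// mul1e.
  apply: eq_integral => s _; rewrite /g' mule1 mulrC; congr (_ * _%:E)%E.
  by rewrite !indicE !mem_setE !in_itv/= !andbT pmulr_rgt0.
under eq_integral do rewrite inner.
rewrite ge0_integralZr//; last 3 first.
- by apply/measurable_EFinP; apply: measurable_funM => //; apply: measurable_indic; exact: measurable_itv.
- by move=> v _; rewrite lee_fin mulr_ge0// invr_ge0 enorm_ge0.
- by apply: integral_ge0.
congr (_ * _)%E; rewrite /a1 [RHS]integral_mkcond; apply: eq_integral => v _.
by rewrite patchE indicE; case: ifPn => _; rewrite ?mulr1 ?mulr0.
Qed.

Let h v : \bar R := (g (enorm v) * ((enorm v ^+ n.-1)^-1)%:E)%E.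

Let J2 : (\int[leb1]_s \int[leb]_v F (s, v) = k1 * \int[leb]_v h v)%E.
Proof.
(* For fixed s > 0 the substitution u = s v has Jacobian s^(-n), and the condition 1 <= |u|/s <= 2
   is written 1/2 <= s/|u| <= 1. *)
pose F2 (p : measurableTypeR R * rV) : \bar R :=
  (g (enorm p.2) * ((p.1 ^+ n)^-1 * \1_(`[2^-1, 1]%classic) (p.1 / enorm p.2))%:E
   * (\1_(`]0%R, +oo[%classic) p.1)%:E)%E.
have mfst := @measurable_fst _ _ (measurableTypeR R) rV.
have msnd := @measurable_snd _ _ (measurableTypeR R) rV.
have men : measurable_fun setT (fun p : measurableTypeR R * rV => enorm p.2).
  exact: (measurableT_comp measurable_enorm msnd).
have mF2 : measurable_fun setT F2.
  apply: emeasurable_funM; first apply: emeasurable_funM.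
  - exact: (measurableT_comp mg).
  - apply/measurable_EFinP; apply: measurable_funM.
      exact: (measurableT_comp mpow mfst).
    apply: (measurable_indic_comp (measurable_itv `[2^-1, 1])); apply: measurable_funM; first exact: mfst.
    exact: (measurableT_comp mrinv msnd).
  - apply/measurable_EFinP.
    by apply: (measurable_indic_comp (measurable_itv `]0%R, +oo[)); exact: measurable_fst.
have F20 p : (0 <= F2 p)%E.
  rewrite /F2 -muleA -EFinM mule_ge0// lee_fin [X in _ * X]indicE mem_setE in_itv/= andbT.
  case: ltP => p0; rewrite ?mulr0// mulr1 mulr_ge0// invr_ge0 exprn_ge0// ltW//.
transitivity (\int[leb1]_s \int[leb]_v F2 (s, v))%E.
  apply: eq_integral => s _; have [s0|s0] := ltP 0 s; last first.
    have E : \1_(`]0%R, +oo[%classic) s = 0 :> R.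
      by rewrite indicE mem_setE in_itv/= andbT ltNge s0.
    by rewrite !integral0_eq// => v _; rewrite /F /F2/= E mule0.
  pose f (u : rV) := (g (enorm u) * (\1_(`[2^-1, 1]%classic) (s / enorm u))%:E)%E.
  have mf : measurable_fun setT f.
    apply: emeasurable_funM; first exact: (measurableT_comp mg measurable_enorm).
    apply/measurable_EFinP.
    by apply: (measurable_indic_comp (measurable_itv `[2^-1, 1])); exact: measurable_funM.
  have f0 u : (0 <= f u)%E by rewrite mule_ge0// lee_fin.
  have E : \1_(`]0%R, +oo[%classic) s = 1 :> R.
    by rewrite indicE mem_setE in_itv/= andbT s0.
  have -> : (\int[leb]_v F2 (s, v) = ((s ^+ n)^-1)%:E * \int[leb]_u f u)%E.
    rewrite -ge0_integralZl//; last by rewrite lee_fin invr_ge0 exprn_ge0// ltW.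
    by apply: eq_integral => v _; rewrite /F2 /f/= E mule1 EFinM muleCA.
  rewrite -(ge0_integral_row_scale s0 mf f0) muleA -EFinM mulVf ?mul1e; last first.
    by rewrite expf_neq0// gt_eqF.
  apply: eq_integral => v _; rewrite /F/= E mule1 /f enormZ ?(ltW s0)//.
  congr (_ * _%:E)%E; rewrite !indicE; congr (_%:R).
  have -> : (v \in A) = (1 <= enorm v <= 2) by apply/idP/idP => [/set_mem//|?]; rewrite inE.
  rewrite mem_setE in_itv/=.
  have [v0|v0] := eqVneq (enorm v) 0.
    by rewrite v0 mulr0 invr0 mulr0 ler10 !leNgt invr_gt0 ltr0n.
  have v1 : 0 < enorm v by rewrite lt_neqAle eq_sym v0 enorm_ge0.
  rewrite invfM mulrA divff ?gt_eqF// mul1r andbC lef_pV2 ?posrE// invf_le1//.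
rewrite (fubini_tonelli F2 mF2 F20) /fubini_G /=.
rewrite -ge0_integralZl//; last 2 first.
- apply: emeasurable_funM; first exact: (measurableT_comp mg measurable_enorm).
  by apply/measurable_EFinP/measurable_inv_comp; exact: (measurable_funX _ measurable_enorm).
- by move=> v _; rewrite mule_ge0// lee_fin invr_ge0 exprn_ge0// enorm_ge0.
apply: eq_integral => v _; rewrite /F2/= /h.
(* At the origin inverses of 0 are 0 by convention: the weight vanishes because n > 1, and s/0 = 0
   lies outside [1/2, 1]. *)
have [v0|v0] := eqVneq (enorm v) 0.
  have -> : (enorm v ^+ n.-1)^-1 = 0.
    by rewrite v0 expr0n (_ : n.-1 == 0%N = false) ?invr0//; case: n n1 => [|[]].
  rewrite mule0 mule0 integral0_eq// => s _; rewrite v0 invr0 mulr0 indicE mem_setE in_itv/=.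
  by rewrite leNgt invr_gt0 ltr0n mulr0 mule0 mul0e.
have v1 : 0 < enorm v by rewrite lt_neqAle eq_sym v0 enorm_ge0.
pose q (s : R) : \bar R := ((s ^+ n)^-1 * \1_(`[2^-1, 1]%classic) (s / enorm v) * \1_(`]0%R, +oo[%classic) s)%:E.
have mq : measurable_fun setT q.
  apply/measurable_EFinP; apply: measurable_funM; last exact: measurable_indic.
  apply: measurable_funM => //.
  by apply: (measurable_indic_comp (measurable_itv `[2^-1, 1])); exact: measurable_funM.
have q0 s : (0 <= q s)%E.
  rewrite lee_fin [X in _ * X]indicE mem_setE in_itv/= andbT.
  case: ltP => p0; rewrite ?mulr0// mulr1 mulr_ge0// invr_ge0 exprn_ge0// ltW//.
transitivity (g (enorm v) * \int[leb1]_s q s)%E.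
  rewrite -ge0_integralZl//; apply: eq_integral => s _.
  by rewrite /q [in RHS]EFinM muleA.
rewrite muleCA; congr (_ * _)%E.
rewrite -(ge0_integral_leb1_scale v1 mq q0) muleC.
have -> : (\int[leb1]_t q (enorm v * t)%R = ((enorm v ^+ n)^-1)%:E * k1)%E.
  rewrite -ge0_integralZl//; last 3 first.
  - by apply/measurable_EFinP; apply: measurable_funM => //; apply: measurable_indic; exact: measurable_itv.
  - move=> t _; rewrite lee_fin indicE mem_setE in_itv/=.
    case: (boolP (_ <= t <= _)) => [/andP[t0 _]|_]; rewrite ?mulr0// mulr1 invr_ge0.
    by rewrite exprn_ge0// (le_trans _ t0).
  - by rewrite lee_fin invr_ge0 exprn_ge0// ltW.
  apply: eq_integral => t _; rewrite -EFinM /q; congr EFin.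
  rewrite exprMn invfM -!mulrA; congr (_ * _); congr (_ * _).
  have -> : enorm v * (t / enorm v) = t by rewrite mulrCA mulfV// mulr1.
  rewrite !indicE !mem_setE !in_itv/= andbT pmulr_rgt0//.
  case: (boolP (_ <= t <= _)) => [/andP[t0 _]|_]; rewrite ?mul0r// mul1r.
  by rewrite (lt_le_trans _ t0).
rewrite muleC muleA -EFinM muleC; congr (_ * _%:E)%E.
have nE : enorm v ^+ n = enorm v * enorm v ^+ n.-1 by rewrite -exprS prednK// ltnW.
by rewrite nE invfM mulrA divff ?mul1r.
Qed.

Lemma polar_formula : (\int[leb]_v (g (enorm v) * ((enorm v ^+ n.-1)^-1)%:E) =
  polar_cst%:E * \int[leb1]_(r in `]0%R, +oo[) g r)%E.
Proof.
have E : (k1 * \int[leb]_v h v = a1 * J)%E.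
  by rewrite -J1 -J2; exact: (fubini_tonelli F mF F0).
rewrite -/J /polar_cst EFinM fineK//.
have k1E : k1 = (fine k1)%:E by rewrite fineK.
have kn0 : fine k1 != 0 by rewrite gt_eqF// fine_gt0// k1_gt0/= ltey_eq k1_fin.
rewrite -/h muleAC -E k1E muleC muleA.
by rewrite -EFinM mulVf// mul1e.
Qed.

End polar_formula.

End polar.

#[global] Instance ae_lebesgue_filter (R : realType) :
  Filter (nbhs (almost_everywhere (@lebesgue_measure R))).
Proof. exact: ae_filter_ringOfSetsType. Qed.

(** * Null sets of radii and measurable radial profiles *)

Section radial_representative.
Context {R : realType} {n : nat}.
Local Notation rV := 'rV[R]_n.
Local Notation leb1 := (@lebesgue_measure R).
Local Notation leb := (lebesgue_row R n).
Hypothesis n1 : (1 < n)%N.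
Implicit Types (v : rV).

Lemma ae_row_ex (P : rV -> Prop) : {ae leb, forall v, P v} -> exists v, P v.
Proof.
move=> [N [mN N0 PN]]; apply: contrapT => nP.
have : (0 < leb N)%E.
  apply: (@lt_le_trans _ _ (leb (boxset (fun=> `[0, 1]%classic)))).
    apply: leb_boxset_gt0 => // i.
    by rewrite lebesgue_measure_itv/= lte_fin ltr01 -EFinB lte_fin subr0.
  apply: le_measure; rewrite ?inE//; first exact: measurable_boxset.
  by move=> v _; apply: PN => Pv; apply: nP; exists v.
by rewrite N0 ltxx.
Qed.

Lemma ae_enorm_gt0 : {ae leb, forall v, 0 < enorm v}.
Proof.
exists (boxset (fun=> [set 0])); split.
- by apply: measurable_boxset.
- rewrite leb_boxset//; under eq_bigr do rewrite lebesgue_measure_set1.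
  by case: n n1 => // m _; rewrite big_ord_recl mul0e.
- move=> v /negP; rewrite -leNgt => v0 i /=; apply/eqP; rewrite -normr_le0.
  exact: le_trans (coord_le_enorm v i) v0.
Qed.

(** The polar formula for the indicator of a null set of radii has right-hand side 0, and the weight
    |v|^(1-n) is positive off the origin. *)
Lemma ae_enorm (P : R -> Prop) : {ae leb1, forall r, 0 < r -> P r} ->
  {ae leb, forall v, P (enorm v)}.
Proof.
move=> [N [mN N0 PN]].
have := @polar_formula R n n1 (fun r => (\1_N r)%:E).
have -> : (\int[leb1]_(r in `]0%R, +oo[) (\1_N r)%:E = 0)%E.
  rewrite integral_indic//; apply: (@subset_measure0 _ _ _ leb1 _ N) => //.
  exact: measurableI.
rewrite mule0 => /(_ _ _)/wrap[|r|I]; [|by rewrite lee_fin|].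
  by apply/measurable_EFinP; exact: measurable_indic.
have mf : measurable_fun setT (fun v => ((\1_N (enorm v))%:E * ((enorm v ^+ n.-1)^-1)%:E)%E).
  apply: emeasurable_funM.
    by apply/measurable_EFinP; apply: (measurable_indic_comp mN); exact: measurable_enorm.
  apply/measurable_EFinP/measurable_inv_comp.
  by apply: measurable_funX; exact: measurable_enorm.
have := iffLR (ae_eq_integral_abs leb measurableT mf).
under eq_integral do rewrite gee0_abs ?mule_ge0 ?lee_fin ?invr_ge0 ?exprn_ge0 ?enorm_ge0//.
move=> /(_ I); move: ae_enorm_gt0; apply: filterS2 => v v0 /(_ Logic.I)/eqP.
rewrite mule_eq0 => /orP[|]; rewrite eqe; last first.
  by rewrite invr_eq0 expf_eq0 gt_eqF// andbF.
rewrite indicE pnatr_eq0 eqb0 => /negP vN; apply: contrapT => nP; apply: vN.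
by rewrite inE; apply: PN => /(_ v0).
Qed.

(* h need not be measurable. For almost every v0 the ray through v0 meets the
   exceptional set in a null set, so f along this ray is a measurable profile. *)
Lemma radial_representative (f : rV -> R) (h : R -> R) : measurable_fun setT f ->
  {ae leb, forall v, f v = h (enorm v)} ->
  exists2 k : R -> R, measurable_fun setT k & {ae leb, forall v, f v = k (enorm v)}.
Proof.
move=> mf fh; have [N [mN N0 fN]] := fh.
pose T (p : rV * measurableTypeR R) : \bar R :=
  ((\1_N (p.2 *: p.1))%:E * (\1_(`]0%R, +oo[%classic) p.2)%:E)%E.
have mfst := @measurable_fst _ _ rV (measurableTypeR R).
have msnd := @measurable_snd _ _ rV (measurableTypeR R).
have mT : measurable_fun setT T.
  apply: emeasurable_funM; apply/measurable_EFinP.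
    apply: (measurable_indic_comp mN); apply: measurable_fun_coordP => i.
    under eq_fun do rewrite mxE; apply: measurable_funM; first exact: msnd.
    exact: (measurableT_comp (measurable_coord i) mfst).
  by apply: (measurable_indic_comp (measurable_itv `]0%R, +oo[)); exact: msnd.
have T0 p : (0 <= T p)%E by rewrite mule_ge0// lee_fin.
have mNs : measurable_fun setT (fun v : rV => (\1_N v)%:E : \bar R).
  by apply/measurable_EFinP; exact: measurable_indic.
have NI : (\int[leb]_v (\1_N v)%:E = 0)%E by rewrite integral_indic// setIT.
(* For each s > 0 the dilate of [N] by 1/s is a null set; Tonelli exchanges this with the statement
   on rays. *)
have I0 : (\int[leb]_v \int[leb1]_s T (v, s) = 0)%E.
  have := fubini_tonelli T mT T0; rewrite /fubini_F /fubini_G /= => ->.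
  apply: integral0_eq => s _; have [s0|s0] := ltP 0 s; last first.
    apply: integral0_eq => v _; rewrite /T/= [X in (_ * X%:E)%E]indicE mem_setE in_itv/= andbT.
    by rewrite ltNge s0 mule0.
  have sn : (0 < s ^+ n)%R by rewrite exprn_gt0.
  have := ge0_integral_row_scale s0 mNs (fun v => _).
  rewrite NI => /(_ _)/wrap[v|]; first by rewrite lee_fin.
  move/eqP; rewrite mule_eq0 eqe gt_eqF//= => /eqP E.
  rewrite -[RHS]E; apply: eq_integral => v _.
  by rewrite /T/= [X in (_ * X%:E)%E]indicE mem_setE in_itv/= andbT s0 mule1.
have mG : measurable_fun setT (fun v => \int[leb1]_s T (v, s))%E.
  exact: measurable_fun_fubini_tonelli_F.
have := iffLR (ae_eq_integral_abs leb measurableT mG).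
under eq_integral do rewrite gee0_abs ?integral_ge0//.
move=> /(_ I0) ae0.
have [v0 [r0 /(_ Logic.I) Tv0]] : exists v, 0 < enorm v /\ (setT v -> \int[leb1]_s T (v, s) = 0)%E.
  by apply: ae_row_ex; move: ae_enorm_gt0 ae0; apply: filterS2.
pose c := (enorm v0)^-1.
have c0 : 0 < c by rewrite invr_gt0.
have mline : measurable_fun setT (fun r : measurableTypeR R => (c * r) *: v0).
  apply: measurable_fun_coordP => i; under eq_fun do rewrite mxE.
  by apply: measurable_funM => //; apply: measurable_funM.
exists (fun r => f ((c * r) *: v0)); first exact: (measurableT_comp mf mline).
have NK : {ae leb1, forall r, 0 < r -> ~ N ((c * r) *: v0)}.
  pose g (s : R) : \bar R := T (v0, s).
  have mg : measurable_fun setT g.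
    by apply: (measurableT_comp mT); exact: pair1_measurable.
  have mgc : measurable_fun setT (fun r => g (c * r)%R).
    by apply: (measurableT_comp mg); exact: measurable_funM.
  have := iffLR (ae_eq_integral_abs leb1 measurableT mgc).
  under eq_integral do rewrite gee0_abs ?T0//.
  move=> /(_ _)/wrap[|].
    have := ge0_integral_leb1_scale c0 mg (fun s => T0 (v0, s)).
    rewrite [RHS]Tv0 => /eqP; rewrite mule_eq0 eqe gt_eqF//= => /eqP E.
    exact: E.
  apply: filterS => r /(_ Logic.I)/eqP + r0' Nr.
  rewrite /g /T/= !indicE mem_set// mem_setE in_itv/= andbT mulr_gt0//.
  by rewrite mul1e eqe oner_eq0.
have EK : {ae leb1, forall r, 0 < r -> f ((c * r) *: v0) = h r}.
  move: NK; apply: filterS => r H r0'; apply: contrapT => ne; apply: (H r0'); apply: fN => /= E.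
  by apply: ne; rewrite E enormZ ?mulr_ge0 ?ltW// mulrAC mulVf ?mul1r ?gt_eqF.
by move: (ae_enorm EK) fh; apply: filterS2 => v -> ->.
Qed.

End radial_representative.

(** * Mollification on the half-line *)

Section mollifier.
Context {R : realType}.
Local Notation leb1 := (@lebesgue_measure R).
Implicit Types (f : R -> R) (x t e : R).

(** The derivative of [step (t / e)]: a kernel of mass 1 supported in [0, e]. One-sidedness matches
    the ramps of [cutoff]. *)
Definition moll e t : R := e^-1 * (smooth_bump (t / e) / bump_prim 1).

Lemma moll_ge0 e t : 0 < e -> 0 <= moll e t.
Proof. by move=> e0; rewrite mulr_ge0 ?invr_ge0 ?(ltW e0)// divr_ge0 ?bump_ge0 ?bump_prim_ge0. Qed.

Lemma moll_le e t : 0 < e -> moll e t <= e^-1 * (bump_prim 1)^-1.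
Proof.
move=> e0; rewrite ler_wpM2l ?invr_ge0 ?(ltW e0)// ler_piMl ?bump_le1//.
by rewrite invr_ge0 bump_prim_ge0.
Qed.

Lemma moll_le0 e t : 0 < e -> t <= 0 -> moll e t = 0.
Proof. by move=> e0 t0; rewrite /moll bump_le0 ?mul0r ?mulr0// pmulr_lle0 ?invr_gt0. Qed.

Lemma moll_ge e t : 0 < e -> e <= t -> moll e t = 0.
Proof. by move=> e0 t0; rewrite /moll bump_ge1 ?mul0r ?mulr0// ler_pdivlMr// mul1r. Qed.

Lemma is_derive_step_aff e x t : e != 0 ->
  is_derive t 1 (fun t : R => step ((t - x) / e)) (moll e (t - x)).
Proof.
move=> e0.
have d1 : is_derive t 1 (fun t : R => (t - x) / e) e^-1.
  have -> : (fun t : R => (t - x) / e) = (e^-1 \*: ((@id R) - cst x)).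
    by apply/funext => s /=; rewrite /GRing.scale/= mulrC.
  by apply: is_derive_eq; rewrite subr0 /GRing.scale/= mulr1.
have := @is_derive1_comp _ step (fun t : R => (t - x) / e) t _ _ (is_derive_step ((t - x) / e)) d1.
by rewrite /moll mulrC.
Qed.

Lemma is_derive_cutoff a b e t : e != 0 ->
  is_derive t 1 (cutoff a b e) (moll e (t - a) - moll e (t - b)).
Proof.
move=> e0; have da := is_derive_step_aff a t e0; have db := is_derive_step_aff b t e0.
exact: is_deriveB.
Qed.

Lemma continuous_moll e x : 0 < e -> continuous (fun t => moll e (t - x)).
Proof.
move=> e0; have e0' : e != 0 by rewrite gt_eqF.
have -> : (fun t => moll e (t - x)) = derive1 (fun t : R => step ((t - x) / e)).
  apply/funext => t; rewrite derive1E.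
  by rewrite (@derive_val _ _ _ _ _ _ _ (is_derive_step_aff x t e0')).
apply/smooth1_continuous/derive1_smooth1; apply: smooth1_comp; first exact: smooth1_step.
apply: smooth1M; last exact: smooth1_cst.
by apply: smooth1B; [exact: smooth1_id|exact: smooth1_cst].
Qed.

Lemma measurable_moll e x : 0 < e -> measurable_fun setT (fun t => moll e (t - x)).
Proof. by move=> e0; apply: continuous_measurable_fun; exact: continuous_moll. Qed.

Lemma integral_moll e x : 0 < e -> (\int[leb1]_t (moll e (t - x))%:E = 1)%E.
Proof.
move=> e0; have e0' : e != 0 by rewrite gt_eqF.
have cm := @continuous_moll e x e0.
transitivity (\int[leb1]_(t in `[x, (x + e)%R]) (moll e (t - x))%:E)%E.
  rewrite [RHS]integral_mkcond; apply: eq_integral => t _; rewrite patchE.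
  case: ifPn => //; rewrite mem_setE in_itv/= negb_and -!ltNge => /orP[tx|tx].
    by rewrite moll_le0// subr_le0 ltW.
  by rewrite moll_ge// lerBrDl ltW.
have cs : continuous (fun t : R => step ((t - x) / e)).
  by move=> t; have [d _] := is_derive_step_aff x t e0'; apply/differentiable_continuous/derivable1_diffP.
rewrite (@continuous_FTC2 _ _ (fun t : R => step ((t - x) / e))).
- have -> : x + e - x = e by rewrite addrAC subrr add0r.
  by rewrite divff// step_ge1// subrr mul0r step_le0// sube0.
- by rewrite ltrDl.
- exact: continuous_subspaceT.
- split.
  + by move=> t _; have [] := is_derive_step_aff x t e0'.
  + by apply: cvg_at_right_filter; exact: cs.
  + by apply: cvg_at_left_filter; exact: cs.
- move=> t _; rewrite derive1E.
  by rewrite (@derive_val _ _ _ _ _ _ _ (is_derive_step_aff x t e0')).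
Qed.

Lemma integrable_mul_moll f e x : 0 < e -> leb1.-integrable setT (EFin \o f) ->
  leb1.-integrable setT (fun t => (f t * moll e (t - x))%:E).
Proof.
move=> e0 intf; have mf : measurable_fun setT f.
  by have /measurable_int/measurable_EFinP := intf.
have mm := @measurable_moll e x e0.
apply: (@le_integrable _ _ _ leb1 setT measurableT _ (fun t => (e^-1 * (bump_prim 1)^-1)%:E * (f t)%:E)%E).
- by apply/measurable_EFinP; exact: measurable_funM.
- move=> t _; rewrite -EFinM !abse_EFin lee_fin [leLHS]normrM [leRHS]normrM.
  have c0 : 0 <= e^-1 * (bump_prim 1)^-1 by rewrite mulr_ge0// invr_ge0 ?bump_prim_ge0// ltW.
  by rewrite (ger0_norm c0) (ger0_norm (moll_ge0 _ e0)) mulrC ler_wpM2r ?moll_le.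
- exact: integrableZl.
Qed.

(** The kernel is at most 1 / (e [bump_prim 1]) and lives in the ball of radius e, of measure 2e.
    The error is thus at most 2 / [bump_prim 1] times the mean deviation of f on that ball, which
    tends to 0 at a Lebesgue point. *)
Lemma moll_near f x (eta : R) : leb1.-integrable setT (EFin \o f) ->
  lebesgue_pt f x -> 0 < eta -> \forall e \near 0^'+,
  `|\int[leb1]_t (f t * moll e (t - x)) - f x| <= eta.
Proof.
move=> intf fx eta0; have mf : measurable_fun setT f.
  by have /measurable_int/measurable_EFinP := intf.
have K0 : 0 < (bump_prim 1)^-1 :> R by rewrite invr_gt0 bump_prim1_gt0.
pose eta' : R := eta / (2 * (bump_prim 1)^-1).
have eta'0 : 0 < eta' by rewrite divr_gt0// mulr_gt0.
have near_d : \forall e \near 0^'+, (davg f x e < eta'%:E)%E.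
  by apply: (fx [set z | (z < eta'%:E)%E]); apply: open_ereal_lt'; rewrite lte_fin.
near=> e.
have e0 : 0 < e by near: e; exact: nbhs_right_gt.
have de : (davg f x e < eta'%:E)%E by near: e.
have mm := @measurable_moll e x e0.
have im : leb1.-integrable setT (fun t => (moll e (t - x))%:E).
  apply/integrableP; split; first exact/measurable_EFinP.
  under eq_integral do rewrite gee0_abs ?lee_fin ?moll_ge0//.
  by rewrite integral_moll// ltry.
have ifx : leb1.-integrable setT (fun t => (f x * moll e (t - x))%:E).
  under eq_fun do rewrite EFinM; exact: integrableZl.
have E : \int[leb1]_t (f t * moll e (t - x)) - f x =
    \int[leb1]_t ((f t - f x) * moll e (t - x)).
  transitivity (\int[leb1]_t (f t * moll e (t - x)) - \int[leb1]_t (f x * moll e (t - x))).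
    by rewrite RintegralZl// /Rintegral integral_moll//= mulr1.
  rewrite -RintegralB//; last exact: integrable_mul_moll.
  by apply: eq_Rintegral => t _; rewrite mulrBl.
have iD : leb1.-integrable setT (fun t => ((f t - f x) * moll e (t - x))%:E).
  under eq_fun do rewrite mulrBl EFinB.
  by apply: integrableB => //; exact: integrable_mul_moll.
rewrite E -lee_fin EFin_normr_Rintegral//.
apply: le_trans (le_abse_integral _ _ _) _ => //; first exact: measurable_int iD.
apply: (@le_trans _ _ (\int[leb1]_(t in ball x e) ((e^-1 * (bump_prim 1)^-1)%:E * `|f t - f x|%:E))%E).
  rewrite [leRHS]integral_mkcond; apply: ge0_le_integral => //.
  - by apply: measurableT_comp => //; exact: measurable_int iD.
  - apply/(measurable_restrictT _ (measurable_ball _ _)).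
    apply: measurable_funTS; apply: emeasurable_funM => //; apply/measurable_EFinP.
    by apply: measurableT_comp => //; exact: measurable_funB.
  - move=> t _; rewrite patchE abse_EFin normrM [`|moll _ _|]ger0_norm ?moll_ge0//.
    case: ifPn => [_|].
      by rewrite -EFinM lee_fin mulrC ler_wpM2r// moll_le.
    rewrite ball_itv mem_setE in_itv/= negb_and -!leNgt => /orP[tx|tx].
      rewrite moll_le0 ?mulr0// subr_le0 (le_trans tx)// gerBl ltW//.
    by rewrite moll_ge ?mulr0// lerBrDl.
rewrite ge0_integralZl//; last 3 first.
- exact: measurable_ball.
- apply: measurable_funTS; apply/measurable_EFinP.
  by apply: measurableT_comp => //; exact: measurable_funB.
- by rewrite lee_fin mulr_ge0 ?invr_ge0 ?bump_prim_ge0// ltW.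
move: de; rewrite /davg /iavg (lebesgue_measure_ball _ (ltW e0)).
rewrite inver mulrn_eq0/= (gt_eqF e0).
set J := (\int[_]_(t in _) _)%E => de.
have e2 : 0 < e *+ 2 by rewrite pmulrn_lgt0.
rewrite -(@lee_pmul2l _ (e *+ 2)^-1%:E) ?lte_fin ?invr_gt0//.
rewrite muleCA; apply: (@le_trans _ _ ((e^-1 * (bump_prim 1)^-1)%:E * eta'%:E)%E).
  by apply: lee_wpmul2l; [rewrite lee_fin mulr_ge0// ltW// invr_gt0|exact: ltW].
rewrite -!EFinM lee_fin /eta' le_eqVlt; apply/orP; left; apply/eqP.
by field; rewrite !gt_eqF//= ?bump_prim1_gt0.
Unshelve. all: by end_near. Qed.

End mollifier.

(** * Oscillation of radial Sobolev functions *)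

Section real_lemmas.
Context {R : realType}.
Local Notation leb1 := (@lebesgue_measure R).

(** A Cauchy-Schwarz bound with a free weight s is linear in b and c, hence can be integrated;
    [amgm_sqr_inv] returns to the product form afterwards. *)
Lemma amgm_sqr (s a b c : R) : 0 < s -> 0 <= b -> 0 <= c -> a ^+ 2 <= b * c ->
  2 * `|a| <= s * b + s^-1 * c.
Proof.
move=> s0 b0 c0 abc; have s0' : 0 <= s by exact: ltW.
rewrite -ler_sqr ?nnegrE ?addr_ge0 ?mulr_ge0 ?invr_ge0//.
rewrite exprMn real_normK ?num_real//; apply: (@le_trans _ _ (4 * (b * c))).
  by rewrite (_ : 2 ^+ 2 = 4 :> R) ?ler_wpM2l// -natrX.
rewrite -subr_ge0; have -> : (s * b + s^-1 * c) ^+ 2 - 4 * (b * c) = (s * b - s^-1 * c) ^+ 2.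
  by field; rewrite gt_eqF.
exact: sqr_ge0.
Qed.

Lemma amgm_sqr_inv (a b c : R) : 0 <= b -> 0 < c ->
  (forall s, 0 < s -> 2 * a <= s * b + s^-1 * c) -> 0 <= a -> a ^+ 2 <= b * c.
Proof.
move=> b0 c0 H; rewrite le_eqVlt => /predU1P[<-|a0].
  by rewrite expr0n/= mulr_ge0// ltW.
(* For s = c / a the last term is a itself, and one of the two copies of a on the left cancels. *)
have /H : 0 < c / a by rewrite divr_gt0.
have -> : (c / a)^-1 * c = a by field; rewrite !gt_eqF.
have -> : c / a * b = b * c / a by rewrite mulrC mulrA.
by rewrite mulr2n mulrDl mul1r lerD2r ler_pdivlMr// -expr2.
Qed.

Lemma sum_mul_sqr_le (n : nat) (a b : 'I_n -> R) :
  (\sum_i a i * b i) ^+ 2 <= (\sum_i a i ^+ 2) * (\sum_i b i ^+ 2).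
Proof.
set A := \sum_i a i ^+ 2; set B := \sum_i b i ^+ 2; set S := \sum_i _.
have A0 : 0 <= A by apply: sumr_ge0 => i _; exact: sqr_ge0.
(* This sum of squares equals A (A B - S^2), which settles Cauchy-Schwarz unless A = 0. *)
have : 0 <= \sum_i (A * b i - S * a i) ^+ 2 by apply: sumr_ge0 => i _; exact: sqr_ge0.
have -> : \sum_i (A * b i - S * a i) ^+ 2 = A * (A * B - S ^+ 2).
  rewrite (eq_bigr (fun i => A ^+ 2 * b i ^+ 2 + (-2 * A * S * (a i * b i) + S ^+ 2 * a i ^+ 2))); last first.
    by move=> i _; ring.
  by rewrite !big_split/= -!mulr_sumr -/A -/B -/S; ring.
move: A0; rewrite le_eqVlt => /predU1P[A0|A0]; last by rewrite pmulr_rge0// subr_ge0.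
have a0 i : a i = 0.
  apply/eqP; rewrite -sqrf_eq0 eq_le sqr_ge0 andbT A0 /A (bigD1 i)//= lerDl.
  by apply: sumr_ge0 => j _; exact: sqr_ge0.
by rewrite /S big1 ?expr0n/= -?A0 ?mul0r// => i _; rewrite a0 mul0r.
Qed.

Lemma integral_inv_sqr_le (x y : R) : 0 < x -> x < y ->
  (\int[leb1]_(r in `[x, y]) ((r ^+ 2)^-1)%:E <= (x^-1)%:E)%E.
Proof.
move=> x0 xy; have pos (r : R) : x <= r -> 0 < r by exact: lt_le_trans.
have dF (r : R) : 0 < r -> is_derive r 1 (fun t : R => - t^-1) ((r ^+ 2)^-1).
  move=> r0; have r1 : r != 0 by rewrite gt_eqF.
  have -> : (fun t : R => - t^-1) = - (fun t : R => t^-1) by apply/funext.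
  have dV : is_derive r 1 (fun t : R => t^-1) (- (r ^- 2) *: (1 : R)).
    exact: (is_deriveV (f := id)).
  by apply: is_derive_eq; rewrite /GRing.scale/= mulr1 opprK.
have cF (r : R) : 0 < r -> {for r, continuous (fun t : R => - t^-1)}.
  by move=> /dF[d _]; apply/differentiable_continuous/derivable1_diffP.
rewrite (@continuous_FTC2 _ _ (fun t : R => - t^-1))//.
- by rewrite -EFinB lee_fin opprK gerDr oppr_le0 invr_ge0 ltW// (lt_trans x0).
- apply: continuous_in_subspaceT => r; rewrite inE/= in_itv/= => /andP[/pos r0 _].
  apply: cvgV; first by rewrite sqrf_eq0 gt_eqF.
  exact: exprn_continuous.
- split.
  + by move=> r; rewrite in_itv/= => /andP[/ltW/pos/dF[]].
  + by apply: cvg_at_right_filter; exact: cF.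
  + by apply: cvg_at_left_filter; apply: cF; rewrite (lt_trans x0).
- move=> r; rewrite in_itv/= => /andP[/ltW/pos r0 _]; rewrite derive1E.
  by rewrite (@derive_val _ _ _ _ _ _ _ (dF r r0)).
Qed.

Lemma Rintegral_sum d (T : measurableType d) (m : {measure set T -> \bar R})
    (n : nat) (f : 'I_n -> T -> R) : (forall i, m.-integrable setT (EFin \o f i)) ->
  \int[m]_v (\sum_i f i v) = \sum_i \int[m]_v f i v.
Proof.
move=> intf; rewrite /Rintegral; under eq_integral do rewrite -sumEFin.
rewrite (@integral_sum _ _ _ m setT measurableT _ (fun i v => (f i v)%:E) intf).
by rewrite sum_fine// => i _; apply: integrable_fin_num => //; exact: intf.
Qed.

End real_lemmas.

Section oscillation.
Context {R : realType} {n : nat}.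
Local Notation rV := 'rV[R]_n.
Local Notation leb1 := (@lebesgue_measure R).
Local Notation leb := (lebesgue_row R n).
Local Notation mu := (@hyp_measure R n).
Local Notation w := (@volume_density R n).
Local Notation cst_ := (@polar_cst R n).
Hypothesis n1 : (1 < n)%N.
Implicit Types (v : rV) (k : R -> R).

Lemma measurable_inv_enormX m : measurable_fun setT (fun v : rV => (enorm v ^+ m)^-1).
Proof.
by apply/measurable_inv_comp/measurable_funX; exact: measurable_enorm.
Qed.

Lemma polar_Rintegral k : measurable_fun setT k ->
  leb1.-integrable `]0, +oo[%classic (EFin \o k) ->
  \int[leb]_v (k (enorm v) * (enorm v ^+ n.-1)^-1) = cst_ * \int[leb1]_(r in `]0, +oo[) k r.
Proof.
move=> mk ik; rewrite /Rintegral integralE [in RHS]integralE.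
have c0 v : 0 <= (enorm v ^+ n.-1)^-1 by rewrite invr_ge0 exprn_ge0// enorm_ge0.
have mkE : measurable_fun setT (EFin \o k) by exact/measurable_EFinP.
have -> : (\int[leb]_v ((fun v => (k (enorm v) * (enorm v ^+ n.-1)^-1)%:E)^\+ v) =
    cst_%:E * \int[leb1]_(r in `]0%R, +oo[) ((EFin \o k)^\+ r))%E.
  rewrite -(polar_formula n1 (measurable_funepos mkE) (fun r => funepos_ge0 _ r)).
  apply: eq_integral => v _; rewrite !funeposE/= -!EFin_max -EFinM.
  by rewrite [in RHS]mulrC maxr_pMr// mulr0 mulrC.
have -> : (\int[leb]_v ((fun v => (k (enorm v) * (enorm v ^+ n.-1)^-1)%:E)^\- v) =
    cst_%:E * \int[leb1]_(r in `]0%R, +oo[) ((EFin \o k)^\- r))%E.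
  rewrite -(polar_formula n1 (measurable_funeneg mkE) (fun r => funeneg_ge0 _ r)).
  apply: eq_integral => v _; rewrite !funenegE/= -!EFin_max -EFinM.
  by rewrite [in RHS]mulrC maxr_pMr// mulr0 mulrN mulrC.
have pf : (\int[leb1]_(r in `]0%R, +oo[) ((EFin \o k)^\+ r))%E \is a fin_num.
  by apply: integrable_pos_fin_num.
have nf : (\int[leb1]_(r in `]0%R, +oo[) ((EFin \o k)^\- r))%E \is a fin_num.
  by apply: integrable_neg_fin_num.
rewrite -muleBr//; last by rewrite fin_num_adde_defr// fin_numN.
by rewrite fineM// fin_numB pf.
Qed.

(** Let S be the sum on the left. Since [gip v a a] = |a|^2 + S^2 and S^2 <= |v|^2 |a|^2, one has
    S^2 (1 + |v|^2) <= |v|^2 [gip v a a]. Here 1 + |v|^2 is the squared height and the density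
    1/height is at least its square. *)
Lemma sqr_dot_le v (a : 'I_n -> R) :
  (\sum_i v 0 i * a i) ^+ 2 <= gip v a a * w v * nsq v.
Proof.
set S := \sum_i _; set h := height v; have h0 : 0 < h by exact: height_gt0.
have wE : w v = h^-1 := volume_densityE v.
have w1 : h^-1 <= 1 by rewrite -wE volume_density_le1.
have gE : gip v a a = \sum_i a i ^+ 2 + S ^+ 2.
  by rewrite /gip -expr2; congr (_ + _); apply: eq_bigr => i _; rewrite expr2.
have CS : S ^+ 2 <= nsq v * \sum_i a i ^+ 2 by exact: sum_mul_sqr_le.
apply: (@le_trans _ _ (gip v a a * nsq v / h ^+ 2)).
  rewrite ler_pdivlMr ?exprn_gt0// sqr_height gE.
  by rewrite mulrDr mulr1 mulrDl lerD2r mulrC.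
rewrite [leRHS]mulrAC wE expr2 invfM mulrA ler_piMr//.
by rewrite mulr_ge0 ?invr_ge0 ?(ltW h0)// mulr_ge0 ?gip_ge0 ?nsq_ge0.
Qed.

Variables (g : rV -> R) (G : 'I_n -> rV -> R) (k : R -> R).
Hypotheses (sG : sobolevR g G) (mk : measurable_fun setT k)
  (gk : {ae leb, forall v, g v = k (enorm v)}).

Let Dir : R := \int[mu]_v gip v (G ^~ v) (G ^~ v).

Let ge0_sqr_quot (D : R -> R) (a r : R) : 0 < a -> (forall t, t <= a -> D t = 0) ->
  0 <= D r ^+ 2 / r ^+ n.-1.
Proof.
move=> a0 Da; have [ra|ra] := leP r a; first by rewrite Da// expr0n/= mul0r.
by rewrite divr_ge0 ?sqr_ge0// exprn_ge0// ltW// (lt_trans a0).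
Qed.

(** The weak-derivative identities for the components of the radial field add up to an integral of g
    times its divergence, which in polar coordinates is the integral of k D'. On the gradient side
    [sqr_dot_le] and the weighted inequality are applied pointwise. *)
Lemma radial_test_bound (D : R -> R) (a b s : R) : 0 < a -> smooth1 D ->
    (forall t, t <= a -> D t = 0) -> (forall t, b <= t -> D t = 0) -> 0 < s ->
  ((2 * (cst_ * `|\int[leb1]_(r in `]0%R, +oo[) (k r * derive1 D r)|))%:E <=
   (s * Dir)%:E + (s^-1 * cst_)%:E * \int[leb1]_(r in `]0%R, +oo[) (D r ^+ 2 / r ^+ n.-1)%:E)%E.
Proof.
move=> a0 sD Da Db s0; have n0 : (0 < n)%N by exact: ltnW.
pose phi i := @radial_field R n D i.
have tphi i : test_function (phi i) := test_radial_field a0 sD Da Db i.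
have lg i := (sobolevR_loc i sG).1; have lG i := (sobolevR_loc i sG).2.
have I1 i : leb.-integrable setT (fun v => (g v * partial i (phi i) v)%:E).
  exact: loc_integrable_test (lg i) (test_partial i (tphi i)).
have I2 i : leb.-integrable setT (fun v => (G i v * phi i v)%:E).
  exact: loc_integrable_test (lG i) (tphi i).
have [[mg _] [mG iG] wG] := sG.
have mD : measurable_fun setT D by apply: continuous_measurable_fun; exact: smooth1_continuous.
have mD' : measurable_fun setT (derive1 D).
  by apply: continuous_measurable_fun; apply: smooth1_continuous; exact: derive1_smooth1.
have mkD : measurable_fun setT (fun r => k r * derive1 D r) by exact: measurable_funM.
pose f v := \sum_i g v * partial i (phi i) v.
have iF : leb.-integrable setT (EFin \o f).
  rewrite (_ : EFin \o f = fun v => (\sum_i (g v * partial i (phi i) v)%:E)%E).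
    by apply: integrable_sum => // i _; exact: I1.
  by apply/funext => v; rewrite /f /= sumEFin.
have fE : {ae leb, forall v, f v = k (enorm v) * derive1 D (enorm v) * (enorm v ^+ n.-1)^-1}.
  move: gk; apply: filterS => v E.
  by rewrite /f -mulr_sumr (div_radial_field n0 a0 sD Da) E mulrA.
have mfE : measurable_fun setT (fun v => (k (enorm v) * derive1 D (enorm v) * (enorm v ^+ n.-1)^-1)%:E).
  apply/measurable_EFinP; apply: measurable_funM; last exact: measurable_inv_enormX.
  exact: (measurableT_comp mkD measurable_enorm).
have mf := measurable_int _ iF.
(* Integrability of k D' is read backwards from the polar formula, since [f] is a finite sum of
   products of [g] with test functions. *)
have iK : leb1.-integrable `]0, +oo[%classic (EFin \o (fun r => k r * derive1 D r)).
  apply/integrableP; split; first exact/measurable_EFinP/measurable_funTS.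
  have mabs : measurable_fun setT (fun r => `|k r * derive1 D r|%:E : \bar R).
    by apply/measurable_EFinP; exact: measurableT_comp.
  have := polar_formula n1 mabs (fun r => _); move=> /(_ _)/wrap[r|P]; first by rewrite lee_fin.
  have : (cst_%:E * \int[leb1]_(r in `]0%R, +oo[) `|k r * derive1 D r|%:E < +oo)%E.
    rewrite -P; have /integrableP[_] := iF; apply: le_lt_trans.
    rewrite le_eqVlt; apply/orP; left; apply/eqP; apply: ge0_ae_eq_integral => //.
    - apply: emeasurable_funM; first exact: (measurableT_comp mabs measurable_enorm).
      by apply/measurable_EFinP; exact: measurable_inv_enormX.
    - exact: measurableT_comp.
    - by move=> v _; rewrite -EFinM lee_fin mulr_ge0// invr_ge0 exprn_ge0// enorm_ge0.
    - move: fE; apply: filterS => v E _ /=; rewrite E -EFinM [in RHS]normrM [`|_^-1|]ger0_norm//.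
      by rewrite invr_ge0 exprn_ge0// enorm_ge0.
  have c0 : 0 < cst_ := polar_cst_gt0 n1.
  set J := (\int[_]_(r in _) _)%E; have J0 : (0 <= J)%E by exact: integral_ge0.
  by rewrite !ltey; apply: contra_neq => ->; rewrite gt0_muley ?lte_fin.
have EQ : cst_ * \int[leb1]_(r in `]0, +oo[) (k r * derive1 D r) =
    - \int[leb]_v (\sum_i G i v * phi i v).
  rewrite -(polar_Rintegral mkD iK) Rintegral_sum// -sumrN.
  under [RHS]eq_bigr do rewrite -wG//.
  rewrite -Rintegral_sum//; congr fine; apply: ae_eq_integral => //.
  by move: fE; apply: filterS => v E _; rewrite -/(f v) E.
have iS : leb.-integrable setT (EFin \o (fun v => \sum_i G i v * phi i v)).
  rewrite (_ : EFin \o _ = fun v => (\sum_i (G i v * phi i v)%:E)%E).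
    by apply: integrable_sum => // i _; exact: I2.
  by apply/funext => v; rewrite /= sumEFin.
have -> : cst_ * `|\int[leb1]_(r in `]0, +oo[) (k r * derive1 D r)| =
    `|\int[leb]_v (\sum_i G i v * phi i v)|.
  by rewrite -[in RHS]normrN -EQ normrM (ger0_norm (ltW (polar_cst_gt0 n1))).
rewrite EFinM EFin_normr_Rintegral//.
apply: le_trans (lee_wpmul2l _ (le_abse_integral _ _ _)) _ => //; first exact: measurable_int iS.
have mgipw : measurable_fun setT (fun v => gip v (G ^~ v) (G ^~ v) * w v).
  by apply: measurable_funM; [exact: measurable_gip|exact: measurable_volume_density].
(* The square of |v|^(1-n) D(|v|), with one factor |v|^(1-n) kept apart as the weight of the polar
   formula. *)
pose Q v := D (enorm v) ^+ 2 / enorm v ^+ n.-1 / enorm v ^+ n.-1.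
have mDn : measurable_fun setT (fun r => D r ^+ 2 / r ^+ n.-1).
  apply: measurable_funM; first exact: measurable_funX.
  by apply: measurable_inv_comp; exact: measurable_funX.
have Q0 v : 0 <= Q v.
  by rewrite divr_ge0 ?exprn_ge0 ?enorm_ge0//; apply: ge0_sqr_quot a0 Da.
have mQ : measurable_fun setT Q.
  apply: measurable_funM; last exact: measurable_inv_enormX.
  exact: (measurableT_comp mDn measurable_enorm).
have mabsS : measurable_fun setT (fun v => `|(\sum_i G i v * phi i v)%:E|%E).
  by apply: measurableT_comp => //; exact: measurable_int iS.
rewrite -ge0_integralZl//.
apply: (@le_trans _ _ (\int[leb]_v (s%:E * (gip v (G ^~ v) (G ^~ v) * w v)%:E + s^-1%:E * (Q v)%:E))%E).
  apply: ge0_le_integral => //.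
  - exact: emeasurable_funM.
  - apply/measurable_EFinP; apply: measurable_funD; apply: measurable_funM => //.
  - move=> v _; rewrite -!EFinM -EFinD lee_fin.
    have g0 : 0 <= gip v (G ^~ v) (G ^~ v) * w v.
      by rewrite mulr_ge0 ?gip_ge0// ltW// volume_density_gt0.
    apply: amgm_sqr => //.
    pose p := profile n D (nsq v).
    have -> : \sum_i G i v * phi i v = (\sum_i v 0 i * G i v) * p.
      by rewrite mulr_suml; apply: eq_bigr => i _; rewrite /phi /radial_field -/p; ring.
    rewrite exprMn; apply: le_trans (ler_wpM2r (sqr_ge0 _) (sqr_dot_le v (G ^~ v))) _.
    rewrite -[leLHS]mulrA ler_wpM2l// /p /profile -/(enorm v).
    have nE : nsq v = enorm v ^+ 2 by rewrite sqr_sqrtr// nsq_ge0.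
    rewrite nE /Q; have [v0|v0] := eqVneq (enorm v) 0.
      by rewrite v0 (Da 0 (ltW a0)) mulr0 [0 ^+ 2]expr0n/= !mul0r.
    have -> : enorm v ^+ n = enorm v * enorm v ^+ n.-1 by rewrite -exprS prednK.
    rewrite le_eqVlt; apply/orP; left; apply/eqP; field.
    by rewrite expf_neq0// v0.
have D0 : (\int[leb]_v (gip v (G ^~ v) (G ^~ v) * w v)%:E = Dir%:E)%E.
  have mgip : measurable_fun setT (fun v => gip v (G ^~ v) (G ^~ v)) by exact: measurable_gip.
  rewrite -integral_hyp// /Dir /Rintegral fineK// ge0_fin_numE//.
  by apply: integral_ge0 => v _; rewrite lee_fin gip_ge0.
rewrite ge0_integralD//; last 4 first.
- by move=> v _; rewrite -EFinM lee_fin mulr_ge0 ?(ltW s0)// mulr_ge0 ?gip_ge0// ltW// volume_density_gt0.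
- by apply/measurable_EFinP; exact: measurable_funM.
- by move=> v _; rewrite -EFinM lee_fin mulr_ge0 ?invr_ge0 ?(ltW s0).
- by apply/measurable_EFinP; exact: measurable_funM.
rewrite !ge0_integralZl//; last 6 first.
- exact/measurable_EFinP.
- by move=> v _; rewrite lee_fin.
- by rewrite lee_fin invr_ge0 ltW.
- exact/measurable_EFinP.
- by move=> v _; rewrite lee_fin mulr_ge0 ?gip_ge0// ltW// volume_density_gt0.
- by rewrite lee_fin ltW.
rewrite D0 -EFinM (EFinM s^-1) -muleA -polar_formula//.
- exact/measurable_EFinP.
- by move=> r; rewrite lee_fin; apply: ge0_sqr_quot a0 Da.
Qed.

Lemma cutoff_bound (x y e : R) : (2 < n)%N -> 0 < x -> x < y -> 0 < e ->
  cst_ * (\int[leb1]_(r in `]0%R, +oo[) (k r * (moll e (r - x) - moll e (r - y)))) ^+ 2 <=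
  Dir * (x ^+ n.-2)^-1.
Proof.
move=> n2 x0 xy e0; have xy' := ltW xy; pose D := cutoff x y e.
have sD : smooth1 D by exact: smooth1_cutoff.
have Da t : t <= x -> D t = 0 by exact: cutoff_lt.
have Db t : y + e <= t -> D t = 0 by exact: cutoff_gt.
have D'E r : derive1 D r = moll e (r - x) - moll e (r - y).
  have d := @is_derive_cutoff R x y e r (lt0r_neq0 e0).
  by rewrite derive1E (@derive_val _ _ _ _ _ _ _ d).
have c0 : 0 < cst_ := polar_cst_gt0 n1.
have Dir0 : 0 <= Dir by apply: Rintegral_ge0 => v _; exact: gip_ge0.
set I := \int[leb1]_(r in _) _.
have IE : I = \int[leb1]_(r in `]0, +oo[) (k r * derive1 D r).
  by apply: eq_Rintegral => r _; rewrite D'E.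
have xn0 : 0 < (x ^+ n.-2)^-1 by rewrite invr_gt0 exprn_gt0.
have J : (\int[leb1]_(r in `]0%R, +oo[) (D r ^+ 2 / r ^+ n.-1)%:E <= ((x ^+ n.-2)^-1)%:E)%E.
  have xye : x < y + e by rewrite (lt_trans xy)// ltrDl.
  have mDn : measurable_fun setT (fun r => D r ^+ 2 / r ^+ n.-1).
    apply: measurable_funM.
      by apply: measurable_funX; apply: continuous_measurable_fun; exact: smooth1_continuous.
    by apply: measurable_inv_comp; exact: measurable_funX.
  have mr2 : measurable_fun setT (fun r : R => (r ^+ 2)^-1).
    by apply: measurable_inv_comp; exact: measurable_funX.
  (* On r >= x, r^(1-n) = r^(3-n) r^(-2) <= x^(3-n) r^(-2), so the primitive of r^(-2) suffices in
     every dimension n >= 3 and yields x^(2-n). *)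
  apply: (@le_trans _ _ (\int[leb1]_(r in `[x, (y + e)%R]) ((x ^+ (n - 3))^-1%:E * ((r ^+ 2)^-1)%:E))%E).
    rewrite integral_mkcond [leRHS]integral_mkcond; apply: ge0_le_integral => //.
    - move=> r _; rewrite patchE; case: ifPn => // _; rewrite lee_fin.
      exact: ge0_sqr_quot x0 Da.
    - apply/(measurable_restrictT _ (measurable_itv _)).
      by apply: measurable_funTS; exact/measurable_EFinP.
    - apply/(measurable_restrictT _ (measurable_itv _)).
      by apply: measurable_funTS; apply: emeasurable_funM => //; exact/measurable_EFinP.
    - move=> r _; rewrite !patchE mem_setE in_itv/= andbT mem_setE in_itv/=.
      have [xr|rx] := leP x r; last first.
        case: ifPn => _; last exact: lexx.
        by rewrite (Da r (ltW rx)) expr0n/= mul0r; exact: lexx.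
      have r0 : 0 < r by exact: lt_le_trans xr.
      rewrite r0/=; case: ifPn => [_|]; last first.
        rewrite -ltNge => ryx; rewrite (Db r (ltW ryx)) expr0n/= mul0r; exact: lexx.
      rewrite -EFinM lee_fin -invfM.
      have -> : r ^+ n.-1 = r ^+ (n - 3) * r ^+ 2.
        by rewrite -exprD; congr (_ ^+ _); rewrite -{1}(subnK n2) addnS.
      rewrite -[leRHS]mul1r ler_pM ?sqr_ge0 ?invr_ge0 ?mulr_ge0 ?exprn_ge0 ?(ltW r0)//.
        by rewrite expr_le1// ?cutoff_le1// cutoff_ge0.
      rewrite lef_pV2 ?posrE ?mulr_gt0 ?exprn_gt0// ler_pM2r ?exprn_gt0//.
      by rewrite lerXn2r ?nnegrE ?(ltW x0) ?(ltW r0).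
  rewrite ge0_integralZl//; last 3 first.
  - by apply: measurable_funTS; exact/measurable_EFinP.
  - by move=> r _; rewrite lee_fin invr_ge0 sqr_ge0.
  - by rewrite lee_fin invr_ge0 exprn_ge0// ltW.
  apply: le_trans (lee_wpmul2l _ (integral_inv_sqr_le x0 xye)) _.
    by rewrite lee_fin invr_ge0 exprn_ge0// ltW.
  rewrite -EFinM lee_fin -invfM -exprSr.
  by rewrite -(subSn n2) subSS subn2.
have H s : 0 < s -> 2 * (cst_ * `|I|) <= s * Dir + s^-1 * (cst_ * (x ^+ n.-2)^-1).
  move=> s0; rewrite IE -lee_fin; apply: le_trans (radial_test_bound x0 sD Da Db s0) _.
  have -> : (s * Dir + s^-1 * (cst_ / x ^+ n.-2))%:E =
      ((s * Dir)%:E + (s^-1 * cst_)%:E * ((x ^+ n.-2)^-1)%:E)%E.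
    by rewrite -EFinM -EFinD mulrA.
  rewrite leeD2l// lee_wpmul2l//.
  by rewrite lee_fin mulr_ge0 ?invr_ge0// ltW.
have cx0 : 0 < cst_ * (x ^+ n.-2)^-1 by rewrite mulr_gt0.
have := amgm_sqr_inv Dir0 cx0 H; rewrite mulr_ge0 ?(ltW c0)// => /(_ isT).
rewrite exprMn real_normK ?num_real//.
have -> : cst_ ^+ 2 * I ^+ 2 = cst_ * (cst_ * I ^+ 2) by rewrite mulrA -expr2.
by rewrite [Dir * _]mulrCA (ler_pM2l c0).
Qed.

(** On a <= |v| <= b the polar weight is at most a^(1-n), and g is integrable on the cube that
    contains this shell. *)
Lemma integrable_radial_part (a b : R) : 0 < a ->
  leb1.-integrable setT (EFin \o (k \_ `[a, b])).
Proof.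
move=> a0; have [mg ig] := sq_integrable_loc (let: And3 h _ _ := sG in h).
have mka : measurable_fun setT (k \_ `[a, b]).
  by apply/(measurable_restrictT _ (measurable_itv _)); exact: measurable_funTS.
pose q (r : R) : \bar R := `|(k \_ `[a, b]) r|%:E.
have mq : measurable_fun setT q by apply/measurable_EFinP; exact: measurableT_comp.
have q0 r : (0 <= q r)%E by rewrite lee_fin.
apply/integrableP; split; first exact/measurable_EFinP.
have -> : (\int[leb1]_r `|(EFin \o k \_ `[a, b]) r| = \int[leb1]_(r in `]0%R, +oo[) q r)%E.
  rewrite [RHS]integral_mkcond; apply: eq_integral => r _.
  rewrite /q [RHS]patchE; case: ifPn => //; rewrite mem_setE in_itv/= andbT -leNgt => r0.
  rewrite patchE ifN ?normr0// mem_setE in_itv/= negb_and -ltNge.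
  by rewrite (le_lt_trans r0).
have c0 : 0 < cst_ := polar_cst_gt0 n1.
rewrite !ltey; apply: contra_neq (_ : (cst_%:E * \int[leb1]_(r in `]0%R, +oo[) q r != +oo)%E) => [->|].
  by rewrite gt0_muley ?lte_fin.
rewrite -polar_formula// -ltey.
have an0 : 0 < (a ^+ n.-1)^-1 by rewrite invr_gt0 exprn_gt0.
pose f v : \bar R := ((a ^+ n.-1)^-1%:E * (`|(g \_ (cube n b)) v|)%:E)%E.
have mcube : measurable (cube n b) := measurable_cube b.
have mgb : measurable_fun setT (fun v => `|(g \_ (cube n b)) v|).
  apply: measurableT_comp => //; apply/(measurable_restrictT _ mcube).
  exact: measurable_funTS.
apply: (@le_lt_trans _ _ (\int[leb]_v f v)%E).
  have mkE : measurable_fun setT (fun v => q (enorm v) * ((enorm v ^+ n.-1)^-1)%:E)%E.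
    apply: emeasurable_funM; first exact: (measurableT_comp mq measurable_enorm).
    by apply/measurable_EFinP; exact: measurable_inv_enormX.
  pose f' v : \bar R := (`|(g v) * \1_(`[a, b]%classic) (enorm v)|%:E * ((enorm v ^+ n.-1)^-1)%:E)%E.
  have mf' : measurable_fun setT f'.
    apply: emeasurable_funM; last by apply/measurable_EFinP; exact: measurable_inv_enormX.
    apply/measurable_EFinP; apply: measurableT_comp => //; apply: measurable_funM => //.
    by apply: (measurable_indic_comp (measurable_itv `[a, b])); exact: measurable_enorm.
  have inv0 v : 0 <= (enorm v ^+ n.-1)^-1 by rewrite invr_ge0 exprn_ge0// enorm_ge0.
  rewrite (_ : (\int[leb]_v _)%E = (\int[leb]_v f' v)%E); last first.
    apply: ge0_ae_eq_integral => //.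
    - by move=> v _; rewrite mule_ge0// lee_fin.
    - by move=> v _; rewrite mule_ge0// lee_fin.
    - move: gk; apply: filterS => v E _; rewrite /f' /q E; congr (_ * _)%E.
      by rewrite patchE indicE; case: ifPn => _; rewrite ?mulr1 ?mulr0.
  apply: ge0_le_integral => //.
  - by move=> v _; rewrite mule_ge0// lee_fin.
  - by apply: emeasurable_funM => //; exact/measurable_EFinP.
  - move=> v _; rewrite /f' /f -!EFinM lee_fin indicE mem_setE in_itv/=.
    case: (boolP (a <= enorm v <= b)) => [/andP[av vb]|_]; last first.
      by rewrite mulr0 normr0 mul0r mulr_ge0// ltW.
    rewrite mulr1 patchE mem_set; last first.
      by move=> i; rewrite /= in_itv/= -ler_norml (le_trans (coord_le_enorm v i)).
    rewrite mulrC ler_wpM2r// lef_pV2 ?posrE ?exprn_gt0// ?(lt_le_trans a0)//.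
    by rewrite lerXn2r ?nnegrE ?enorm_ge0// ltW.
rewrite ge0_integralZl//; last 2 first.
- exact/measurable_EFinP.
- by rewrite lee_fin ltW.
apply: lte_mul_pinfty; rewrite ?lee_fin ?ltW//.
have /integrableP[_] := ig b; apply: le_lt_trans.
rewrite [leRHS]integral_mkcond le_eqVlt; apply/orP; left; apply/eqP; apply: eq_integral => v _.
by rewrite !patchE; case: ifPn => //=; rewrite normr0.
Qed.

(** Let the ramp width in [cutoff_bound] tend to 0: the integrals against the two kernels tend to k
    x and k y at Lebesgue points. Since k need not be integrable near 0 or infinity, Lebesgue points
    are taken for countably many truncations to [1/(m+1), m+1]. *)
Lemma radial_oscillation : (2 < n)%N ->
  exists2 P : R -> Prop, {ae leb1, forall r, P r} &
    forall x y, P x -> P y -> 0 < x -> x < y ->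
      cst_ * (k x - k y) ^+ 2 <= Dir * (x ^+ n.-2)^-1.
Proof.
move=> n2; pose kk m := k \_ `[m.+1%:R^-1, m.+1%:R].
have ikk m : leb1.-integrable setT (EFin \o kk m).
  by apply: integrable_radial_part; rewrite invr_gt0.
exists (fun r => forall m, lebesgue_pt (kk m) r).
  apply: ae_foralln => m; apply: lebesgue_differentiation.
  by apply: open_integrable_locally => //; exact: openT.
move=> x y Px Py x0 xy; have y0 : 0 < y := lt_trans x0 xy.
(* The interval [1/(m+1), m+1] then contains x and y, and also the ramps to their right when e <
   1. *)
pose m := Num.truncn (Num.max x^-1 (y + 1)).
have : Num.max x^-1 (y + 1) < m.+1%:R by exact: truncnS_gt.
rewrite gt_max => /andP[xm ym].
have mx : m.+1%:R^-1 < x by rewrite invf_plt ?posrE.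
have kkE r : m.+1%:R^-1 <= r <= m.+1%:R -> kk m r = k r.
  by move=> rm; rewrite /kk patchE mem_set//= in_itv.
have mc z : lebesgue_pt (kk m) z ->
    \int[leb1]_r (kk m r * moll e (r - z)) @[e --> 0^'+] --> kk m z.
  move=> Lz; apply/cvgrPdist_le => eta eta0; have := moll_near (ikk m) Lz eta0.
  by apply: filterS => e; rewrite distrC.
pose Dl e := \int[leb1]_r (kk m r * moll e (r - x)) - \int[leb1]_r (kk m r * moll e (r - y)).
have cv : Dl e @[e --> 0^'+] --> kk m x - kk m y.
  by apply: cvgB; [exact: mc (Px m)|exact: mc (Py m)].
have ym' : y <= m.+1%:R by rewrite ltW// (lt_trans _ ym)// ltrDl.
rewrite !kkE in cv; last 2 first.
- by rewrite (ltW (lt_trans mx xy)).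
- by rewrite (ltW mx)/= (le_trans (ltW xy)).
have cv2 : cst_ * (Dl e * Dl e) @[e --> 0^'+] --> cst_ * ((k x - k y) * (k x - k y)).
  by apply: cvgM; [exact: cvg_cst|exact: cvgM].
rewrite expr2; apply: (cvgr_to_le cv2); near=> e.
have e0 : 0 < e by near: e; exact: nbhs_right_gt.
have e1 : e < 1 by near: e; exact: nbhs_right_lt.
rewrite -expr2; apply: le_trans (cutoff_bound n2 x0 xy e0).
apply: ler_wpM2l; first exact/ltW/polar_cst_gt0.
rewrite le_eqVlt; apply/orP; left; apply/eqP.
congr (_ ^+ 2); transitivity (\int[leb1]_r (kk m r * moll e (r - x) - kk m r * moll e (r - y))).
  by rewrite RintegralB//; exact: integrable_mul_moll.
rewrite [RHS]Rintegral_mkcond; apply: eq_Rintegral => r _; rewrite patchE mem_setE in_itv/= andbT.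
have [xr|rx] := leP r x.
  rewrite !moll_le0 ?subr_le0// ?(le_trans xr) ?(ltW xy)// !mulr0 subrr mulr0.
  by case: ifPn.
have [ry|ry] := leP (y + e) r.
  have ey : e <= r - y by rewrite lerBrDl.
  have ex : e <= r - x by rewrite (le_trans ey)// lerD2l lerN2 ltW.
  by rewrite (moll_ge e0 ey) (moll_ge e0 ex) !mulr0 subrr mulr0; case: ifPn.
rewrite (lt_trans x0 rx) kkE ?mulrBr//.
by rewrite (ltW (lt_trans mx rx))/= (le_trans (ltW ry))// (le_trans _ (ltW ym))// lerD2l ltW.
Unshelve. all: by end_near. Qed.

End oscillation.

(** * A radial Gagliardo-Nirenberg inequality *)

Section power_integral.
Context {R : realType}.
Local Notation leb1 := (@lebesgue_measure R).

Lemma continuous_powR_gt0 (a x : R) : 0 < x -> {for x, continuous (fun r : R => r `^ a)}.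
Proof.
move=> x0; have [d _] := is_derive1_powR a x0.
by apply/differentiable_continuous/derivable1_diffP.
Qed.

(** For a < 0 the integrand is singular at 0, so the primitive is used on [d/(k+2), d] and k tends
    to infinity; the shift by 2 makes the left end smaller than d from k = 0 on. *)
Lemma integral_powR_le (a d : R) : -1 < a -> 0 < d ->
  (\int[leb1]_(r in `]0%R, d[) (r `^ a)%:E <= (d `^ (a + 1) / (a + 1))%:E)%E.
Proof.
move=> a1 d0; have a10 : 0 < a + 1 by rewrite -ltrBlDr sub0r.
pose F (k : nat) := `[d / k.+2%:R, d]%classic : set R.
pose P (r : R) := (a + 1)^-1 * r `^ (a + 1).
have mp : measurable_fun [set: R] (fun r : R => (r `^ a)%:E : \bar R).
  by apply/measurable_EFinP; exact: measurable_powR.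
have dk k : 0 < d / k.+2%:R by rewrite divr_gt0.
have dP (r : R) : 0 < r -> is_derive r 1 P (r `^ a).
  move=> r0; have -> : P = ((a + 1)^-1 \*: (fun r : R => r `^ (a + 1))).
    by apply/funext.
  have := is_derive1_powR (a + 1) r0 => ?.
  apply: is_derive_eq; rewrite /GRing.scale/= addrK mulrA mulVf ?mul1r// gt_eqF//.
have IF k : (\int[leb1]_(r in F k) (r `^ a)%:E <= (d `^ (a + 1) / (a + 1))%:E)%E.
  have lt : d / k.+2%:R < d by rewrite ltr_pdivrMr// ltr_pMr// ltr1n.
  rewrite (@continuous_FTC2 _ _ P)//.
  - rewrite -EFinB lee_fin /P mulrC gerDl oppr_le0.
    by rewrite mulr_ge0 ?powR_ge0// invr_ge0 ltW.
  - apply: continuous_in_subspaceT => r; rewrite inE/= in_itv/= => /andP[dr _].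
    by apply: continuous_powR_gt0; exact: lt_le_trans dr.
  - split.
    + move=> r; rewrite in_itv/= => /andP[dr _].
      by have [] := dP r (lt_trans (dk k) dr).
    + apply: cvg_at_right_filter; have [h _] := dP _ (dk k).
      exact/differentiable_continuous/derivable1_diffP.
    + apply: cvg_at_left_filter; have [h _] := dP _ d0.
      exact/differentiable_continuous/derivable1_diffP.
  - move=> r; rewrite in_itv/= => /andP[dr _]; rewrite derive1E.
    by rewrite (@derive_val _ _ _ _ _ _ _ (dP r (lt_trans (dk k) dr))).
apply: (@le_trans _ _ (\int[leb1]_(r in \bigcup_k F k) (r `^ a)%:E)%E).
  apply: ge0_subset_integral => //.
  - by apply: bigcup_measurable => k _; exact: measurable_itv.
  - exact: measurable_funTS.
  - by move=> r _; rewrite lee_fin powR_ge0.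
  - move=> r /=; rewrite in_itv/= => /andP[r0 rd].
    have [k rk] : exists k, d / r < k.+2%:R.
      exists (Num.truncn (d / r)); apply: lt_trans (truncnS_gt _) _.
      by rewrite ltr_nat.
    exists k => //; rewrite /F /= in_itv/= (ltW rd) andbT ltW//.
    by rewrite ltr_pdivrMr// mulrC -ltr_pdivrMr.
have cv : (\int[leb1]_(r in F i) (r `^ a)%:E)%E @[i --> \oo] -->
    (\int[leb1]_(r in \bigcup_k F k) (r `^ a)%:E)%E.
  apply: ge0_nondecreasing_set_cvg_integral => //.
  - move=> i j ij; apply/subsetPset => r; rewrite /F /= !in_itv/= => /andP[ir ->].
    rewrite andbT (le_trans _ ir)// ler_pM2l// lef_pV2 ?posrE ?ltr0n// ler_nat.
    by rewrite ltnS ltnS.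
  - by move=> i; exact: measurable_itv.
  - by move=> i; exact: measurable_funTS.
  - by move=> i r _; rewrite lee_fin powR_ge0.
rewrite -(cvg_lim (@ereal_hausdorff R) cv); apply: lime_le.
  by apply/cvg_ex; eexists; exact: cv.
by apply: nearW => k; exact: IF.
Qed.

End power_integral.

Section gagliardo_nirenberg.
Context {R : realType} {n : nat}.
Local Notation rV := 'rV[R]_n.
Local Notation leb1 := (@lebesgue_measure R).
Local Notation leb := (lebesgue_row R n).
Local Notation mu := (@hyp_measure R n).
Local Notation w := (@volume_density R n).
Local Notation cst_ := (@polar_cst R n).
Hypothesis n2 : (2 < n)%N.

Let n1 : (1 < n)%N. Proof. exact: ltnW. Qed.

Let c0 : 0 < cst_. Proof. exact: polar_cst_gt0. Qed.

Section pointwise.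
Variables (g : rV -> R) (G : 'I_n -> rV -> R) (k : R -> R) (delta : R).
Hypotheses (sG : sobolevR g G) (mk : measurable_fun setT k)
  (gk : {ae leb, forall v, g v = k (enorm v)}) (d01 : 0 < delta <= 1).

Let Dir : R := \int[mu]_v gip v (G ^~ v) (G ^~ v).
Let M : R := \int[mu]_v (g v ^+ 2).

Let d0 : 0 < delta. Proof. by case/andP: d01. Qed.

Let Dir0 : 0 <= Dir. Proof. by apply: Rintegral_ge0 => v _; exact: gip_ge0. Qed.
Let M0 : 0 <= M. Proof. by apply: Rintegral_ge0 => v _; exact: sqr_ge0. Qed.

Lemma mass_density : (\int[leb]_v (g v ^+ 2 * w v)%:E = M%:E)%E.
Proof.
have [[mg ig] _ _] := sG.
rewrite -integral_hyp; last exact: measurable_funX.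
rewrite /M /Rintegral fineK// ge0_fin_numE//.
by apply: integral_ge0 => v _; rewrite lee_fin sqr_ge0.
Qed.

(** For delta <= 1 both 1 and |v| are at most (|v|/delta)^(n-1), and height <= 1 + |v|. Away from
    the origin the hyperbolic density thus controls the polar weight, at the price delta^(1-n). *)
Lemma height_le_shell v : delta <= enorm v ->
  (enorm v ^+ n.-1)^-1 <= 2 * (delta ^+ n.-1)^-1 * w v.
Proof.
move=> dv; have v0 : 0 < enorm v by exact: lt_le_trans dv.
have h0 : 0 < height v by exact: height_gt0.
rewrite volume_densityE ler_pdivlMr// mulrC ler_pdivrMr ?exprn_gt0//.
rewrite -mulrA [X in _ * X]mulrC -expr_div_n.
have x1 : 1 <= enorm v / delta by rewrite ler_pdivlMr// mul1r.
have xn : enorm v / delta <= (enorm v / delta) ^+ n.-1.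
  by rewrite ler_eXnr// -ltnS prednK// ltnW.
have vx : enorm v <= enorm v / delta.
  by rewrite ler_peMr ?(ltW v0)// invf_ge1//; case/andP: d01.
apply: (@le_trans _ _ (1 + enorm v)).
  rewrite -[leRHS]ger0_norm ?addr_ge0 ?(ltW v0)// -sqrtr_sqr /height.
  rewrite ler_sqrt ?sqr_ge0// sqrrD expr1n mul1r -/(nsq v).
  have -> : enorm v ^+ 2 = nsq v by rewrite sqr_sqrtr// nsq_ge0.
  by rewrite addrAC lerDl mulrn_wge0// ltW.
rewrite mulr2n mulrDl mul1r lerD//; last exact: le_trans vx xn.
exact: le_trans x1 xn.
Qed.

Lemma shell_mass (rho : R) : delta <= rho ->
  (\int[leb1]_(r in `]rho, (rho + delta)%R[) (k r ^+ 2)%:E <=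
   (2 / cst_ * (delta ^+ n.-1)^-1 * M)%:E)%E.
Proof.
move=> drho; have rho0 : 0 < rho by exact: lt_le_trans drho.
have [[mg ig] _ _] := sG.
pose S := `]rho, (rho + delta)[%classic : set R.
pose q (r : R) : \bar R := (k r ^+ 2 * \1_S r)%:E.
have mq : measurable_fun setT q.
  apply/measurable_EFinP; apply: measurable_funM; first exact: measurable_funX.
  by apply: measurable_indic; exact: measurable_itv.
have q0 r : (0 <= q r)%E by rewrite lee_fin mulr_ge0// sqr_ge0.
have -> : (\int[leb1]_(r in S) (k r ^+ 2)%:E = \int[leb1]_(r in `]0%R, +oo[) q r)%E.
  rewrite integral_mkcond [RHS]integral_mkcond; apply: eq_integral => r _.
  rewrite !patchE /q indicE; case: (boolP (r \in S)) => [|_]; last first.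
    by rewrite mulr0 if_same.
  rewrite mem_setE in_itv/= => /andP[rr _].
  by rewrite mem_setE in_itv/= (lt_trans rho0 rr) mulr1.
suff : (cst_%:E * \int[leb1]_(r in `]0%R, +oo[) q r <= (2 * (delta ^+ n.-1)^-1 * M)%:E)%E.
  rewrite muleC -lee_pdivlMr// => h; apply: le_trans h _.
  rewrite -EFinM lee_fin le_eqVlt; apply/orP; left; apply/eqP; ring.
rewrite -polar_formula// [leRHS]EFinM -mass_density.
have mgw : measurable_fun setT (fun v => (g v ^+ 2 * w v)%:E : \bar R).
  by apply/measurable_EFinP; apply: measurable_funM; [exact: measurable_funX|exact: measurable_volume_density].
have gw0 v : (0 <= (g v ^+ 2 * w v)%:E)%E.
  by rewrite lee_fin mulr_ge0 ?sqr_ge0// ltW// volume_density_gt0.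
rewrite -ge0_integralZl//; last by rewrite lee_fin mulr_ge0// invr_ge0 exprn_ge0// ltW.
apply: ae_ge0_le_integral => //.
- by move=> v _; rewrite mule_ge0// lee_fin invr_ge0 exprn_ge0// enorm_ge0.
- apply: emeasurable_funM; first exact: (measurableT_comp mq measurable_enorm).
  by apply/measurable_EFinP; exact: measurable_inv_enormX.
- by move=> v _; rewrite mule_ge0// lee_fin mulr_ge0// invr_ge0 exprn_ge0// ltW.
- exact: emeasurable_funM.
move: gk; apply: filterS => v E _; rewrite /q -E indicE -!EFinM lee_fin.
case: (boolP (enorm v \in S)) => [|_]; last first.
  have i0 : 0 <= (delta ^+ n.-1)^-1 by rewrite invr_ge0 exprn_ge0// ltW.
  have w0 := ltW (volume_density_gt0 v).
  by rewrite mulr0 mul0r; apply: mulr_ge0; [exact: mulr_ge0|apply: mulr_ge0 => //; exact: sqr_ge0].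
rewrite mem_setE in_itv/= => /andP[rr _]; rewrite mulr1 [leRHS]mulrCA ler_wpM2l ?sqr_ge0//.
by apply: height_le_shell; rewrite (le_trans drho)// ltW.
Qed.

(** The inequality k(x)^2 <= 2 k(r)^2 + 2 (k(x) - k(r))^2 is averaged over r in an interval of
    length delta: the first term is controlled by [shell_mass], the second by the oscillation
    estimate. *)
Lemma radial_pointwise : {ae leb, forall v, g v ^+ 2 <=
  4 / cst_ * (Dir + M / delta ^+ 2) * (Num.min (enorm v) delta ^+ n.-2)^-1}.
Proof.
have [P aeP HP] := radial_oscillation n1 sG mk gk n2.
set B := 4 / cst_ * (Dir + M / delta ^+ 2).
suff H x : P x -> 0 < x -> k x ^+ 2 <= B * (Num.min x delta ^+ n.-2)^-1.
  have aeH : {ae leb1, forall r, 0 < r -> k r ^+ 2 <= B * (Num.min r delta ^+ n.-2)^-1}.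
    by move: aeP; apply: filterS => r Pr; exact: H.
  by move: (ae_enorm n1 aeH) gk; apply: filterS2 => v h ->.
(* The averaging interval must lie to the right of x for the oscillation estimate, and beyond delta
   for [shell_mass]. *)
move=> Px x0; pose rho := Num.max x delta.
have drho : delta <= rho by rewrite /rho le_max lexx orbT.
have xrho : x <= rho by rewrite /rho le_max lexx.
have cx0 : 0 <= 2 / cst_ * (Dir * (x ^+ n.-2)^-1).
  apply: mulr_ge0; first by rewrite divr_ge0// ltW.
  by rewrite divr_ge0// exprn_ge0// ltW.
pose S := `]rho, (rho + delta)[%classic : set R.
have mS : measurable S by exact: measurable_itv.
have lS : leb1 S = delta%:E.
  by rewrite lebesgue_measure_itv/= lte_fin ltrDl d0 -EFinB [rho + _]addrC addrK.
have ic (c : R) : (\int[leb1]_(r in S) (cst c%:E r) = (c * delta)%:E)%E.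
  by transitivity (c%:E * leb1 S)%E; [exact: integral_cst|rewrite lS EFinM].
have I : (\int[leb1]_(r in S) (cst (k x ^+ 2)%:E r) <=
    \int[leb1]_(r in S) (2%:E * (k r ^+ 2)%:E + (2 / cst_ * (Dir * (x ^+ n.-2)^-1))%:E))%E.
  apply: ae_ge0_le_integral => //.
  - by move=> r _; rewrite lee_fin sqr_ge0.
  - move=> r _; rewrite adde_ge0// ?mule_ge0// lee_fin ?sqr_ge0//.
  - apply: emeasurable_funD => //; apply: measurable_funTS; apply: emeasurable_funM => //.
    by apply/measurable_EFinP; exact: measurable_funX.
  - move: aeP; apply: filterS => r Pr; rewrite /S /= in_itv/= => /andP[rr _].
    have := HP x r Px Pr x0 (le_lt_trans xrho rr); rewrite -/Dir => h.
    rewrite -EFinM -EFinD lee_fin.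
    apply: (@le_trans _ _ (2 * k r ^+ 2 + 2 * (k x - k r) ^+ 2)).
      rewrite -subr_ge0 (_ : _ - _ = (k x - 2 * k r) ^+ 2); first exact: sqr_ge0.
      ring.
    by rewrite lerD2l -mulrA ler_wpM2l// mulrC ler_pdivlMr// mulrC.
move: I; rewrite ic.
rewrite ge0_integralD//; last 2 first.
- by move=> r _; rewrite mule_ge0// lee_fin sqr_ge0.
- apply: measurable_funTS; apply: emeasurable_funM => //.
  by apply/measurable_EFinP; exact: measurable_funX.
rewrite ge0_integralZl//; last 2 first.
- by apply: measurable_funTS; apply/measurable_EFinP; exact: measurable_funX.
- by move=> r _; rewrite lee_fin sqr_ge0.
rewrite ic => I.
have two0 : (0 <= 2%:E :> \bar R)%E by rewrite lee_fin.
have := le_trans I (leeD2r _ (lee_wpmul2l two0 (shell_mass drho))).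
rewrite -!EFinM -EFinD lee_fin -ler_pdivlMr// => h.
apply: le_trans h _; set m := Num.min x delta.
have m0 : 0 < m by rewrite lt_min x0.
have mx : m <= x by rewrite ge_min lexx.
have md : m <= delta by rewrite ge_min lexx orbT.
have E : delta ^+ n.-1 * delta = delta ^+ 2 * delta ^+ n.-2.
  by rewrite -exprSr -exprD; congr (_ ^+ _); case: n n2 => [|[|[|?]]].
have -> : (2 * (2 / cst_ * (delta ^+ n.-1)^-1 * M) + 2 / cst_ * (Dir * (x ^+ n.-2)^-1) * delta) / delta =
    4 / cst_ * (M / delta ^+ 2) * (delta ^+ n.-2)^-1 + 2 / cst_ * Dir * (x ^+ n.-2)^-1.
  transitivity (4 / cst_ * M * (delta ^+ n.-1 * delta)^-1 + 2 / cst_ * Dir * (x ^+ n.-2)^-1).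
    by field; rewrite !gt_eqF ?exprn_gt0.
  by rewrite E; field; rewrite !gt_eqF ?exprn_gt0.
have im (y : R) : 0 < y -> m <= y -> (y ^+ n.-2)^-1 <= (m ^+ n.-2)^-1.
  move=> y0 my; rewrite lef_pV2 ?posrE ?exprn_gt0//.
  by rewrite lerXn2r ?nnegrE ?(ltW m0) ?(ltW y0).
have a4 : 0 <= 4 / cst_ by rewrite divr_ge0// ltW.
rewrite /B mulrDr mulrDl [leRHS]addrC; apply: lerD.
  apply: ler_pM => //; last exact: im.
    by rewrite mulr_ge0// divr_ge0// exprn_ge0// ltW.
  by rewrite invr_ge0 exprn_ge0// ltW.
apply: ler_pM; rewrite ?mulr_ge0 ?divr_ge0 ?invr_ge0 ?exprn_ge0 ?(ltW c0) ?(ltW x0)//; last exact: im.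
by rewrite ler_wpM2r// ler_wpM2r ?invr_ge0 ?(ltW c0)// ler_nat.
Qed.

End pointwise.

(** The pointwise bound r^(2-n) raised to the power q/2 has radial integrand r^(kappa - 1), so kappa
    > 0 is integrability at the origin, that is, q < 2n/(n - 2). *)
Let kappa (q : R) : R := n%:R - (n%:R - 2) * (q / 2).

Let powR_dim (x : R) : 0 < x -> (x ^+ n.-2)^-1 = x `^ (- (n%:R - 2)).
Proof.
move=> x0; rewrite powRN -powR_mulrn ?ltW//; congr (_ `^ _)^-1.
by rewrite -subn2 natrB// ltnW.
Qed.

Let powR_dim1 (x : R) : 0 < x -> (x ^+ n.-1)^-1 = x `^ (- (n%:R - 1)).
Proof.
move=> x0; rewrite powRN -powR_mulrn ?ltW//; congr (_ `^ _)^-1.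
by rewrite -subn1 natrB// ltnW// ltnW.
Qed.

Let powR_abs (x q : R) : `|x| `^ q = (x ^+ 2) `^ (q / 2).
Proof.
rewrite -[x ^+ 2]real_normK ?num_real// -powR_mulrn// -powRrM; congr (_ `^ _).
by rewrite mulrC divfK.
Qed.

Let gn_far (q B b d : R) : 2 < q -> 0 <= b -> b <= B * (d ^+ n.-2)^-1 ->
  b `^ (q / 2) <= (B * (d ^+ n.-2)^-1) `^ (q / 2 - 1) * b.
Proof.
move=> q2 b0 bB; have q1 : 0 < q / 2 - 1 by rewrite subr_gt0 ltr_pdivlMr// mul1r.
have q0 : q / 2 - 1 + 1 != 0 by rewrite subrK gt_eqF// divr_gt0// (lt_trans _ q2).
rewrite -[q / 2](subrK 1) powRD ?(negPf q0)// powRr1// subrK ler_wpM2r//.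
by apply: ge0_ler_powR; rewrite ?nnegrE ?(ltW q1)// (le_trans b0).
Qed.

Let gn_near (q B b r : R) : 2 < q -> 0 <= B -> 0 <= b -> 0 < r -> b <= B * (r ^+ n.-2)^-1 ->
  b `^ (q / 2) <= B `^ (q / 2) * (r `^ (kappa q - 1) * (r ^+ n.-1)^-1).
Proof.
move=> q2 B0 b0 r0 bB; have q0 : 0 <= q / 2 by rewrite divr_ge0// ltW// (lt_trans _ q2).
apply: (@le_trans _ _ ((B * (r ^+ n.-2)^-1) `^ (q / 2))).
  by apply: ge0_ler_powR; rewrite ?nnegrE// (le_trans b0).
rewrite powRM ?invr_ge0 ?exprn_ge0 ?(ltW r0)// powR_dim// -powRrM powR_dim1//.
rewrite -powRD; last by rewrite (gt_eqF r0) implybT.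
rewrite le_eqVlt; apply/orP; left; apply/eqP; congr (_ * _ `^ _).
rewrite /kappa; ring.
Qed.

(** The integral is split at |v| = delta. Outside, |g|^q is at most sup(g^2)^(q/2 - 1) g^2; inside,
    the pointwise bound is integrated. Both parts scale like delta^kappa, and the constant does not
    depend on delta. *)
Lemma gagliardo_nirenberg (q : R) : 2 < q -> 0 < n%:R - (n%:R - 2) * (q / 2) ->
  exists2 C : R, 0 < C & forall (g : rV -> R) G (h : R -> R) (delta : R),
    sobolevR g G -> {ae leb, forall v, g v = h (enorm v)} -> 0 < delta <= 1 ->
    (\int[mu]_v (`|g v| `^ q)%:E <=
     (C * (\int[mu]_v gip v (G ^~ v) (G ^~ v) + \int[mu]_v (g v ^+ 2) / delta ^+ 2) `^ (q / 2) *
      delta `^ (n%:R - (n%:R - 2) * (q / 2)))%:E)%E.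
Proof.
move=> q2; rewrite -/(kappa q) => ka0; have a40 : 0 < 4 / cst_ by rewrite divr_gt0.
exists ((4 / cst_) `^ (q / 2 - 1) + (4 / cst_) `^ (q / 2) * (cst_ / kappa q)).
  by rewrite addr_gt0 ?powR_gt0// mulr_gt0 ?powR_gt0// divr_gt0.
move=> g G h d sG gh d01; have d0 : 0 < d by case/andP: d01.
have [[mg ig] [mG iG] _] := sG.
have [k mk gk] := radial_representative n1 mg gh.
set Dir := \int[mu]_v gip _ _ _; set M := \int[mu]_v _.
have Dir0 : 0 <= Dir by apply: Rintegral_ge0 => v _; exact: gip_ge0.
have M0 : 0 <= M by apply: Rintegral_ge0 => v _; exact: sqr_ge0.
set T := Dir + M / d ^+ 2; have T0 : 0 <= T by rewrite addr_ge0// divr_ge0// sqr_ge0.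
pose B := 4 / cst_ * T; have B0 : 0 <= B by rewrite mulr_ge0// ltW.
have pw := radial_pointwise sG mk gk d01; rewrite -/Dir -/M -/T -/B in pw.
pose K1 := (B * (d ^+ n.-2)^-1) `^ (q / 2 - 1); pose K2 := B `^ (q / 2).
have K10 : 0 <= K1 by exact: powR_ge0.
have K20 : 0 <= K2 by exact: powR_ge0.
pose S := `]0, d[%classic : set R.
pose p (r : R) : \bar R := (r `^ (kappa q - 1) * \1_S r)%:E.
have mp : measurable_fun setT p.
  apply/measurable_EFinP; apply: measurable_funM; first exact: measurable_powR.
  by apply: measurable_indic; exact: measurable_itv.
have p0 r : (0 <= p r)%E by rewrite lee_fin mulr_ge0// powR_ge0.
have mgq : measurable_fun setT (fun v => `|g v| `^ q).
  by apply: measurable_powR_comp; exact: measurableT_comp.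
have mw := @measurable_volume_density R n.
have w0 v : 0 <= w v by rewrite ltW// volume_density_gt0.
have mgw : measurable_fun setT (fun v => (g v ^+ 2 * w v)%:E : \bar R).
  by apply/measurable_EFinP; apply: measurable_funM => //; exact: measurable_funX.
pose P (v : rV) : \bar R := (p (enorm v) * ((enorm v ^+ n.-1)^-1)%:E)%E.
have mP : measurable_fun setT P.
  apply: emeasurable_funM; first exact: (measurableT_comp mp measurable_enorm).
  by apply/measurable_EFinP; exact: measurable_inv_enormX.
have P0 v : (0 <= P v)%E by rewrite mule_ge0// lee_fin invr_ge0 exprn_ge0// enorm_ge0.
have mgqE : measurable_fun setT (fun v => (`|g v| `^ q)%:E : \bar R) by exact/measurable_EFinP.
have gq0 v : (0 <= (`|g v| `^ q)%:E :> \bar R)%E by rewrite lee_fin powR_ge0.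
rewrite (ge0_integral_hyp mgqE gq0).
have K1e : (0 <= K1%:E)%E by rewrite lee_fin.
have K2e : (0 <= K2%:E)%E by rewrite lee_fin.
have gw0 v : (0 <= (g v ^+ 2 * w v)%:E)%E by rewrite lee_fin mulr_ge0// sqr_ge0.
apply: (@le_trans _ _ (\int[leb]_v (K1%:E * (g v ^+ 2 * w v)%:E + K2%:E * P v))%E).
  apply: ae_ge0_le_integral => //.
  - by move=> v _; rewrite -EFinM lee_fin mulr_ge0 ?powR_ge0.
  - by apply/measurable_EFinP; exact: measurable_funM.
  - by move=> v _; rewrite adde_ge0// mule_ge0.
  - by apply: emeasurable_funD; exact: emeasurable_funM.
  - move: (@ae_enorm_gt0 R n n1) pw; apply: filterS2 => v v0 gB _.
    rewrite /P /p -!EFinM -EFinD lee_fin powR_abs indicE.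
    have [vd|dv] := ltP (enorm v) d.
      have -> : (enorm v \in S) = true by rewrite mem_setE in_itv/= v0.
      rewrite min_l ?(ltW vd)// in gB.
      rewrite mulr1; apply: (@le_trans _ _ ((g v ^+ 2) `^ (q / 2))).
        by rewrite ler_piMr ?powR_ge0// volume_density_le1.
      apply: le_trans (gn_near q2 B0 (sqr_ge0 _) v0 gB) _.
      by rewrite lerDr mulr_ge0// mulr_ge0// sqr_ge0.
    have -> : (enorm v \in S) = false by rewrite mem_setE in_itv/= v0 ltNge dv.
    rewrite min_r// in gB.
    rewrite mulr0 mul0r mulr0 addr0 mulrA ler_wpM2r//.
    exact: gn_far q2 (sqr_ge0 _) gB.
rewrite ge0_integralD//; last 4 first.
- by move=> v _; rewrite mule_ge0.
- exact: emeasurable_funM.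
- by move=> v _; rewrite mule_ge0.
- exact: emeasurable_funM.
rewrite !ge0_integralZl// (mass_density sG) polar_formula//.
have -> : (\int[leb1]_(r in `]0%R, +oo[) p r = \int[leb1]_(r in `]0%R, d[) (r `^ (kappa q - 1))%:E)%E.
  rewrite integral_mkcond [RHS]integral_mkcond; apply: eq_integral => r _.
  rewrite !patchE /p indicE; case: (boolP (r \in S)) => [|rS]; last first.
    by rewrite mulr0 if_same.
  rewrite mem_setE in_itv/= => /andP[r0 _].
  by rewrite mem_setE in_itv/= r0 mulr1.
have ka1 : -1 < kappa q - 1 by rewrite ltrBrDl subrr.
have I := integral_powR_le ka1 d0; rewrite subrK in I.
have ce : (0 <= cst_%:E)%E by rewrite lee_fin ltW.
apply: le_trans (leeD2l _ (lee_wpmul2l K2e (lee_wpmul2l ce I))) _.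
rewrite -!EFinM -EFinD lee_fin.
(* The mass in the outer part is traded for [T]; the factor d^2 completes the exponent of d to
   kappa. *)
have MT : M <= d ^+ 2 * T.
  by rewrite /T mulrDr mulrC [X in _ + X]mulrC divfK ?expf_neq0 ?gt_eqF// lerDr mulr_ge0// sqr_ge0.
have q1 : q / 2 - 1 + 1 != 0 by rewrite subrK gt_eqF// divr_gt0// (lt_trans _ q2).
rewrite -mulrA mulrDl; apply: lerD.
  apply: le_trans (ler_wpM2l K10 MT) _.
  rewrite /K1 powR_dim// (powRM _ B0 (powR_ge0 _ _)) /B (powRM _ (ltW a40) T0).
  rewrite -powRrM -[d ^+ 2]powR_mulrn ?(ltW d0)//.
  rewrite -[X in _ <= _ * (X * _)](_ : T `^ (q / 2 - 1) * T = _); last first.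
    by rewrite -{2}(powRr1 T0) -powRD ?(negPf q1)// subrK.
  have -> : d `^ kappa q = d `^ (- (n%:R - 2) * (q / 2 - 1)) * d `^ 2.
    rewrite -powRD ?(gt_eqF d0) ?implybT//; congr (_ `^ _); rewrite /kappa; ring.
  rewrite le_eqVlt; apply/orP; left; apply/eqP; ring.
rewrite /K2 /B (powRM _ (ltW a40) T0).
rewrite le_eqVlt; apply/orP; left; apply/eqP; field.
by rewrite !gt_eqF.
Qed.

End gagliardo_nirenberg.

(** * The Nehari identity for ground states *)

Section nehari_algebra.
Context {R : realType}.
Implicit Types (D N P K A C t q : R).

Lemma powR_pred (a r : R) : 0 < a -> a `^ r = a * a `^ (r - 1).
Proof.
by move=> a0; rewrite -{2}[a](powRr1 (ltW a0)) -powRD ?(gt_eqF a0) ?implybT// addrC subrK.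
Qed.

(* Convexity of the power, from Young's inequality. *)
Lemma powR_ge_tangent (a s q : R) : 1 < q -> 0 < a ->
  a `^ q + q * s * a `^ (q - 1) <= `|a + s| `^ q.
Proof.
move=> q1 a0; have q0 : 0 < q by rewrite (lt_trans _ q1).
have q10 : 0 < q - 1 by rewrite subr_gt0.
have c0 : 0 < q / (q - 1) by rewrite divr_gt0.
have conj : (q / (q - 1))^-1 + q^-1 = 1 by field; rewrite !gt_eqF.
have := conjugate_powR (powR_ge0 a (q - 1)) (normr_ge0 (a + s)) c0 q0 conj.
rewrite -powRrM (_ : (q - 1) * (q / (q - 1)) = q); last by field; rewrite gt_eqF.
have aq := powR_pred q a0.
move=> H; have : q * (a `^ (q - 1) * (a + s)) <= (q - 1) * a `^ q + `|a + s| `^ q.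
  apply: (@le_trans _ _ (q * (a `^ (q - 1) * `|a + s|))).
    by rewrite !ler_wpM2l ?powR_ge0 ?(ltW q0)// ler_norm.
  apply: le_trans (ler_wpM2l (ltW q0) H) _; rewrite le_eqVlt; apply/orP; left; apply/eqP.
  by field; rewrite !gt_eqF.
rewrite -lerBlDl; apply: le_trans; rewrite aq le_eqVlt; apply/orP; left; apply/eqP.
ring.
Qed.

(** Bernoulli's inequality is reversed for exponents below 1, and the exponent needed is 2/q.
    Replacing x by x/(1 + x) gives a lower bound for all r >= 0 with the same first-order term; it
    follows from ln(1 + x) >= x/(1 + x). *)
Lemma powR1D_ge (x r : R) : -1 < x -> 0 <= r -> 1 + r * (x / (1 + x)) <= (1 + x) `^ r.
Proof.
move=> x1 r0; have y0 : 0 < 1 + x by rewrite -ltrBlDl sub0r.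
have lnx : x / (1 + x) <= ln (1 + x).
  rewrite -ler_expR lnK ?posrE// -[leLHS]invrK -[leRHS]invrK lef_pV2 ?posrE ?invr_gt0 ?expR_gt0//.
  rewrite -expRN; apply: le_trans (expR_ge1Dx _).
  rewrite le_eqVlt; apply/orP; left; apply/eqP; field; by rewrite gt_eqF.
rewrite /powR gt_eqF//; apply: le_trans (expR_ge1Dx _).
by rewrite lerD2l ler_wpM2l.
Qed.

(* D, N and P are the squared norm, the power integral and the pairing of Q^p with
   the test function: minimality of Q along Q + t phi, for t of both signs. *)
Lemma nehari_algebra D N P K q : 0 < N -> 0 <= D -> 0 < P -> 0 <= K -> 0 < q ->
  (forall t, 0 < N + q * t * P ->
     D * (N + q * t * P) `^ (2 / q) <= (D + 2 * t * P + t ^+ 2 * K) * N `^ (2 / q)) ->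
  D = N.
Proof.
move=> N0 D0 P0 K0 q0 H; have r0 : 0 <= 2 / q by rewrite divr_ge0// ltW.
pose c := q * P / N; have cp : 0 < c by rewrite divr_gt0// mulr_gt0.
(* With N + q t P = N (1 + c t), the factor N^(2/q) cancels. Multiplying by 1 + c t and bounding t^3
   by t^2 leaves a linear term in t dominated by a quadratic one. *)
have quad t : -1 < c * t -> t <= 1 -> 2 * P * (D / N - 1) * t <= t ^+ 2 * (K + c * (2 * P + K)).
  move=> ct t1; have y0 : 0 < 1 + c * t by rewrite -ltrBlDl sub0r.
  have NE : N + q * t * P = N * (1 + c * t) by rewrite /c; field; rewrite gt_eqF.
  have Nt0 : 0 < N + q * t * P by rewrite NE mulr_gt0.
  have := H t Nt0; rewrite NE powRM ?(ltW N0) ?(ltW y0)// mulrCA mulrC ler_pM2r ?powR_gt0// => h.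
  have := le_trans (ler_wpM2l D0 (powR1D_ge ct r0)) h.
  rewrite mulrDr mulr1 -addrA lerD2l => {}h.
  have : D * (2 / q * (c * t / (1 + c * t))) * (1 + c * t) <= (2 * t * P + t ^+ 2 * K) * (1 + c * t).
    by rewrite ler_pM2r.
  have -> : D * (2 / q * (c * t / (1 + c * t))) * (1 + c * t) = 2 * P * D / N * t.
    transitivity (D * (2 / q) * (c * t)).
      have fe (u y : R) : y != 0 -> D * (2 / q * (u / y)) * y = D * (2 / q) * u.
        by move=> y0'; field; rewrite y0' gt_eqF.
      by rewrite fe// gt_eqF.
    by rewrite /c; field; rewrite !gt_eqF.
  rewrite -subr_ge0 => h2; rewrite -subr_ge0; apply: le_trans h2 _; rewrite -subr_ge0.
  have -> : t ^+ 2 * (K + c * (2 * P + K)) - 2 * P * (D / N - 1) * t -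
     ((2 * t * P + t ^+ 2 * K) * (1 + c * t) - 2 * P * D / N * t) = c * K * t ^+ 2 * (1 - t) by ring.
  by rewrite mulr_ge0 ?subr_ge0// mulr_ge0 ?sqr_ge0// mulr_ge0// ltW.
pose A := 2 * P * (D / N - 1); pose C := K + c * (2 * P + K).
have C0 : 0 <= C.
  by rewrite addr_ge0// mulr_ge0 ?(ltW cp)// addr_ge0// mulr_ge0// ltW.
suff : A = 0.
  move/eqP; rewrite /A mulf_eq0 mulf_eq0 pnatr_eq0/= gt_eqF//= subr_eq0 => /eqP DN.
  by rewrite -[D](divfK (lt0r_neq0 N0)) DN mul1r.
(* For 0 < t <= t1 one has c t <= 1/2, so that both t and -t are admissible; the two signs bound |A|
   by t C. *)
pose t1 := Num.min 1 (2^-1 / c).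
have t10 : 0 < t1 by rewrite lt_min ltr01 divr_gt0 ?invr_gt0.
have small t : 0 < t -> t <= t1 -> `|A| <= t * C.
  move=> t0; rewrite le_min => /andP[tle1 tc].
  have ct : c * t <= 2^-1 by rewrite mulrC -ler_pdivlMr.
  have h1 : -1 < c * t by rewrite (lt_le_trans (ltrN10 _))// mulr_ge0 ?ltW.
  have h2 : -1 < c * - t.
    by rewrite mulrN ltrN2 (le_lt_trans ct)// invf_lt1// ltr1n.
  rewrite ler_norml; apply/andP; split.
    have := quad (- t) h2; rewrite sqrrN -/A -/C mulrN => /(_ _)/wrap[|h].
      by rewrite (le_trans _ ler01)// oppr_le0 ltW.
    by rewrite -(ler_pM2r t0) mulNr lerNl; apply: le_trans h _; rewrite expr2 mulrAC.
  have := quad t h1 tle1; rewrite -/A -/C => h.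
  by rewrite -(ler_pM2r t0); apply: le_trans h _; rewrite expr2 mulrAC.
apply/eqP; rewrite -normr_le0; apply/ler_addgt0Pr => e e0; rewrite add0r.
pose t := Num.min t1 (e / (C + 1)).
have C1 : 0 < C + 1 by rewrite ltr_wpDl.
have t0 : 0 < t by rewrite lt_min t10 divr_gt0.
have tt1 : t <= t1 by rewrite ge_min lexx.
apply: le_trans (small t t0 tt1) _.
have te : t <= e / (C + 1) by rewrite ge_min lexx orbT.
apply: (@le_trans _ _ (t * (C + 1))); first by rewrite ler_wpM2l ?(ltW t0)// lerDl.
by rewrite -ler_pdivlMr.
Qed.

End nehari_algebra.

Lemma Rintegral_ae0 d (T : measurableType d) (R : realType)
    (m : {measure set T -> \bar R}) (f : T -> R) : measurable_fun setT f ->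
  {ae m, forall x, f x = 0} -> \int[m]_x f x = 0.
Proof.
move=> mf f0; rewrite /Rintegral (_ : (\int[m]_x (f x)%:E)%E = 0%E)//.
rewrite -(integral0 m setT); apply: ae_eq_integral => //; first exact/measurable_EFinP.
by move: f0; apply: filterS => x -> _.
Qed.

Section positive_sobolev.
Context {R : realType} {n : nat}.
Local Notation rV := 'rV[R]_n.
Local Notation mu := (@hyp_measure R n).
Local Notation leb := (lebesgue_row R n).
Implicit Types (f : rV -> R[i]) (G : 'I_n -> rV -> R[i]).

(** The zero field is also a weak gradient of g, and weak gradients are unique. It is used for
    imaginary parts, which vanish only almost everywhere. *)
Lemma sobolevR_ae0 (g : rV -> R) (G : 'I_n -> rV -> R) : sobolevR g G -> {ae mu, forall v, g v = 0} ->
  \int[mu]_v gip v (G ^~ v) (G ^~ v) = 0.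
Proof.
move=> sG g0; have [[mg ig] [mG iG] wG] := sG.
have s0 : sobolevR g (fun _ _ => 0).
  split=> //; first by have [_ ? _] := @sobolevR0 R n.
  move=> phi tphi i; rewrite wG// -wG//; transitivity (0 : R).
    have mp := measurable_test (test_partial i tphi).
    apply: Rintegral_ae0; first exact: measurable_funM.
    by move/ae_hypP: g0; apply: filterS => v ->; rewrite mul0r.
  rewrite (_ : \int[leb]_v (0 * phi v) = 0) ?oppr0//.
  apply: Rintegral_ae0; first by apply: measurable_funM => //; exact: measurable_test.
  by apply: nearW => v; rewrite mul0r.
have u := sobolevR_unique sG s0.
rewrite (Rintegral_gip_ae (G' := fun _ _ => 0) (H' := fun _ _ => 0) mG _ mG _ u u)//.
have gip0 (v : rV) : gip v (fun i : 'I_n => 0 : R) (fun i : 'I_n => 0) = 0.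
  by rewrite /gip !big1 ?mulr0 ?addr0// => i _; rewrite ?mulr0.
apply: Rintegral_ae0; first by apply: measurable_gip => i; exact: measurable_cst.
by apply: nearW => v; exact: gip0.
Qed.

Section real_valued.
Variables (f : rV -> R[i]) (G : 'I_n -> rV -> R[i]).
Hypotheses (sG : sobolev_differential f G) (f0 : {ae mu, forall v, im f v = 0}).

Lemma dirichlet_real : dirichlet f =
  \int[mu]_v gip v (fun i => re (G i) v) (fun i => re (G i) v).
Proof.
have [_ sI] := iffLR (sobolev_differentialP f G) sG.
by rewrite (dirichletE sG) (sobolevR_ae0 sI f0) addr0.
Qed.

Lemma l2_norm_sq_real : l2_norm_sq f = \int[mu]_v (re f v ^+ 2).
Proof.
have sf : sobolev f by exists G.
have [_ [[mi _] _ _]] := iffLR (sobolev_differentialP f G) sG.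
rewrite (l2_norm_sqE sf) (_ : \int[mu]_v im f v ^+ 2 = 0) ?addr0//.
apply: Rintegral_ae0; first exact: measurable_funX.
by move: f0; apply: filterS => v ->; rewrite expr0n.
Qed.

Lemma Lp_norm_real (q : R) : 0 < q -> (\int[mu]_v (`|re f v| `^ q)%:E < +oo)%E ->
  Lp_norm q f = (\int[mu]_v (`|re f v| `^ q)) `^ q^-1.
Proof.
move=> q0 fin; have [[[mr _] _ _] [[mi _] _ _]] := iffLR (sobolev_differentialP f G) sG.
have mc : measurable_fun setT (fun v => cabs (f v)).
  exact: measurable_cabs.
have mpow (h : rV -> R) : measurable_fun setT h -> measurable_fun setT (fun v => `|h v| `^ q).
  by move=> mh; apply: measurable_powR_comp; exact: measurableT_comp.
rewrite /Lp_norm unlock.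
have -> : (\int[mu]_v (`|(cabs (f v))%:E| `^ q) = (\int[mu]_v (`|re f v| `^ q))%:E)%E.
  rewrite /Rintegral fineK; last first.
    by rewrite ge0_fin_numE//; apply: integral_ge0 => v _; rewrite lee_fin powR_ge0.
  apply: ae_eq_integral => //.
  - by under eq_fun do rewrite abse_EFin poweR_EFin; apply/measurable_EFinP; exact: mpow.
  - by apply/measurable_EFinP; exact: mpow.
  - move: f0; apply: filterS => v fv _; rewrite abse_EFin poweR_EFin.
    by rewrite cabsE -/(im f v) fv expr0n/= addr0 sqrtr_sqr normr_id.
by rewrite poweR_EFin.
Qed.

End real_valued.

(** In the chart the hyperbolic cosine of the distance to the origin is the height (1 +
    |v|^2)^(1/2), so radial means a function of |v|. *)
Lemma radial_re f : radial f -> exists h : R -> R, {ae leb, forall v, re f v = h (enorm v)}.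
Proof.
move=> [h fh]; pose H (r : R) := Num.sqrt (1 + r ^+ 2).
exists (fun r => complex.Re (h (ln (H r + Num.sqrt (H r ^+ 2 - 1))))).
move/ae_hypP: fh; apply: filterS => v E; rewrite /re E; congr (complex.Re (h (ln _))).
have -> : lorentz (hyp v) 'e_ord0 = H (enorm v).
  rewrite /lorentz [X in _ * X - _]mxE !eqxx mulr1 big1 ?subr0; last first.
    by move=> i _; rewrite [X in _ * X]mxE eqxx/= mulr0.
  by rewrite row_cons0/= /height /H sqr_sqrtr// nsq_ge0.
by [].
Qed.

End positive_sobolev.

(** * A nonnegative radial test function *)

Section annulus_test.
Context {R : realType} {n : nat}.
Local Notation rV := 'rV[R]_n.
Local Notation mu := (@hyp_measure R n).
Local Notation leb := (lebesgue_row R n).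
Hypothesis n1 : (1 < n)%N.

(* Radial, so that the radial Gagliardo-Nirenberg inequality applies to the
   competitors Q + t * annulus_test. *)
Definition annulus_test (v : rV) : R := cutoff 2^-1 3 1 (enorm v).

Lemma test_annulus : test_function annulus_test.
Proof.
have h3 : 2^-1 <= 3 :> R by rewrite (le_trans (_ : _ <= 1)) ?invf_le1 ?ler1n.
apply: (@test_radial R n (cutoff 2^-1 3 1) 2^-1 (3 + 1)); first by rewrite invr_gt0.
- exact: smooth1_cutoff.
- by move=> t; exact: cutoff_lt.
- by move=> t; exact: cutoff_gt.
Qed.

Lemma annulus_test_ge0 v : 0 <= annulus_test v.
Proof. by apply: cutoff_ge0 => //; rewrite (le_trans (_ : _ <= 1)) ?invf_le1 ?ler1n. Qed.

Lemma annulus_test_le1 v : annulus_test v <= 1. Proof. exact: cutoff_le1. Qed.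

Lemma annulus_test_gt0 v : 1 <= enorm v <= 2 -> 0 < annulus_test v.
Proof.
move=> /andP[v1 v2]; apply: cutoff_gt0 => //; rewrite (lt_le_trans _ v1) ?invf_lt1 ?ltr1n//=.
by rewrite (le_lt_trans v2)// ltr_nat.
Qed.

Lemma integrable_hyp_test (phi : rV -> R) : test_function phi ->
  mu.-integrable setT (EFin \o phi).
Proof.
move=> tphi; have mp := measurable_test tphi; apply/(iffRL (integrable_hyp mp)).
have mw := @measurable_volume_density R n.
apply: le_integrable (integrable_test tphi) => //.
  by apply/measurable_EFinP; exact: measurable_funM.
move=> v _; rewrite !abse_EFin lee_fin normrM ler_piMr//.
by rewrite ger0_norm ?volume_density_le1// ltW// volume_density_gt0.
Qed.

(** A zero integral would force the integrand to vanish almost everywhere, although it is positive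
    at almost every point of the annulus 1 <= |v| <= 2, which has positive measure. *)
Lemma Rintegral_annulus_gt0 (g : rV -> R) : measurable_fun setT g ->
  {ae mu, forall v, 0 < g v} ->
  mu.-integrable setT (EFin \o (fun v => g v * annulus_test v)) ->
  0 < \int[mu]_v (g v * annulus_test v).
Proof.
move=> mg g0 ig; have mp := measurable_test test_annulus.
have mga : measurable_fun setT (fun v => g v * annulus_test v) by exact: measurable_funM.
pose f v : R := `|g v * annulus_test v|.
have E : (\int[mu]_v (g v * annulus_test v)%:E = \int[mu]_v `|(g v * annulus_test v)%:E|)%E.
  apply: ae_eq_integral => //.
  - exact/measurable_EFinP.
  - by apply: measurableT_comp => //; exact/measurable_EFinP.
  - move: g0; apply: filterS => v gv _; rewrite abse_EFin ger0_norm//.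
    by rewrite mulr_ge0 ?(ltW gv)// annulus_test_ge0.
rewrite /Rintegral E; apply: fine_gt0.
have /integrableP[_ ->] := ig; rewrite andbT lt_neqAle integral_ge0// andbT eq_sym.
apply/eqP => /(iffLR (ae_eq_integral_abs mu measurableT (iffRL (measurable_EFinP _ _) mga))) h.
have : {ae leb, forall v, ~ (1 <= enorm v <= 2)}.
  apply/ae_hypP; move: h g0; apply: filterS2 => v /(_ I) /= [gv0] gv vA.
  by have := mulr_gt0 gv (annulus_test_gt0 vA); rewrite gv0 ltxx.
move=> [N [mN N0 AN]]; have := @annulus_gt0 R n n1.
rewrite (@subset_measure0 _ _ _ leb _ N _ mN _ N0) ?ltxx//.
  have -> : [set v : rV | 1 <= enorm v <= 2] = (@enorm R n) @^-1` `[1, 2]%classic.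
    by apply/seteqP; split => v; rewrite /= in_itv.
  by rewrite -[X in measurable X]setTI; exact: measurable_enorm.
by move=> v vA; apply: AN => /(_ vA).
Qed.

End annulus_test.

Lemma Rintegral_ae_ge0 d (T : measurableType d) (R : realType)
    (m : {measure set T -> \bar R}) (f : T -> R) : measurable_fun setT f ->
  {ae m, forall x, 0 <= f x} -> 0 <= \int[m]_x f x.
Proof.
move=> mf f0; rewrite /Rintegral (_ : (\int[m]_x (f x)%:E = \int[m]_x `|f x|%:E)%E).
  by apply: fine_ge0; apply: integral_ge0 => x _; rewrite lee_fin.
apply: ae_eq_integral => //; first exact/measurable_EFinP.
  by apply/measurable_EFinP; exact: measurableT_comp.
by move: f0; apply: filterS => x f0 _; rewrite ger0_norm.
Qed.

Lemma powR_quotient (R : realType) (A B a b X Y x y q : R) : A = a -> B = b ->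
  X = x `^ q^-1 -> Y = y `^ q^-1 -> 0 < x -> 0 < y ->
  A / X ^+ 2 <= B / Y ^+ 2 -> a * y `^ (2 / q) <= b * x `^ (2 / q).
Proof.
move=> -> -> -> -> x0 y0; have E (z : R) : (z `^ q^-1) ^+ 2 = z `^ (2 / q).
  by rewrite -powR_mulrn ?powR_ge0// -powRrM mulrC.
by rewrite !E ler_pdivrMr ?powR_gt0// mulrAC ler_pdivlMr ?powR_gt0.
Qed.

Section ground_states.
Context {R : realType} {n : nat}.
Local Notation rV := 'rV[R]_n.
Local Notation mu := (@hyp_measure R n).
Local Notation leb := (lebesgue_row R n).
Hypothesis n2 : (2 < n)%N.
Variables (lam p : R) (Q : H1 R n).
Hypotheses (lam0 : lam <= 0) (p1 : 1 < p)
  (pn : 0 < n%:R - (n%:R - 2) * ((p + 1) / 2)) (gQ : ground_state lam p Q).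

Let q := p + 1.
Let q2 : 2 < q. Proof. by rewrite /q (_ : 2 = 1 + 1 :> R) ?ltrD2r// -mulr2n. Qed.
Let q0 : 0 < q. Proof. exact: lt_trans q2. Qed.

Let n1 : (1 < n)%N. Proof. exact: ltnW. Qed.

Let G := differential Q.

Let sQ : sobolev_differential Q G. Proof. exact/differentialP/H1_sobolev. Qed.

Lemma ground_state_pos : {ae mu, forall v, 0 < re Q v}.
Proof. by have [Q0 _ _ _] := gQ; move: Q0; apply: filterS => v; rewrite ltc0 => /andP[]. Qed.

Lemma ground_state_im : {ae mu, forall v, im Q v = 0}.
Proof. by have [Q0 _ _ _] := gQ; move: Q0; apply: filterS => v; rewrite ltc0 => /andP[/eqP]. Qed.


(** The inequality at scale delta = 1 is used only for the finiteness of its right-hand side. *)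
Lemma radial_power_integrable (g : rV -> R) (H : 'I_n -> rV -> R) (h : R -> R) :
  sobolevR g H -> {ae leb, forall v, g v = h (enorm v)} ->
  mu.-integrable setT (EFin \o (fun v => `|g v| `^ q)).
Proof.
move=> sg gh; have [C C0 GN] := gagliardo_nirenberg n2 q2 pn.
have [[mg _] _ _] := sg.
apply/integrableP; split.
  by apply/measurable_EFinP; apply: measurable_powR_comp; exact: measurableT_comp.
have := GN g H h 1 sg gh; rewrite ltr01 lexx => /(_ isT) I.
under eq_integral do rewrite /= ger0_norm ?powR_ge0//.
by apply: le_lt_trans I _; rewrite ltry.
Qed.

Let phi := @annulus_test R n.
Let tphi : test_function phi := test_annulus.
Let sphi := sobolev_differential_test tphi.

Let sQre : sobolevR (re Q) (fun i => re (G i)).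
Proof. by have [] := iffLR (sobolev_differentialP Q G) sQ. Qed.

Let mQ : measurable_fun setT (re Q). Proof. by have [[]] := sQre. Qed.

Let radQ : exists h : R -> R, {ae leb, forall v, re Q v = h (enorm v)}.
Proof. by have [_ rQ _ _] := gQ; exact: radial_re rQ. Qed.

Let ft (t : R) : 'rV[R]_n -> R[i] := fun v => Q v + t%:C * (phi v)%:C.

Let sft t : sobolev_differential (ft t) (fun i v => G i v + t%:C * (partial i phi v)%:C) :=
  sobolev_differential_lin t sQ sphi.

Let re_ft t v : re (ft t) v = re Q v + t * phi v.
Proof. by rewrite /re /ft Re_add Re_mul/= mul0r subr0. Qed.

Let im_ft t : {ae mu, forall v, im (ft t) v = 0}.
Proof.
move: ground_state_im; apply: filterS => v; rewrite /im /ft Im_add Im_mul/= => ->.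
by rewrite mulr0 mul0r !addr0.
Qed.

Let mpow_ft t : measurable_fun setT (fun v => `|re (ft t) v| `^ q).
Proof.
have [[[mf _] _ _] _] := iffLR (sobolev_differentialP _ _) (sft t).
by apply: measurable_powR_comp; exact: measurableT_comp.
Qed.

Let power_ft t : mu.-integrable setT (EFin \o (fun v => `|re (ft t) v| `^ q)).
Proof.
have [h hQ] := radQ; have [sf _] := iffLR (sobolev_differentialP _ _) (sft t).
apply: (@radial_power_integrable _ _ (fun r => h r + t * cutoff 2^-1 3 1 r) sf).
by move: hQ; apply: filterS => v E; rewrite re_ft E.
Qed.

Let N := \int[mu]_v (`|re Q v| `^ q).
Let P := \int[mu]_v (re Q v `^ p * phi v).
Let D := \int[mu]_v gip v (fun i => re (G i) v) (fun i => re (G i) v) -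
  lam * \int[mu]_v (re Q v ^+ 2).
Let K := \int[mu]_v gip v (fun i => partial i phi v) (fun i => partial i phi v) -
  lam * \int[mu]_v (phi v ^+ 2).

Lemma ground_state_power_integrable :
  mu.-integrable setT (EFin \o (fun v => `|re Q v| `^ q)).
Proof. by have [h hQ] := radQ; exact: radial_power_integrable sQre hQ. Qed.

Let mphi : measurable_fun setT phi := measurable_test tphi.

Lemma ground_state_pairing_integrable :
  mu.-integrable setT (EFin \o (fun v => re Q v `^ p * phi v)).
Proof.
have mP : measurable_fun setT (fun v => re Q v `^ p * phi v).
  by apply: measurable_funM => //; exact: measurable_powR_comp.
have := integrableD measurableT ground_state_power_integrable (integrable_hyp_test tphi).
apply: le_integrable => //; first exact/measurable_EFinP.
move=> v _; rewrite /= lee_fin.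
have f0 : 0 <= phi v := annulus_test_ge0 v; have f1 : phi v <= 1 := annulus_test_le1 v.
have a0 : 0 <= re Q v `^ p * phi v := mulr_ge0 (powR_ge0 _ _) f0.
have b0 : 0 <= `|re Q v| `^ q + phi v := addr_ge0 (powR_ge0 _ _) f0.
rewrite (ger0_norm a0) (ger0_norm b0).
have bound (x : R) : x `^ p <= `|x| `^ q + 1.
  (* A power of a negative real is 1 by convention, which the summand 1 absorbs. *)
  have [x0|x0] := ltP x 0; first by rewrite lt0_powR1// lerDr powR_ge0.
  rewrite ger0_norm//; have [x1|x1] := leP x 1.
    apply: (@le_trans _ _ 1); last by rewrite lerDr powR_ge0.
    have p0 : 0 <= p by rewrite ltW// (lt_trans ltr01).
    have := @ge0_ler_powR _ p p0 x 1; rewrite !nnegrE powR1; exact.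
  by apply: ler_wpDr => //; apply: ler_powR; [exact: ltW|rewrite /q lerDl].
apply: le_trans (ler_wpM2r f0 (bound _)) _.
by rewrite mulrDl mul1r lerD2r ler_piMr ?powR_ge0.
Qed.

Let P0 : 0 < P.
Proof.
apply: Rintegral_annulus_gt0 ground_state_pairing_integrable => //.
  exact: measurable_powR_comp.
by move: ground_state_pos; apply: filterS => v; exact: powR_gt0.
Qed.

Lemma ground_state_weak (psi : rV -> R) : test_function psi ->
  \int[mu]_v gip v (fun i => re (G i) v) (fun i => partial i psi v) -
  lam * \int[mu]_v (re Q v * psi v) = \int[mu]_v (re Q v `^ p * psi v).
Proof.
move=> tpsi; have [_ _ _ /(_ _ tpsi) W] := gQ.
have mpsi := measurable_test tpsi.
have := congr1 (@complex.Re R) W.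
rewrite Re_add Re_opp Re_mul (dirichlet_pairingE sQ tpsi) !l2_pairingE/= mul0r subr0 => ->.
have reE v : re (fun v => power_nonlinearity p (Q v)) v = cabs (Q v) `^ (p - 1) * re Q v.
  by rewrite /re /power_nonlinearity Re_mul/= mul0r subr0.
have mc : measurable_fun setT (fun v => cabs (Q v)).
  have [_ [[mi _] _ _]] := iffLR (sobolev_differentialP Q G) sQ.
  exact: measurable_cabs.
congr fine; apply: ae_eq_integral => //.
- apply/measurable_EFinP; apply: measurable_funM => //.
  have -> : re (fun v => power_nonlinearity p (Q v)) = (fun v => cabs (Q v) `^ (p - 1) * re Q v).
    by apply/funext => v; exact: reE.
  apply: measurable_funM => //.
  exact: measurable_powR_comp.
- by apply/measurable_EFinP; apply: measurable_funM => //; exact: measurable_powR_comp.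
- move: ground_state_pos ground_state_im; apply: filterS2 => v v0 vi _; congr (_ * _)%:E.
  rewrite reE cabsE -/(im Q v) vi -/(re Q v) expr0n/= addr0 sqrtr_sqr gtr0_norm//.
  by rewrite -{2}(powRr1 (ltW v0)) -powRD ?subrK// (gt_eqF v0) implybT.
Qed.

Let K0 : 0 <= K.
Proof.
rewrite addr_ge0//; first by apply: Rintegral_ge0 => v _; exact: gip_ge0.
rewrite -mulNr mulr_ge0 ?oppr_ge0//.
by apply: Rintegral_ge0 => v _; exact: sqr_ge0.
Qed.

Lemma Hlam_norm_sqr (f : rV -> R[i]) F : sobolev_differential f F ->
  {ae mu, forall v, im f v = 0} -> Hlam_norm lam f ^+ 2 =
  \int[mu]_v gip v (fun i => re (F i) v) (fun i => re (F i) v) - lam * \int[mu]_v (re f v ^+ 2).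
Proof.
move=> sf f0; rewrite /Hlam_norm (dirichlet_real sf f0) (l2_norm_sq_real sf f0) sqr_sqrtr//.
rewrite addr_ge0//; first by apply: Rintegral_ge0 => v _; exact: gip_ge0.
rewrite -mulNr mulr_ge0 ?oppr_ge0//.
by apply: Rintegral_ge0 => v _; exact: sqr_ge0.
Qed.

(** The cross term of the quadratic expansion is the weak equation tested with [phi], which turns it
    into 2 t P. *)
Let D_ft t : Hlam_norm lam (ft t) ^+ 2 = D + 2 * t * P + t ^+ 2 * K.
Proof.
have [sq sg _] := sQre; have [sp sgp _] := sobolevR_test tphi.
rewrite (Hlam_norm_sqr (sft t) (im_ft t)).
have -> : \int[mu]_v (re (ft t) v ^+ 2) = \int[mu]_v ((re Q v + t * phi v) ^+ 2).
  by apply: eq_Rintegral => v _; rewrite re_ft.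
have -> : \int[mu]_v gip v (fun i => re (fun w => G i w + t%:C * (partial i phi w)%:C) v)
     (fun i => re (fun w => G i w + t%:C * (partial i phi w)%:C) v) =
    \int[mu]_v gip v (fun i => re (G i) v + t * partial i phi v) (fun i => re (G i) v + t * partial i phi v).
  have E i v : re (fun w => G i w + t%:C * (partial i phi w)%:C) v = re (G i) v + t * partial i phi v.
    by rewrite /re Re_add Re_mul/= mul0r subr0.
  by apply: eq_Rintegral => v _; congr (gip v _ _); apply/funext => i; exact: E.
rewrite Rintegral_sq_lin// Rintegral_gip_lin// /D /K /P -ground_state_weak//.
ring.
Qed.

Let D_Q : Hlam_norm lam Q ^+ 2 = D.
Proof. exact: Hlam_norm_sqr sQ ground_state_im. Qed.

Let N0 : 0 < N.
Proof.
have /integrableP[mp fin] := ground_state_power_integrable.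
rewrite /N /Rintegral fine_gt0//; apply/andP; split; last first.
  apply: le_lt_trans fin; apply: ge0_le_integral => //.
  - exact: measurableT_comp.
  - by move=> v _; rewrite /= lee_fin ler_norm.
rewrite lt_neqAle integral_ge0 ?andbT; last by move=> v _; rewrite lee_fin powR_ge0.
apply/eqP => h.
have := iffLR (ae_eq_integral_abs mu measurableT mp).
rewrite (_ : (\int[mu]_v _)%E = 0%E); last first.
  by rewrite h; apply: eq_integral => v _; rewrite /= ger0_norm ?powR_ge0.
move=> /(_ erefl) h0.
have [v [v0 /(_ I) [vp]]] : exists v, 0 < re Q v /\ (setT v -> (`|re Q v| `^ q)%:E = 0%E).
  by apply: ae_row_ex; apply/ae_hypP; move: ground_state_pos h0; apply: filterS2.
by have := powR_gt0 q (_ : 0 < `|re Q v|); rewrite vp ltxx normr_gt0 gt_eqF// => /(_ isT).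
Qed.

(** The tangent inequality for the power, integrated. A lower bound is enough because the power
    integral stands in the denominator of the minimized quotient. *)
Let N_ft t : N + q * t * P <= \int[mu]_v (`|re (ft t) v| `^ q).
Proof.
have iN := ground_state_power_integrable; have iP := ground_state_pairing_integrable.
have iqP : mu.-integrable setT (EFin \o (fun v => q * t * (re Q v `^ p * phi v))).
  by have := integrableZl measurableT (q * t) iP; apply: eq_integrable => // v _; rewrite /= EFinM.
rewrite -subr_ge0 /N /P -RintegralZl// -RintegralD// -RintegralB//; last first.
  by have := integrableD measurableT iN iqP; apply: eq_integrable.
apply: Rintegral_ae_ge0.
  apply: measurable_funB; first exact: mpow_ft.
  apply: measurable_funD; first by apply: measurable_powR_comp; exact: measurableT_comp.
  by apply: measurable_funM => //; apply: measurable_funM => //; exact: measurable_powR_comp.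
move: ground_state_pos; apply: filterS => v v0; rewrite subr_ge0 re_ft (gtr0_norm v0).
have q1 : 1 < q by rewrite (lt_trans _ q2)// ltr1n.
have := powR_ge_tangent (t * phi v) q1 v0.
rewrite (_ : q - 1 = p); last by rewrite /q addrK.
by apply: le_trans; rewrite lerD2l -!mulrA (mulrC (phi v)).
Qed.

Let Lp_sqr (f : rV -> R[i]) F : sobolev_differential f F ->
  {ae mu, forall v, im f v = 0} ->
  mu.-integrable setT (EFin \o (fun v => `|re f v| `^ q)) ->
  Lp_norm q f = (\int[mu]_v (`|re f v| `^ q)) `^ q^-1.
Proof.
move=> sf f0 /integrableP[_ fin]; apply: (Lp_norm_real sf f0 q0).
apply: le_lt_trans fin; rewrite le_eqVlt; apply/orP; left; apply/eqP.
by apply: eq_integral => v _; rewrite gee0_abs ?lee_fin ?powR_ge0.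
Qed.

(** Minimality of the quotient at t = 0 along Q + t phi equates, to first order, the variation of
    the squared norm with that of the power integral; P > 0 then gives the equality without testing
    the equation with Q. *)
Lemma nehari : Hlam_norm lam Q ^+ 2 = \int[mu]_v (`|re Q v| `^ q).
Proof.
have D0 : 0 <= D by rewrite -D_Q sqr_ge0.
rewrite D_Q; apply: (nehari_algebra N0 D0 P0 K0 q0) => t Nt0.
have Nt : 0 < \int[mu]_v (`|re (ft t) v| `^ q) by exact: lt_le_trans Nt0 (N_ft t).
have [_ _ M _] := gQ.
pose f : H1 R n := MkH1 (ex_intro _ _ (sft t)).
have nf : ~ {ae mu, forall v, f v = 0}.
  move=> f0; have : \int[mu]_v (`|re (ft t) v| `^ q) = 0.
    apply: Rintegral_ae0; first exact: mpow_ft.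
    move: f0; apply: filterS => v fv.
    have -> : re (ft t) v = 0 by rewrite /re [ft t v]fv.
    by rewrite normr0 powR0// gt_eqF.
  by move=> E; rewrite E ltxx in Nt.
have h := powR_quotient D_Q (D_ft t)
  (Lp_sqr sQ ground_state_im ground_state_power_integrable)
  (Lp_sqr (sft t) (im_ft t) (power_ft t)) N0 Nt (M f nf).
apply: le_trans h; apply: ler_wpM2l => //; apply: ge0_ler_powR; last exact: N_ft.
- by rewrite divr_ge0// ltW.
- by rewrite nnegrE ltW.
- by rewrite nnegrE ltW.
Qed.

Lemma energy_ground_state : energy lam p Q = (2^-1 - q^-1) * Hlam_norm lam Q ^+ 2.
Proof.
rewrite /energy -/q (Lp_sqr sQ ground_state_im ground_state_power_integrable).
rewrite -powRrM mulVf ?gt_eqF// powRr1 ?(ltW N0)// nehari; ring.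
Qed.

Lemma ground_state_norm_gt0 : 0 < Hlam_norm lam Q ^+ 2.
Proof. by rewrite nehari. Qed.

End ground_states.

(** * A ground state is a stationary solution that does not scatter *)

Section stationary.
Context {R : realType} {n : nat}.
Local Notation rV := 'rV[R]_n.
Local Notation mu := (@hyp_measure R n).
Local Notation leb := (lebesgue_row R n).

Lemma sqr_le_discriminant (a b c : R) : 0 <= c ->
  (forall t, 0 <= a + 2 * t * b + t ^+ 2 * c) -> b ^+ 2 <= a * c.
Proof.
rewrite le_eqVlt => /predU1P[<-|c0] H.
  rewrite mulr0; have [->|b0] := eqVneq b 0; first by rewrite expr0n.
  (* If c = 0 and b is nonzero, this value of t makes a + 2 t b equal to -1. *)
  have := H (- (a + 1) / (2 * b)); rewrite mulr0 addr0.
  have -> : a + 2 * (- (a + 1) / (2 * b)) * b = -1 by field.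
  by rewrite oppr_ge0 ler10.
have := H (- b / c); have -> : a + 2 * (- b / c) * b + (- b / c) ^+ 2 * c = a - b ^+ 2 / c.
  by field; rewrite gt_eqF.
by rewrite subr_ge0 ler_pdivrMr.
Qed.

Lemma sqr_Rintegral_mul_le (g h : rV -> R) : sq_integrable g -> sq_integrable h ->
  (\int[mu]_v (g v * h v)) ^+ 2 <= \int[mu]_v (g v ^+ 2) * \int[mu]_v (h v ^+ 2).
Proof.
move=> sg sh; apply: sqr_le_discriminant; first by apply: Rintegral_ge0 => v _; exact: sqr_ge0.
move=> t; rewrite -(Rintegral_sq_lin t sg sh).
by apply: Rintegral_ge0 => v _; exact: sqr_ge0.
Qed.

Lemma sqr_Rintegral_gip_le (G H : 'I_n -> rV -> R) : gip_integrable G -> gip_integrable H ->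
  (\int[mu]_v gip v (G ^~ v) (H ^~ v)) ^+ 2 <=
  \int[mu]_v gip v (G ^~ v) (G ^~ v) * \int[mu]_v gip v (H ^~ v) (H ^~ v).
Proof.
move=> sG sH; apply: sqr_le_discriminant; first by apply: Rintegral_ge0 => v _; exact: gip_ge0.
move=> t; rewrite -(Rintegral_gip_lin t sG sH).
by apply: Rintegral_ge0 => v _; exact: gip_ge0.
Qed.

(** Continuity in the H^1 norm of the two pairings linked by the real part of the free Schrodinger
    equation: the real part of the gradient pairing and the imaginary part of the L^2 pairing. *)
Lemma h1_norm_pairing (f g : rV -> R[i]) F G phi :
  sobolev_differential f F -> sobolev_differential g G -> test_function phi ->
  let e := h1_norm (fun v => f v - g v) in
  (\int[mu]_v gip v (fun i => re (F i) v) (fun i => partial i phi v) -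
   \int[mu]_v gip v (fun i => re (G i) v) (fun i => partial i phi v)) ^+ 2 <=
  e ^+ 2 * \int[mu]_v gip v (fun i => partial i phi v) (fun i => partial i phi v) /\
  (\int[mu]_v (im f v * phi v) - \int[mu]_v (im g v * phi v)) ^+ 2 <=
  e ^+ 2 * \int[mu]_v (phi v ^+ 2).
Proof.
move=> sF sG tphi e; have sH := sobolev_differential_lin (-1) sF sG.
have [sFr sFi] := iffLR (sobolev_differentialP _ _) sF.
have [sGr sGi] := iffLR (sobolev_differentialP _ _) sG.
have [sHr sHi] := iffLR (sobolev_differentialP _ _) sH.
set k := fun v => f v + (-1)%:C * g v in sH sHr sHi.
set H := fun i v => F i v + (-1)%:C * G i v in sH sHr sHi.
have fgE : (fun v => f v - g v) = k.
  apply/funext => v; apply: eqc; rewrite /k ?Re_add ?Im_add ?Re_opp ?Im_opp ?Re_mul ?Im_mul/=.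
    by rewrite mulN1r mul0r subr0.
  by rewrite mulN1r mul0r addr0.
have [sp sgp _] := sobolevR_test tphi.
have [sqr_ gr_ _] := sHr; have [sqi_ gi_ _] := sHi.
have p1 : 0 <= \int[mu]_v gip v (fun i => re (H i) v) (fun i => re (H i) v).
  by apply: Rintegral_ge0 => v _; exact: gip_ge0.
have p2 : 0 <= \int[mu]_v gip v (fun i => im (H i) v) (fun i => im (H i) v).
  by apply: Rintegral_ge0 => v _; exact: gip_ge0.
have p3 : 0 <= \int[mu]_v (re k v ^+ 2) by apply: Rintegral_ge0 => v _; exact: sqr_ge0.
have p4 : 0 <= \int[mu]_v (im k v ^+ 2) by apply: Rintegral_ge0 => v _; exact: sqr_ge0.
have eE : e ^+ 2 = \int[mu]_v gip v (fun i => re (H i) v) (fun i => re (H i) v) +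
   \int[mu]_v gip v (fun i => im (H i) v) (fun i => im (H i) v) +
   (\int[mu]_v (re k v ^+ 2) + \int[mu]_v (im k v ^+ 2)).
  have sk : sobolev k by exists H.
  rewrite /e fgE /h1_norm (dirichletE sH) (l2_norm_sqE sk) sqr_sqrtr//.
  by rewrite addr_ge0// addr_ge0.
have [[mFr sgF _] [_ gF _]] := (sFr, sFi).
split.
  have -> : \int[mu]_v gip v (fun i => re (F i) v) (fun i => partial i phi v) -
      \int[mu]_v gip v (fun i => re (G i) v) (fun i => partial i phi v) =
      \int[mu]_v gip v (fun i => re (H i) v) (fun i => partial i phi v).
    have [_ gFr _] := sFr; have [_ gGr _] := sGr.
    rewrite -RintegralB//; [|exact: integrable_gip|exact: integrable_gip].
    apply: eq_Rintegral => v _.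
    have E i : re (H i) v = re (F i) v + (-1) * re (G i) v.
      by rewrite /H /re Re_add Re_mul/= mul0r subr0.
    rewrite (_ : (fun i => re (H i) v) = (fun i => re (F i) v + (-1) * re (G i) v)); last exact/funext.
    by rewrite gipDl gipZl mulN1r.
  apply: le_trans (sqr_Rintegral_gip_le gr_ sgp) _.
  rewrite ler_wpM2r//; first by apply: Rintegral_ge0 => v _; exact: gip_ge0.
  by rewrite eE -!addrA lerDl addr_ge0// addr_ge0.
have -> : \int[mu]_v (im f v * phi v) - \int[mu]_v (im g v * phi v) = \int[mu]_v (im k v * phi v).
  have [sfi _ _] := sFi; have [sgi _ _] := sGi.
  rewrite -RintegralB//; [|exact: integrable_mul|exact: integrable_mul].
  apply: eq_Rintegral => v _; rewrite -mulrBl; congr (_ * _).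
  by rewrite /k /im Im_add Im_mul/= mul0r addr0 mulN1r.
apply: le_trans (sqr_Rintegral_mul_le sqi_ sp) _.
rewrite ler_wpM2r//; first by apply: Rintegral_ge0 => v _; exact: sqr_ge0.
by rewrite eE addrA lerDr addr_ge0// addr_ge0.
Qed.

Hypothesis n2 : (2 < n)%N.
Variables (p : R) (Q : H1 R n).
Hypotheses (p1 : 1 < p) (pn : 0 < n%:R - (n%:R - 2) * ((p + 1) / 2))
  (gQ : ground_state 0 p Q).

Lemma stationary_solution : nls_maximal_solution p Q +oo%E +oo%E (fun=> Q).
Proof.
split; last by move=> Tm Tp u _; rewrite !leey.
split=> //; first by apply: nearW.
move=> t _; split; first exact: cst_continuous.
move=> phi tphi; have [_ _ _ /(_ phi tphi)] := gQ; rewrite mul0r subr0 => ->.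
split; first by split; exact: derivable_cst.
by rewrite /cderive !derive_cst (_ : 0 +i* 0 = 0 :> R[i])// mulr0 sub0r addNr.
Qed.

Lemma stationary_nonscattering : ~ scatters_forward +oo%E (fun=> Q).
Proof.
have n1 : (1 < n)%N by exact: ltnW.
move=> [_ [v0 [w [[_ _ _ fw] cw]]]]; pose phi := @annulus_test R n.
have tphi : test_function phi := test_annulus.
pose G := differential Q; have sQ : sobolev_differential Q G by exact/differentialP/H1_sobolev.
pose P := \int[mu]_v (re Q v `^ p * phi v).
have ip := ground_state_pairing_integrable n2 p1 pn gQ.
have P0 : 0 < P.
  apply: Rintegral_annulus_gt0 ip => //.
    by apply: measurable_powR_comp; have [[[]]] := iffLR (sobolev_differentialP _ _) sQ.
  by move: (ground_state_pos gQ); apply: filterS => v; exact: powR_gt0.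
have PE : \int[mu]_v gip v (fun i => re (G i) v) (fun i => partial i phi v) = P.
  by have := ground_state_weak gQ tphi; rewrite mul0r subr0.
have imQ : \int[mu]_v (im Q v * phi v) = 0.
  have [_ [[mi _] _ _]] := iffLR (sobolev_differentialP _ _) sQ.
  apply: Rintegral_ae0; first by apply: measurable_funM => //; exact: measurable_test.
  by move: (ground_state_im gQ); apply: filterS => v ->; rewrite mul0r.
pose c1 := \int[mu]_v gip v (fun i => partial i phi v) (fun i => partial i phi v).
pose c2 := \int[mu]_v (phi v ^+ 2).
have c10 : 0 <= c1 by apply: Rintegral_ge0 => v _; exact: gip_ge0.
have c20 : 0 <= c2 by apply: Rintegral_ge0 => v _; exact: sqr_ge0.
pose A t : R := complex.Im (l2_pairing (w t) phi).
pose B t : R := \int[mu]_v gip v (fun i => re (differential (w t) i) v) (fun i => partial i phi v).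
(* This is the real part of the weak free equation, the factor i exchanging real and imaginary
   parts. *)
have dA (t : R) : is_derive t 1 A (- B t).
  have tR : (- +oo < t%:E < +oo)%E by rewrite /= ltNyr ltry.
  have [_ /(_ phi tphi)[[_ dI]]] := fw t tR.
  have sw : sobolev_differential (w t) (differential (w t)) by exact/differentialP/H1_sobolev.
  move=> /(congr1 (@complex.Re R)).
  rewrite Re_add Re_add Re_opp Re_mul (dirichlet_pairingE sw tphi) l2_pairingE/=.
  rewrite mul0r mul1r sub0r -/(B t) (_ : \int[mu]_v (re (fun=> 0) v * phi v) = 0); last first.
    apply: Rintegral_ae0.
      by apply: measurable_funM; [exact: measurable_cst|exact: measurable_test tphi].
    by apply: nearW => v; rewrite mul0r.
  rewrite addr0 => /eqP; rewrite subr_eq0 eqr_oppLR => /eqP E.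
  by apply: DeriveDef => //; rewrite -E.
(* Within H^1 distance e of Q, the quantity B differs from P by at most P/2 and |A| is at most 1. *)
have [e e0 [e1 e2]] : exists2 e : R, 0 < e & e ^+ 2 * c1 <= (P / 2) ^+ 2 /\ e ^+ 2 * c2 <= 1.
  pose e := Num.min (P / 2 / (c1 + 1)) (c2 + 1)^-1.
  have h1 : 0 < c1 + 1 by rewrite ltr_wpDl.
  have h2 : 0 < c2 + 1 by rewrite ltr_wpDl.
  have e0 : 0 < e by rewrite lt_min invr_gt0 h2 !divr_gt0.
  have gen (c x : R) : 0 <= c -> 0 <= x -> e <= x / (c + 1) -> e ^+ 2 * c <= x ^+ 2.
    move=> c0 x0 ex; have h : 0 < c + 1 by rewrite ltr_wpDl.
    have : e * (c + 1) <= x by rewrite -ler_pdivlMr.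
    move=> h3; apply: (@le_trans _ _ ((e * (c + 1)) ^+ 2)); last first.
      by rewrite lerXn2r ?nnegrE// mulr_ge0 ?ltW.
    rewrite exprMn ler_wpM2l ?sqr_ge0// -subr_ge0.
    have -> : (c + 1) ^+ 2 - c = c ^+ 2 + c + 1 by ring.
    by rewrite addr_ge0// addr_ge0// sqr_ge0.
  exists e => //; split.
    by apply: gen; rewrite ?divr_ge0 ?(ltW P0)// ge_min lexx.
  have := @gen c2 1 c20 ler01; rewrite expr1n; apply.
  by rewrite div1r ge_min lexx orbT.
have near_e : \forall t \near +oo, `|h1_norm (fun v => w t v - Q v)| < e.
  by move: cw => /cvgr0_norm_lt; apply.
have [T [Treal HT]] := near_e.
have key t : T < t -> B t >= P / 2 /\ `|A t| <= 1.
  move=> /HT/= he; have sw : sobolev_differential (w t) (differential (w t)).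
    exact/differentialP/H1_sobolev.
  have := h1_norm_pairing sw sQ tphi; rewrite -/(B t) PE imQ subr0 -/c1 -/c2.
  set eta := h1_norm _ in he * => -[H1' H2'].
  have ee : eta ^+ 2 <= e ^+ 2.
    by rewrite -[eta ^+ 2]real_normK ?num_real// lerXn2r ?nnegrE// ltW.
  split.
    have : (B t - P) ^+ 2 <= (P / 2) ^+ 2.
      by apply: le_trans H1' _; apply: le_trans e1; rewrite ler_wpM2r.
    rewrite -[leLHS]real_normK ?num_real// ler_sqr ?nnegrE ?divr_ge0 ?(ltW P0)//.
    rewrite ler_norml => /andP[+ _]; rewrite lerBrDr => h; apply: le_trans h.
    by rewrite -subr_ge0 (_ : _ - _ = 0)//; field.
  rewrite -ler_sqr ?nnegrE// real_normK ?num_real// expr1n.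
  rewrite /A l2_pairingE/=; apply: le_trans H2' _; apply: le_trans e2.
  by rewrite ler_wpM2r.
(* On an interval of length 6/P beyond T, the slope at most -P/2 makes A drop by at least 3, while
   |A| <= 1 at both ends allows a drop of 2 only. *)
pose a := T + 1; pose b := a + 6 / P.
have ab : a < b by rewrite ltrDl divr_gt0.
have Ta : T < a by rewrite ltrDl.
have cA : {within `[a, b], continuous A}.
  apply: continuous_subspaceT => t; have [d _] := dA t.
  exact/differentiable_continuous/derivable1_diffP.
have [c cab E] := MVT ab (fun t _ => dA t) cA.
have Tc : T < c by move: cab; rewrite in_itv/= => /andP[ac _]; rewrite (lt_trans Ta).
have [Bc _] := key c Tc; have [_ Aa] := key a Ta.
have [_ Ab] := key b (lt_trans Ta ab).
have : A a - A b >= 3.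
  rewrite -opprB E mulNr opprK /b addrAC subrr add0r.
  apply: le_trans (ler_wpM2r _ Bc); last by rewrite divr_ge0// ltW.
  by rewrite -subr_ge0 (_ : _ - _ = 0)//; field; rewrite gt_eqF.
have : A a - A b <= 2.
  have -> : 2 = 1 + 1 :> R by [].
  apply: lerD; first exact: le_trans (ler_norm _) Aa.
  by rewrite (le_trans (ler_norm _))// normrN.
by move=> h1 h2; have := le_trans h2 h1; rewrite ler_nat.
Qed.

End stationary.

(** * Ground states for very negative lambda *)

Section large_frequency.
Context {R : realType}.
Implicit Types (D C c omega kappa q s Y : R).

(** Division by D > 0 leaves D^(q/2 - 1), whose power 2/(q - 2) is D. Superquadratic growth (q > 2)
    is what turns an upper bound in terms of D into a lower bound on D. *)
Lemma powR_lower_bound D C omega kappa q : 0 < D -> 0 < C -> 0 < omega -> 2 < q ->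
  D <= C * D `^ (q / 2) * omega `^ (- (kappa / 2)) ->
  C `^ (- (2 / (q - 2))) * omega `^ (kappa / (q - 2)) <= D.
Proof.
move=> D0 C0 w0 q2; have q20 : 0 < q - 2 by rewrite subr_gt0.
have e0 : 0 <= 2 / (q - 2) by rewrite divr_ge0// ltW.
rewrite (powR_pred _ D0).
have -> : C * (D * D `^ (q / 2 - 1)) * omega `^ (- (kappa / 2)) =
    D * (C * D `^ (q / 2 - 1) * omega `^ (- (kappa / 2))) by ring.
rewrite -[leLHS]mulr1 ler_pM2l// => h.
have wp : 0 < omega `^ (kappa / 2) by exact: powR_gt0.
have {}h : C^-1 * omega `^ (kappa / 2) <= D `^ (q / 2 - 1).
  rewrite -(ler_pM2l C0) mulrA mulfV ?gt_eqF// mul1r.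
  by rewrite powRN ler_pdivlMr// mul1r in h.
have h0 : 0 <= C^-1 * omega `^ (kappa / 2) by rewrite mulr_ge0// ?invr_ge0 ltW.
have := @ge0_ler_powR R (2 / (q - 2)) e0 _ _ _ _ h; rewrite !nnegrE => /(_ h0 (powR_ge0 _ _)).
rewrite -powRrM (_ : (q / 2 - 1) * (2 / (q - 2)) = 1); last by field; rewrite gt_eqF.
rewrite powRr1 ?(ltW D0)//; apply: le_trans.
have iC0 : 0 <= C^-1 by rewrite invr_ge0 ltW.
rewrite (powRM _ iC0 (ltW wp)) -(powR_inv1 (ltW C0)) -!powRrM mulN1r.
rewrite le_eqVlt; apply/orP; left; apply/eqP; congr (_ * _ `^ _).
by field; rewrite gt_eqF.
Qed.

Lemma powR_superlinear c s Y : 0 < c -> 1 < s -> 0 <= Y ->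
  exists2 omega, 1 <= omega & Y * omega < c * omega `^ s.
Proof.
move=> c0 s1 Y0; have s10 : 0 < s - 1 by rewrite subr_gt0.
(* The value x^(1/(s-1)) solves c omega^(s-1) = Y + 1; the maximum with 1 only improves the
   inequality. *)
pose x := (Y + 1) / c; have x0 : 0 < x by rewrite divr_gt0// ltr_wpDl.
pose omega := Num.max 1 (x `^ (s - 1)^-1).
have w1 : 1 <= omega by rewrite le_max lexx.
have w0 : 0 < omega by exact: lt_le_trans w1.
exists omega => //; rewrite (powR_pred s w0) mulrCA [ltLHS]mulrC ltr_pM2l//; apply: (@lt_le_trans _ _ (Y + 1)); first by rewrite ltrDl.
rewrite mulrC -ler_pdivrMr// -/x.
have -> : x = (x `^ (s - 1)^-1) `^ (s - 1).
  by rewrite -powRrM mulVf ?gt_eqF// powRr1// ltW.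
apply: ge0_ler_powR; rewrite ?nnegrE ?powR_ge0 ?(ltW s10) ?(ltW w0)//.
by rewrite /omega le_max lexx orbT.
Qed.

End large_frequency.

(** By the Nehari identity the power integral equals the squared norm D, and at delta = omega^(-1/2)
    the bracket of the Gagliardo-Nirenberg inequality is D too. The result is D <= C D^(q/2)
    omega^(-kappa/2), to be solved for D. *)
Lemma ground_state_norm_large (R : realType) (n : nat) (p : R) : (2 < n)%N -> 1 < p ->
  0 < n%:R - (n%:R - 2) * ((p + 1) / 2) -> exists2 c : R, 0 < c &
  forall omega (Q : H1 R n), 1 <= omega -> ground_state (- omega) p Q ->
    c * omega `^ ((n%:R - (n%:R - 2) * ((p + 1) / 2)) / (p + 1 - 2)) <=
    Hlam_norm (- omega) Q ^+ 2.
Proof.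
move=> n2 p1 pn; have q2 : 2 < p + 1 by rewrite -[2]/(1 + 1) ltrD2r.
have [C C0 GN] := gagliardo_nirenberg n2 q2 pn.
exists (C `^ (- (2 / (p + 1 - 2)))); first exact: powR_gt0.
move=> omega Q w1 gQ; have w0 : 0 < omega by exact: lt_le_trans w1.
have l0 : - omega <= 0 by rewrite oppr_le0 ltW.
apply: powR_lower_bound => //; first exact: ground_state_norm_gt0 gQ.
have sQ := differentialP (H1_sobolev Q).
have [sQr _] := iffLR (sobolev_differentialP _ _) sQ.
have [_ rQ _ _] := gQ; have [h hQ] := radial_re rQ.
pose delta := omega `^ (- 2^-1).
have d0 : 0 < delta by exact: powR_gt0.
have d2 : delta ^+ 2 = omega^-1.
  rewrite -powR_mulrn ?ltW// -powRrM mulNr mulVf ?pnatr_eq0// powRN powRr1// ltW//.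
have d1 : delta <= 1.
  by rewrite -(@ler_pXn2r _ 2) ?nnegrE ?(ltW d0)// expr1n d2 invf_le1.
have := GN _ _ h delta sQr hQ; rewrite d0 d1 => /(_ isT) I.
have iN := ground_state_power_integrable n2 p1 pn gQ.
rewrite [leLHS](nehari n2 l0 p1 pn gQ) -lee_fin /Rintegral fineK; last first.
  exact: integrable_fin_num.
apply: le_trans I _; rewrite lee_fin le_eqVlt; apply/orP; left; apply/eqP.
rewrite (Hlam_norm_sqr l0 sQ (ground_state_im gQ)) d2 invrK.
congr (_ * _ `^ _ * _); first by rewrite mulNr opprK [X in _ + X]mulrC.
by rewrite -powRrM; congr (_ `^ _); rewrite mulNr mulrC.
Qed.

Theorem proposition1p5 (R : realType) (n : nat) (p : R)
    (hn : (3 <= n)%N) (hp : 1 < p) (hpn : p < 1 + 4 / n%:R) :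
  exists2 lam : R, lam < (n%:R - 1) ^+ 2 / 4 &
    forall (Q : H1 R n) (vc : R -> H1 R n),
      ground_state lam p Q -> critical_element lam p Q vc ->
      energy lam p (vc 0) < energy lam p Q.
Proof.
have n0 : 0 < n%:R :> R by rewrite ltr0n (leq_trans _ hn).
have top : 0 < (n%:R - 1) ^+ 2 / 4 :> R.
  by rewrite divr_gt0// exprn_gt0// subr_gt0 ltr1n (leq_trans _ hn).
pose kappa : R := n%:R - (n%:R - 2) * ((p + 1) / 2).
have np : n%:R * (p - 1) < 4 by rewrite mulrC -ltr_pdivlMr// ltrBlDl.
(* The mass-subcritical condition enters here, through kappa - (p - 1) = 2 - n (p - 1)/2; it makes
   the growth exponent kappa/(p - 1) exceed 1. *)
have kp : p + 1 - 2 < kappa by rewrite /kappa; lra.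
have q20 : 0 < p + 1 - 2 by lra.
have k0 : 0 < kappa by exact: lt_trans kp.
have [H|/existsNP[Q0 /existsNP[vc0 /not_implyP[g0 _]]]] := pselect (forall (Q : H1 R n) (vc : R -> H1 R n),
    ground_state 0 p Q -> critical_element 0 p Q vc -> energy 0 p (vc 0) < energy 0 p Q).
  by exists 0.
have [c c0 large] := ground_state_norm_large hn hp k0.
have s1 : 1 < kappa / (p + 1 - 2) by rewrite ltr_pdivlMr// mul1r.
have sQ0 := differentialP (H1_sobolev Q0); have im0 := ground_state_im g0.
pose A0 := \int[@hyp_measure R n]_v gip v (fun i => re (differential Q0 i) v) (fun i => re (differential Q0 i) v).
pose M0 := \int[@hyp_measure R n]_v (re Q0 v ^+ 2).
have A00 : 0 <= A0 by apply: Rintegral_ge0 => v _; exact: gip_ge0.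
have M00 : 0 <= M0 by apply: Rintegral_ge0 => v _; exact: sqr_ge0.
(* The energy of Q0 is at most X/2, while that of Q is (1/2 - 1/(p+1)) times its squared norm; r is
   the quotient of 1/2 by this factor, so a squared norm above r X suffices to compare energies. *)
pose r := (p + 1) / (p + 1 - 2).
have r1 : 1 <= r by rewrite /r ler_pdivlMr// mul1r; lra.
have r0 : 0 <= r by rewrite (le_trans _ r1).
(* Since omega >= 1, the squared norm X = A0 + omega M0 of Q0 is at most omega (A0 + M0), a linear
   bound beaten by the superlinear growth. *)
have [omega w1 big] := powR_superlinear c0 s1 (mulr_ge0 r0 (addr_ge0 A00 M00)).
have w0 : 0 < omega by exact: lt_le_trans w1.
have l0 : - omega <= 0 by rewrite oppr_le0 ltW.
exists (- omega); first exact: le_lt_trans top.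
move=> Q vc gQ [_ _ _ _ [_ _ scat]]; rewrite ltNge; apply/negP => Ele.
pose X := A0 + omega * M0.
have X0 : 0 <= X by rewrite addr_ge0// mulr_ge0// ltW.
have HX : Hlam_norm (- omega) Q0 ^+ 2 = X by rewrite (Hlam_norm_sqr l0 sQ0 im0) mulNr opprK.
have DX : r * X < Hlam_norm (- omega) Q ^+ 2.
  apply: lt_le_trans (large omega Q w1 gQ); apply: le_lt_trans big.
  rewrite -[leRHS]mulrA ler_wpM2l// mulrDl lerD//; last by rewrite mulrC.
  by rewrite ler_peMr.
have XD : X <= Hlam_norm (- omega) Q ^+ 2 by rewrite (le_trans _ (ltW DX))// ler_peMl.
(* If the energy of [vc 0] were at least that of [Q], then Q0 would lie below the threshold of the
   critical element in energy and in norm, and its stationary solution would have to scatter. *)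
have [] := scat Q0 _ _ _ _ _ _ (stationary_solution g0).
- by have [_ ? _ _] := g0.
- apply: lt_le_trans Ele; rewrite (energy_ground_state hn l0 hp k0 gQ).
  rewrite /energy HX; apply: (@le_lt_trans _ _ (2^-1 * X)).
    by rewrite gerDl oppr_le0 mulr_ge0 ?powR_ge0// invr_ge0; lra.
  have -> : 2^-1 * X = (2^-1 - (p + 1)^-1) * (r * X).
    by rewrite /r; field; rewrite !gt_eqF//; lra.
  rewrite ltr_pM2l// subr_gt0 ltf_pV2 ?posrE//; lra.
- by rewrite -(@ler_pXn2r _ 2) ?nnegrE ?sqrtr_ge0// HX.
- by move=> /(stationary_nonscattering hn hp k0 g0).
Qed.
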